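(* There exists an absolute constant $c_0>0$ such that the following holds. Consider a sequence of problems indexed by $n$ (with $p,\Sigma^*$ and the tuning parameters possibly depending on $n$), with $d\lambda_c=o(1)$ and $d\lambda_{ac}=o(1)$ as $n\to\infty$. Suppose that for each $k=1,\dots,p$ the parameter $\lambda_c$ of the first-stage rank-based CLIME satisfies $$\min\Big\{\frac{\psi_{\min}}{4M},\ \frac1{4M(\psi_{\min}+2\tilde G_k)d}-\frac{2}{Mn}\Big\}\ge\lambda_c\ge\frac{12\pi M}{n},$$ and the parameter $\lambda_{ac}$ of the rank-based adaptive CLIME satisfies $$\frac{\psi_{\min}^2}{8\tilde G_k}\ge\lambda_{ac}\ge\max\Big\{\frac{12\pi}n,\ \Big(2M\lambda_c+\frac1n\Big)\frac{\tilde H_k\psi_{\min}}{\tilde G_k}\Big\},\qquad d\lambda_{ac}\le\min\Big\{\lambda_{\min}(\Sigma^*_{\mathcal A_k\mathcal A_k}),\ \frac1{2\tilde G_k},\ \frac{\psi_{\min}}{4\tilde G_k(\psi_{\min}+\tilde G_k)}\Big\},$$ and that the weight matrix $\mathbf W=\mathbf W^c=(|\hat\Theta^s_c|+\frac1n)^{-1}$ is used. Then with probability at least $$1-p^2\exp\Big(-c_0n\min\Big\{\lambda_{ac}^2,\frac1{M^2}\lambda_c^2\Big\}\Big),$$ the optimal solution $\hat\Theta^s_{ac}=(\hat\theta^{s.ac}_{ij})$ of the rank-based adaptive CLIME is sign consistent, that is, $\operatorname{sign}(\hat\theta^{s.ac}_{ij})=\operatorname{sign}(\theta^*_{ij})$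 for $(i,j)\in\mathcal A$ and $\operatorname{sign}(\hat\theta^{s.ac}_{ij})=0$ for $(i,j)$ with $i\ne j$ and $(i,j)\notin\mathcal A$.
   Context: Model and rank correlation: $X=(X_1,\dots,X_p)$ follows the nonparanormal model, i.e. there are (unknown) univariate monotone increasing functions $f_1,\dots,f_p$ such that $(f_1(X_1),\dots,f_p(X_p))\sim N_p(0,\Sigma^* )$, where $\Sigma^*=(\sigma^*_{ij})$ is positive definite with unit diagonal; $\Theta^*=(\theta^*_{ij})=(\Sigma^* )^{-1}$. One observes $n$ i.i.d. copies $\mathbf x_1,\dots,\mathbf x_n$ of $X$, $\mathbf x_l=(x_{l1},\dots,x_{lp})$. For each $i$ let $(r_{1i},\dots,r_{ni})$ be the ranks of $x_{1i},\dots,x_{ni}$; $\hat r_{ij}$ (Spearman's rank correlation) is the Pearson sample correlation of the rank vectors of variables $i$ and $j$; $\hat r^s_{ij}=2\sin(\frac{\pi}{6}\hat r_{ij})$ and $\hat{\mathbf R}^s=(\hat r^s_{ij})_{1\le i,j\le p}$. First stage (rank-based CLIME with parameter $\lambda_c$): $\hat\Theta^s_c$ is a solution of $\min_\Theta\|\Theta\|_1$ over $p\times p$ matrices subject to $\|\hat{\mathbf R}^s\Theta-\mathbf I\|_{\max}\le\lambda_c$. Second stage (rank-based adaptive CLIME with parameter $\lambda_{ac}$ and weight matrix $\mathbf W$ with positive entries): $\hat\Theta^s_{ac}=\arg\min_\Theta\|\mathbf W\circ\Theta\|_1$ subject to $|\hat{\mathbf R}^s\Theta-\mathbf I|\le\lambda_{ac}\mathbf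 W$, where $\circ$ is the Hadamard product and absolute values, inequalities and the reciprocal in $(|\hat\Theta^s_c|+\frac1n)^{-1}$ are entrywise. Notation: $\mathcal A=\{(i,j):i\ne j,\theta^*_{ij}\ne0\}$ (nonempty), $\psi_{\min}=\min_{(i,j)\in\mathcal A}|\theta^*_{ij}|$; $\mathcal A_k=\{j\ne k:\theta^*_{kj}\ne0\}$, $d=\max_k|\mathcal A_k|$, $\tilde{\mathcal A}_k=\mathcal A_k\cup\{k\}$, $\tilde{\mathcal A}_k^c=\{1,\dots,p\}\setminus\tilde{\mathcal A}_k$. For index sets $U,V$, $\Sigma^*_{UV}$ is the submatrix with rows $U$ and columns $V$ ($\lambda_{\min}$ of an empty matrix is read as $+\infty$). $\tilde G_k=\|(\Sigma^*_{\tilde{\mathcal A}_k\tilde{\mathcal A}_k})^{-1}\|_{\ell_\infty}$, $\tilde H_k=\|\Sigma^*_{\tilde{\mathcal A}_k^c\tilde{\mathcal A}_k}(\Sigma^*_{\tilde{\mathcal A}_k\tilde{\mathcal A}_k})^{-1}\|_{\ell_\infty}$. $M=\|\Theta^*\|_{\ell_1}$. Norms: $\|A\|_1=\sum_{i,j}|a_{ij}|$, $\|A\|_{\max}=\max_{i,j}|a_{ij}|$, $\|A\|_{\ell_1}=\max_j\sum_i|a_{ij}|$, $\|A\|_{\ell_\infty}=\max_i\sum_j|a_{ij}|$. *)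

(* Defs.v *)
(* MathComp + MathComp-Analysis *)
From HB Require Import structures.
From mathcomp Require Import all_boot all_order all_algebra.
From mathcomp Require Import all_classical all_reals all_analysis.

Set Implicit Arguments.
Unset Strict Implicit.
Unset Printing Implicit Defensive.

Import Order.TTheory GRing.Theory Num.Theory.
Import numFieldNormedType.Exports.
Local Open Scope classical_set_scope.
Local Open Scope ring_scope.

Section matrix_notions.
Context {R : realType}.

(* The bigmax's default 0 only matters for matrices with no entries. *)
Definition norm1 {m n} (A : 'M[R]_(m, n)) : R := \sum_i \sum_j `|A i j|.
Definition norm_max {m n} (A : 'M[R]_(m, n)) : R :=
  \big[Num.max/0]_i \big[Num.max/0]_j `|A i j|.
Definition norm_l1 {m n} (A : 'M[R]_(m, n)) : R :=
  \big[Num.max/0]_j \sum_i `|A i j|.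
Definition norm_loo {m n} (A : 'M[R]_(m, n)) : R :=
  \big[Num.max/0]_i \sum_j `|A i j|.

Definition hadamard {m n} (A B : 'M[R]_(m, n)) : 'M[R]_(m, n) :=
  map2_mx *%R A B.

Definition set_submx {p} (U V : {set 'I_p}) (A : 'M[R]_p) : 'M[R]_(#|U|, #|V|) :=
  mxsub (@enum_val _ (mem U)) (@enum_val _ (mem V)) A.

(* Smallest eigenvalue of a symmetric matrix; +oo for the empty matrix, which
   has no eigenvalue. *)
Definition lambda_min {n} (A : 'M[R]_n) : \bar R :=
  ereal_inf [set a%:E | a in [set a : R | eigenvalue A a]].

Definition posdef {p} (S : 'M[R]_p) : Prop :=
  S^T = S /\ forall v : 'rV[R]_p, v != 0 -> 0 < (v *m S *m v^T) 0 0.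

Definition correlation_mx {p} (S : 'M[R]_p) : Prop :=
  posdef S /\ forall i, S i i = 1.

(* T is an optimal solution of: minimize obj over feas. *)
Definition argmin_on {p} (feas : 'M[R]_p -> Prop) (obj : 'M[R]_p -> R)
    (T : 'M[R]_p) : Prop :=
  feas T /\ forall T', feas T' -> obj T <= obj T'.

End matrix_notions.

(* Quantities attached to the correlation matrix S = Sigma^*. *)
Section precision_matrix.
Context {R : realType} {p : nat}.
Implicit Types (S : 'M[R]_p) (k : 'I_p).

Definition Theta S : 'M[R]_p := invmx S.

Definition edges S : {set 'I_p * 'I_p} :=
  [set ij | (ij.1 != ij.2) && (Theta S ij.1 ij.2 != 0)].

(* A minimum when [edges S] is nonempty. *)
Definition psi_min S : R :=
  inf [set `|Theta S ij.1 ij.2| | ij in [set` edges S]].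

Definition adj S k : {set 'I_p} := [set j | (j != k) && (Theta S k j != 0)].
Definition adj1 S k : {set 'I_p} := k |: adj S k.

Definition max_degree S : nat := \max_k #|adj S k|.

Definition G_ S k : R := norm_loo (invmx (set_submx (adj1 S k) (adj1 S k) S)).
Definition H_ S k : R :=
  norm_loo (set_submx (~: adj1 S k) (adj1 S k) S
              *m invmx (set_submx (adj1 S k) (adj1 S k) S)).
Definition M_ S : R := norm_l1 (Theta S).

Definition sign_consistent S (T : 'M[R]_p) : Prop :=
  (forall i j, (i, j) \in edges S -> Num.sg (T i j) = Num.sg (Theta S i j)) /\
  (forall i j, i != j -> (i, j) \notin edges S -> Num.sg (T i j) = 0).

End precision_matrix.

Section spearman.
Context {R : realType} {n p : nat}.

(* Ties, for which every tied observation gets the largest rank here, have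
   probability 0 under the nonparanormal model. *)
Definition rank (x : 'I_n -> R) (l : 'I_n) : nat := #|[pred m | x m <= x l]|.

Definition mean (u : 'I_n -> R) : R := (\sum_l u l) / n%:R.

Definition pearson (u v : 'I_n -> R) : R :=
  (\sum_l (u l - mean u) * (v l - mean v)) /
  (Num.sqrt (\sum_l (u l - mean u) ^+ 2) *
   Num.sqrt (\sum_l (v l - mean v) ^+ 2)).

(* Row l of the data matrix is the l-th observation. *)
Definition spearman (x : 'M[R]_(n, p)) (i j : 'I_p) : R :=
  pearson (fun l => (rank (fun m => x m i) l)%:R)
          (fun l => (rank (fun m => x m j) l)%:R).

Definition Rs (x : 'M[R]_(n, p)) : 'M[R]_p :=
  \matrix_(i, j) (2 * sin (pi / 6 * spearman x i j)).

Definition clime (x : 'M[R]_(n, p)) (lc : R) : 'M[R]_p -> Prop :=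
  argmin_on (fun T => norm_max (Rs x *m T - 1%:M) <= lc) norm1.

Definition aclime (x : 'M[R]_(n, p)) (lac : R) (W : 'M[R]_p) :
    'M[R]_p -> Prop :=
  argmin_on (fun T => forall i j, `|(Rs x *m T - 1%:M) i j| <= lac * W i j)
            (fun T => norm1 (hadamard W T)).

End spearman.

Definition clime_weight {R : realType} {p : nat} (n : nat) (T : 'M[R]_p) :
    'M[R]_p := map_mx (fun t => (`|t| + n%:R^-1)^-1) T.

(* Neither program need have a unique solution, so "the" solution is read as
   existence together with the claim for every solution at each stage. *)
Definition aclime_sign_consistent {R : realType} {n p : nat} (S : 'M[R]_p)
    (lc lac : R) (x : 'M[R]_(n, p)) : Prop :=
  (exists Tc, clime x lc Tc) /\
  forall Tc, clime x lc Tc ->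
    (exists T, aclime x lac (clime_weight n Tc) T) /\
    forall T, aclime x lac (clime_weight n Tc) T -> sign_consistent S T.

Section model.
Context {R : realType}.

(* Y ~ N_p(0, S) for invertible S: Y = A Z with A A^T = S and Z a vector of
   independent N(0, 1) variables.  No extra randomness is needed to write Y in
   this way, since Z = A^-1 Y.  The second parameter of [normal_prob] is the
   standard deviation. *)
Definition multivariate_normal {d} {T : measurableType d}
    (P : probability T R) {p} (Y : 'I_p -> T -> R) (S : 'M[R]_p) : Prop :=
  exists (A : 'M[R]_p) (Z : 'I_p -> {RV P >-> R}),
    [/\ A *m A^T = S,
        forall B : 'I_p -> set R, (forall i, measurable (B i)) ->
          P [set w | forall i, B i (Z i w)] =
          (\prod_i normal_prob (0 : R) 1 (B i))%E
      & forall i w, Y i w = \sum_j A i j * Z j w].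

(* Each transformation f i only has to be increasing (possibly not strictly)
   on an interval carrying X i: asking for monotonicity on the whole line would
   exclude, e.g., uniform margins. *)
Definition nonparanormal {d} {T : measurableType d} (P : probability T R) {p}
    (X : 'I_p -> {RV P >-> R}) (S : 'M[R]_p) : Prop :=
  exists (f : 'I_p -> R -> R) (D : 'I_p -> interval R),
    [/\ forall i, P (X i @^-1` [set` D i]) = 1%E,
        forall i, {in D i &, {homo f i : x y / x <= y}}
      & multivariate_normal P (fun i w => f i (X i w)) S].

(* The rows x l are n i.i.d. copies of the vector X: the joint law of all the
   entries agrees on measurable rectangles with the n-fold power of the law of
   X.  Some B l may be full, so this also gives the laws of the rows. *)
Definition iid_copies {d0} {T0 : measurableType d0} (P0 : probability T0 R)
    {d} {T : measurableType d} (P : probability T R) {n p}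
    (X : 'I_p -> {RV P0 >-> R}) (x : 'I_n -> 'I_p -> {RV P >-> R}) : Prop :=
  forall B : 'I_n -> 'I_p -> set R, (forall l i, measurable (B l i)) ->
    P [set w | forall l i, B l i (x l i w)] =
    (\prod_l P0 [set w | forall i, B l i (X i w)])%E.

(* P(E) >= q, in the sense of inner probability: E is not required to be
   measurable. *)
Definition holds_with_prob {d} {T : measurableType d} (P : probability T R)
    (E : set T) (q : R) : Prop :=
  exists F : set T, [/\ measurable F, F `<=` E & (q%:E <= P F)%E].

End model.

(* Main.v *)
Require Import Defs.
From HB Require Import structures.
From mathcomp Require Import all_boot all_order all_algebra perm.
From mathcomp Require Import all_classical all_reals all_analysis.
From mathcomp Require Import measurable_realfun.
From mathcomp Require Import zify ring lra.

Set Implicit Arguments.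
Unset Strict Implicit.
Unset Printing Implicit Defensive.

Import Order.TTheory GRing.Theory Num.Theory.
Import numFieldNormedType.Exports.
Local Open Scope classical_set_scope.
Local Open Scope ring_scope.

(** The theorem separates into a deterministic part and a probabilistic part
    that meet in one event: that every entry of the rank-based estimate [Rs]
    is within m / 2 of [Sigma], where m = min (lac, lc / M).

    On this event sign consistency is deterministic ([clime_sign_recovery]).
    Both stages split into one linear program per column of the precision
    matrix.  In the first stage the true column is feasible, so the norm of
    the solution is at most M, and this turns the residual bound into an
    entrywise error of at most 2 M lc.  Therefore the adaptive weights are
    bounded on the true support and large, at least 1 / (2 M lc + 1 / n), off
    it.  In the second stage [column_witness] constructs a primal vector and a
    dual vector by solving the optimality equations restricted to the true
    support; the bounds involving G, H and psi show that both extend strictly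
    off the support and that the primal vector is so close to the true column
    that no sign changes.  Complementary slackness ([dantzig_certificate])
    transfers the support to every optimal solution, so no uniqueness has to
    be assumed.

    For the probability of the event ([rank_correlation_concentration]), ranks
    do not see increasing transformations, so that the observations may be
    replaced by a latent Gaussian sample, almost surely without ties
    ([latent_sample], [latent_ties]).  For a sample without ties Spearman's
    correlation is, up to an error of order 1 / n, an affine function of the
    proportion of triples (l, m, m') of distinct observations for which the
    order of l and m in the first variable disagrees with the order of l and
    m' in the second ([spearman_ustat]).  This proportion is a U-statistic,
    whose mean is a probability that two Gaussian linear forms have
    different signs.  Sheppard's formula ([sheppard]) computes it as
    acos (Sigma i j / 2) / pi, and the map 2 sin (pi / 6 * _) is exactly the
    inverse of the resulting relation ([latent_correlation]).

    Sheppard's formula holds because the standard Gaussian measure of the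
    plane is invariant under rotations ([gauss2_rotation], where a rotation is
    a product of three shears), so that the measure of a double sector is an
    additive nonnegative function of its angle, hence linear; plane rotations
    of pairs of coordinates reduce any two linear forms to this case.
    Hoeffding's device gives the concentration ([ustat_concentration]): the
    U-statistic is an average, over permutations of the observations, of
    means of n / 3 independent indicators, and the exponential is convex.  A
    union bound over the p^2 pairs ends the proof; the lower bounds
    12 pi / n and 12 pi M / n on the tuning parameters absorb the error of
    order 1 / n. *)

(** * Vectors, submatrices and norms *)

Section vectors.
Context {R : realType} {p : nat}.
Implicit Types (Q S : 'M[R]_p) (v w : 'I_p -> R) (U : {set 'I_p}).

(** Vectors are plain functions on ['I_p], so that a column of a matrix, a
    restriction to a support and a difference need no conversions. *)
Definition mxapply Q v (j : 'I_p) : R := \sum_i Q j i * v i.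

Definition basis_vec (k j : 'I_p) : R := (j == k)%:R.

Definition supported U v := forall j, j \notin U -> v j = 0.

Definition sup_norm v : R := \big[Num.max/0]_j `|v j|.

Lemma sup_norm_ge v j : `|v j| <= sup_norm v.
Proof. exact: (le_bigmax _ (fun j => `|v j|)). Qed.

Lemma sup_norm_ge0 v : 0 <= sup_norm v.
Proof. exact: bigmax_ge_id. Qed.

Lemma sup_norm_le v (b : R) : 0 <= b -> (forall j, `|v j| <= b) -> sup_norm v <= b.
Proof. by move=> b0 vb; apply/bigmax_leP; split => // j _; exact: vb. Qed.

Lemma mxapplyB Q v w j :
  mxapply Q (fun i => v i - w i) j = mxapply Q v j - mxapply Q w j.
Proof. by rewrite /mxapply -sumrB; apply: eq_bigr => i _; rewrite mulrBr. Qed.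

Lemma mxapplyBl Q S v j : mxapply (Q - S) v j = mxapply Q v j - mxapply S v j.
Proof. by rewrite /mxapply -sumrB; apply: eq_bigr => i _; rewrite !mxE mulrBl. Qed.

Lemma mxapplyE Q (T : 'M[R]_p) j k : (Q *m T) j k = mxapply Q (T^~ k) j.
Proof. by rewrite mxE. Qed.

Lemma mxapply_sym Q v w : Q^T = Q ->
  \sum_j v j * mxapply Q w j = \sum_j mxapply Q v j * w j.
Proof.
move=> Qs; under eq_bigr do rewrite mulr_sumr.
rewrite exchange_big /=; apply: eq_bigr => i _; rewrite mulr_suml.
by apply: eq_bigr => j _; rewrite -[in RHS]Qs mxE; ring.
Qed.

Lemma mxapply_supported U Q v j : supported U v ->
  mxapply Q v j = \sum_(i in U) Q j i * v i.
Proof.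
move=> vU; rewrite /mxapply (bigID (mem U)) /= [X in _ + X]big1 ?addr0//.
by move=> i /vU ->; rewrite mulr0.
Qed.

Lemma mxapply_le Q v j (b : R) : (forall i, `|v i| <= b) ->
  `|mxapply Q v j| <= (\sum_i `|Q j i|) * b.
Proof.
move=> vb; rewrite /mxapply mulr_suml (le_trans (ler_norm_sum _ _ _))//.
by apply: ler_sum => i _; rewrite normrM ler_wpM2l.
Qed.

Lemma norm_loo_ge m n (A : 'M[R]_(m, n)) i : \sum_j `|A i j| <= norm_loo A.
Proof. exact: (le_bigmax _ (fun i => \sum_j `|A i j|)). Qed.

Lemma norm_l1_ge m n (A : 'M[R]_(m, n)) j : \sum_i `|A i j| <= norm_l1 A.
Proof. exact: (le_bigmax _ (fun j => \sum_i `|A i j|)). Qed.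

Lemma norm_max_leP m n (A : 'M[R]_(m, n)) c : 0 <= c ->
  norm_max A <= c <-> forall i j, `|A i j| <= c.
Proof.
move=> c0; split=> [Ac i j|Ac].
  apply: le_trans Ac.
  apply: le_trans (le_bigmax _ (fun i => \big[Num.max/0]_j `|A i j|) i).
  exact: (le_bigmax _ (fun j => `|A i j|)).
apply/bigmax_leP; split => // i _; apply/bigmax_leP; split => // j _.
Qed.

Lemma norm_loo_ge0 m n (A : 'M[R]_(m, n)) : 0 <= norm_loo A.
Proof. exact: bigmax_ge_id. Qed.

Definition restrict_vec U v : 'cV[R]_#|U| := \col_a v (enum_val a).

Lemma set_submx_restrict U V Q v b : supported U v ->
  (set_submx V U Q *m restrict_vec U v) b 0 = mxapply Q v (enum_val b).
Proof.
move=> vU; rewrite (mxapply_supported _ _ vU) mxE [RHS]big_enum_val /=.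
by apply: eq_bigr => i _; rewrite !mxE.
Qed.

(** The restriction of [v] to [U] is the inverse of the submatrix applied to
    the values of [S v] on [U]; the row sums of that inverse give the
    constant.  For the true support this constant is [G_]. *)
Lemma inv_set_submx_bound U S v (b : R) j : set_submx U U S \in unitmx ->
  supported U v -> 0 <= b -> (forall i, i \in U -> `|mxapply S v i| <= b) ->
  `|v j| <= norm_loo (invmx (set_submx U U S)) * b.
Proof.
move=> Su vU b0 Svb.
have [jU|/vU ->] := boolP (j \in U); last by rewrite normr0 mulr_ge0// norm_loo_ge0.
have -> : v j = restrict_vec U v (enum_rank_in jU j) 0.
  by rewrite mxE enum_rankK_in.
rewrite -[restrict_vec U v](mulKmx Su) mxE.
apply: (le_trans (ler_norm_sum _ _ _)).
apply: (@le_trans _ _ (\sum_a `|invmx (set_submx U U S) (enum_rank_in jU j) a| * b)).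
  apply: ler_sum => a _; rewrite normrM ler_wpM2l//.
  by rewrite set_submx_restrict// Svb// enum_valP.
by rewrite -mulr_suml ler_wpM2r// norm_loo_ge.
Qed.

(** The values of [S v] off [U] are the image of its values on [U] under the
    matrix whose row sums define [H_]. *)
Lemma off_set_submx_bound U S v (b : R) j : set_submx U U S \in unitmx ->
  supported U v -> 0 <= b -> (forall i, i \in U -> `|mxapply S v i| <= b) ->
  j \notin U ->
  `|mxapply S v j|
    <= norm_loo (set_submx (~: U) U S *m invmx (set_submx U U S)) * b.
Proof.
move=> Su vU b0 Svb jU'; have jU : j \in ~: U by rewrite finset.in_setC.
have -> : mxapply S v j
    = (set_submx (~: U) U S *m restrict_vec U v) (enum_rank_in jU j) 0.
  by rewrite set_submx_restrict// enum_rankK_in.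
rewrite -[restrict_vec U v](mulKmx Su) (mulmxA (set_submx (~: U) U S)) mxE.
apply: (le_trans (ler_norm_sum _ _ _)).
set B := _ *m invmx _.
apply: (@le_trans _ _ (\sum_a `|B (enum_rank_in jU j) a| * b)).
  apply: ler_sum => a _; rewrite normrM ler_wpM2l//.
  by rewrite set_submx_restrict// Svb// enum_valP.
by rewrite -mulr_suml ler_wpM2r// norm_loo_ge.
Qed.

Definition extend_vec U (w : 'cV[R]_#|U|) (j : 'I_p) : R :=
  \sum_(a | enum_val a == j) w a 0.

Lemma extend_vecK U (w : 'cV[R]_#|U|) a : extend_vec w (enum_val a) = w a 0.
Proof. by apply: big_pred1 => c; rewrite (inj_eq enum_val_inj). Qed.

Lemma extend_vec_supported U (w : 'cV[R]_#|U|) : supported U (extend_vec w).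
Proof.
move=> j jU; apply: big_pred0 => a; apply: contraNF jU => /eqP <-.
exact: enum_valP.
Qed.

Lemma restrict_extend U (w : 'cV[R]_#|U|) : restrict_vec U (extend_vec w) = w.
Proof. by apply/colP => a; rewrite mxE extend_vecK. Qed.

Lemma unitmx_inj m (A : 'M[R]_m) :
  (forall v : 'cV[R]_m, A *m v = 0 -> v = 0) -> A \in unitmx.
Proof.
move=> Ainj; rewrite -unitmx_tr -row_free_unit; apply: inj_row_free => v vA.
apply: trmx_inj; rewrite trmx0; apply: Ainj.
by rewrite -[A]trmxK -trmx_mul vA trmx0.
Qed.

(** Injectivity is only asked on vectors supported in [U]: this form applies
    to a small perturbation of [S], whose submatrix is controlled through its
    action on such vectors and not through its eigenvalues. *)
Lemma set_submx_unit U Q :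
  (forall v, supported U v -> (forall j, j \in U -> mxapply Q v j = 0) ->
     forall j, v j = 0) ->
  set_submx U U Q \in unitmx.
Proof.
move=> Qinj; apply: unitmx_inj => w Qw; apply/colP => a.
rewrite -extend_vecK mxE; apply: Qinj; first exact: extend_vec_supported.
move=> j jU; rewrite -(enum_rankK_in jU jU).
rewrite -(set_submx_restrict Q _ (extend_vec_supported w)).
by rewrite restrict_extend Qw mxE.
Qed.

Lemma set_submx_solve U Q (g : 'I_p -> R) : set_submx U U Q \in unitmx ->
  exists2 v, supported U v & forall j, j \in U -> mxapply Q v j = g j.
Proof.
move=> Qu; exists (extend_vec (invmx (set_submx U U Q) *m restrict_vec U g)).
  exact: extend_vec_supported.
move=> j jU; rewrite -(enum_rankK_in jU jU).
rewrite -(set_submx_restrict Q _ (extend_vec_supported _)).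
by rewrite restrict_extend mulKVmx// mxE.
Qed.

Definition quad_form S v : R := \sum_i v i * mxapply S v i.

Lemma posdef_quad_form S v : posdef S -> (exists j, v j != 0) ->
  0 < quad_form S v.
Proof.
case=> Ss Spos [j vj].
have := Spos (\row_i v i); rewrite mxE; have -> : (\row_i v i) != 0 :> 'rV[R]_p.
  by apply/eqP => /rowP /(_ j); rewrite !mxE; apply/eqP.
move=> /(_ isT); rewrite /quad_form; congr (_ < _); apply: eq_bigr => i _.
rewrite !mxE mulrC; congr (_ * _); apply: eq_bigr => l _.
by rewrite mxE -[in RHS]Ss mxE mulrC.
Qed.

Lemma posdef_set_submx_unit U S : posdef S -> set_submx U U S \in unitmx.
Proof.
move=> Sp; apply: set_submx_unit => v vU Sv0 j; apply/eqP/negPn/negP => vj.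
have := posdef_quad_form Sp (ex_intro _ j vj); rewrite /quad_form big1 ?ltxx//.
by move=> i _; have [/Sv0 ->|/vU ->] := boolP (i \in U); rewrite ?mulr0 ?mul0r.
Qed.

Lemma posdef_unitmx S : posdef S -> S \in unitmx.
Proof.
move=> Sp; apply: unitmx_inj => v Sv0; apply/colP => j; rewrite mxE.
apply/eqP/negPn/negP => vj.
have := posdef_quad_form (v := fun i => v i 0) Sp (ex_intro _ j vj).
rewrite /quad_form big1 ?ltxx// => i _.
have /colP/(_ i) := Sv0; rewrite !mxE => Svi.
by rewrite /mxapply Svi mulr0.
Qed.

End vectors.

(** * Primal-dual witnesses of weighted Dantzig programs *)

Section weighted_dantzig.
Context {R : realType} {p : nat}.
Implicit Types (Q S : 'M[R]_p) (u v w b : 'I_p -> R).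

(** The constraints and the objective of the linear program that estimates
    column [k]: unit weights give the first stage, the adaptive weights of
    column [k] the second. *)
Definition dantzig_feasible Q (lam : R) w (k : 'I_p) b :=
  forall j, `|mxapply Q b j - basis_vec k j| <= lam * w j.

Definition weighted_l1 w b : R := \sum_j w j * `|b j|.

Lemma basis_vecE k u : \sum_j @basis_vec R p k j * u j = u k.
Proof.
rewrite (bigD1 k) //= /basis_vec eqxx mul1r big1 ?addr0// => j /negbTE ->.
by rewrite mul0r.
Qed.

(** A vector [u] with |Q u| <= w is feasible for the dual program, with value
    u k - lam * |u|_w; pairing the constraint on [b] with [u] bounds this
    value. *)
Lemma dantzig_weak_duality Q lam w k u b : Q^T = Q ->
  (forall j, `|mxapply Q u j| <= w j) -> dantzig_feasible Q lam w k b ->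
  u k - lam * weighted_l1 w u <= \sum_j mxapply Q u j * b j.
Proof.
move=> Qs uw bf; rewrite (eq_bigr (fun j => b j * mxapply Q u j)); last first.
  by move=> j _; rewrite mulrC.
rewrite mxapply_sym// -{1}(basis_vecE k u) /weighted_l1 mulr_sumr -sumrB.
apply: ler_sum => j _.
have : - (lam * w j * `|u j|) <= (mxapply Q b j - basis_vec k j) * u j.
  rewrite lerNl (le_trans (ler_norm _))// normrN normrM ler_wpM2r//.
by rewrite /basis_vec; lra.
Qed.

(** If [beta] and [u] satisfy the complementary slackness equations, their
    values coincide, so that [beta] is optimal.  Any other optimal [b] has the
    same value, which forces w j |b j| = (Q u) j * b j for every [j], and so
    [b] vanishes where the dual constraint is strict.  In this way sparsity of
    one solution passes to all of them. *)
Lemma dantzig_certificate Q lam w k u beta : Q^T = Q ->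
  (forall j, `|mxapply Q u j| <= w j) ->
  (forall j, mxapply Q u j * beta j = w j * `|beta j|) ->
  (forall j, (mxapply Q beta j - basis_vec k j) * u j = - (lam * (w j * `|u j|))) ->
  (forall b, dantzig_feasible Q lam w k b -> weighted_l1 w beta <= weighted_l1 w b) /\
  (forall b, dantzig_feasible Q lam w k b -> weighted_l1 w b <= weighted_l1 w beta ->
     forall j, `|mxapply Q u j| < w j -> b j = 0).
Proof.
move=> Qs uw ub bu.
have betaE : weighted_l1 w beta = u k - lam * weighted_l1 w u.
  rewrite /weighted_l1; under eq_bigr do rewrite -ub mulrC.
  rewrite mxapply_sym// -[in RHS](basis_vecE k u) mulr_sumr -sumrB.
  by apply: eq_bigr => j _; have := bu j; lra.
have Qub b j : mxapply Q u j * b j <= w j * `|b j|.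
  by rewrite (le_trans (ler_norm _))// normrM ler_wpM2r.
split=> [b bf|b bf b_opt j uwj].
  rewrite betaE (le_trans (dantzig_weak_duality Qs uw bf))//.
  by apply: ler_sum => j _; exact: Qub.
have /eqP : \sum_i (w i * `|b i| - mxapply Q u i * b i) = 0.
  apply/eqP; rewrite eq_le; apply/andP; split; last first.
    by apply: sumr_ge0 => i _; rewrite subr_ge0 Qub.
  rewrite sumrB subr_le0 (le_trans b_opt)// betaE.
  exact: dantzig_weak_duality.
rewrite psumr_eq0; last by move=> i _; rewrite subr_ge0 Qub.
move=> /allP /(_ j (mem_index_enum _)) /=; rewrite subr_eq0 => /eqP bj.
apply/eqP/negPn/negP => bj0.
have : mxapply Q u j * b j < w j * `|b j|.
  by rewrite (le_lt_trans (ler_norm _))// normrM ltr_pM2r// normr_gt0.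
by rewrite -bj ltxx.
Qed.

(** The primal-dual witness for one column.  Here [th] is the true column,
    [U] its support together with [k], and [Q] a perturbation of [S] by at
    most [delta]; [wm] bounds the weights on [U] from above and [om] their
    inverses off [U]. *)
Section column.
Variables (S Q : 'M[R]_p) (U : {set 'I_p}) (k : 'I_p) (th w : 'I_p -> R).
Variables (G H psi lam delta d M om wm : R).
Hypothesis Qs : Q^T = Q.
Hypothesis kU : k \in U.
Hypothesis G_bound : forall v (b : R), supported U v -> 0 <= b ->
  (forall j, j \in U -> `|mxapply S v j| <= b) -> forall j, `|v j| <= G * b.
Hypothesis H_bound : forall v (b : R), supported U v -> 0 <= b ->
  (forall j, j \in U -> `|mxapply S v j| <= b) ->
  forall j, j \notin U -> `|mxapply S v j| <= H * b.
(* Without the factor 2 of [D_bound]: the diagonal of [Q - S] vanishes, so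
   that a row in [U] meets only d of the at most d + 1 elements of [U]. *)
Hypothesis D_boundU : forall v (b : R), supported U v -> 0 <= b ->
  (forall j, `|v j| <= b) -> forall j, j \in U ->
  `|mxapply (Q - S) v j| <= d * delta * b.
Hypothesis D_bound : forall v (b : R), supported U v -> 0 <= b ->
  (forall j, `|v j| <= b) -> forall j,
  `|mxapply (Q - S) v j| <= 2 * (d * delta) * b.
Hypothesis D_th : forall j, `|mxapply (Q - S) th j| <= delta * M.
Hypothesis thU : supported U th.
Hypothesis Sth : forall j, mxapply S th j = basis_vec k j.
Hypothesis th_le : forall j, `|th j| <= G.
Hypothesis th_psi : forall j, j \in U -> j != k -> psi <= `|th j|.
Hypothesis th_k : 1 <= th k.
Hypothesis w_gt0 : forall j, 0 < w j.
Hypothesis w_le : forall j, j \in U -> w j <= wm.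
Hypothesis w_ge : forall j, j \notin U -> om^-1 <= w j.
Hypothesis G_gt0 : 0 < G.
Hypothesis psi_gt0 : 0 < psi.
Hypothesis lam_gt0 : 0 < lam.
Hypothesis om_gt0 : 0 < om.
Hypothesis d_gt0 : 0 < d.
Hypothesis delta_ge0 : 0 <= delta.
Hypothesis M_ge0 : 0 <= M.
Hypothesis g_psi : G * (lam * wm) <= psi / 3.
Hypothesis g_half : G * (lam * wm) <= 1 / 2.
Hypothesis Gd : G * (d * delta) <= 1 / 4.
Hypothesis Gdpsi : G * (d * delta * (psi + G)) <= psi / 8.
Hypothesis GdM : G * (delta * M) <= 1 / 16.
(* The irrepresentability condition, in the form in which the lower bound on
   lambda_ac provides it. *)
Hypothesis Hom : H * om * psi <= lam * G.
Hypothesis dom : 2 * (d * om * (psi + 2 * G)) <= 1.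
Hypothesis delta_lam : delta <= lam / 2.

Let dd_ge0 : 0 <= d * delta. Proof. by rewrite mulr_ge0// ltW. Qed.

Lemma wm_gt0 : 0 < wm. Proof. exact: lt_le_trans (w_gt0 k) (w_le kU). Qed.

(** If [v] is supported in [U] and [Q v] vanishes there, then [S v] is at most
    d delta |v| on [U], hence |v| <= G d delta |v| <= |v| / 4. *)
Lemma column_Q_unit : set_submx U U Q \in unitmx.
Proof.
apply: set_submx_unit => v vU Qv0 j.
have e0 := sup_norm_ge0 v; set e := sup_norm v in e0.
have ve i : `|v i| <= e by exact: sup_norm_ge.
have Sv i : i \in U -> `|mxapply S v i| <= d * delta * e.
  move=> iU; have := D_boundU vU e0 ve iU.
  by rewrite mxapplyBl Qv0// sub0r normrN.
have : e <= G * (d * delta * e).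
  apply: sup_norm_le; first by rewrite !mulr_ge0// ltW.
  by apply: G_bound => //; rewrite mulr_ge0.
move=> eG; have {}eG : e <= 1/4 * e.
  apply: (le_trans eG); rewrite mulrA; exact: ler_wpM2r.
have : e = 0 by lra.
by move=> e00; apply/eqP; rewrite -normr_le0 -e00.
Qed.

(** The error [v] satisfies |v| <= G (lam wm + d delta |v| + r), where [r]
    comes from (Q - S) th; since G d delta <= 1 / 4 the middle term is
    absorbed.  The bound by [psi] preserves the signs of the neighbours, the
    bound by 1 the sign of the diagonal entry. *)
Lemma column_error b : supported U b ->
  (forall j, j \in U -> `|mxapply Q b j - basis_vec k j| <= lam * w j) ->
  forall j, `|b j - th j| < psi /\ `|b j - th j| < 1.
Proof.
move=> bU bf.
pose v j := b j - th j.
have vU : supported U v by move=> j jU; rewrite /v bU// thU// subrr.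
have e0 := sup_norm_ge0 v; set e := sup_norm v in e0.
have ve i : `|v i| <= e by exact: sup_norm_ge.
(* Two bounds on (Q - S) th are available; the first is compared with [psi],
   the second with 1. *)
pose r := Num.min (d * delta * G) (delta * M).
have r0 : 0 <= r by rewrite le_min !mulr_ge0// ltW.
have Sv j : j \in U -> `|mxapply S v j| <= lam * wm + d * delta * e + r.
  move=> jU.
  have -> : mxapply S v j = (mxapply Q b j - basis_vec k j)
      - mxapply (Q - S) v j - mxapply (Q - S) th j.
    by rewrite !mxapplyBl /v !mxapplyB Sth; ring.
  rewrite (le_trans (ler_normB _ _))// lerD//; last first.
    rewrite le_min D_th andbT; apply: D_boundU => //; exact: ltW.
  rewrite (le_trans (ler_normB _ _))// lerD//; last exact: D_boundU.
  by rewrite (le_trans (bf _ jU))// ler_wpM2l// ?w_le// ltW.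
have wm0 := ltW wm_gt0.
have : e <= G * (lam * wm + d * delta * e + r).
  apply: sup_norm_le.
    by rewrite mulr_ge0 ?addr_ge0 ?mulr_ge0// ltW.
  by apply: G_bound => //; rewrite !addr_ge0 ?mulr_ge0// ltW.
have Gr1 : G * r <= psi / 8.
  apply: le_trans Gdpsi; rewrite ler_pM2l// ge_min; apply/orP; left.
  by rewrite ler_wpM2l// lerDr ltW.
have Gr2 : G * r <= 1 / 16.
  by apply: le_trans GdM; rewrite ler_pM2l// ge_min lexx orbT.
have Gde : G * (d * delta * e) <= 1/4 * e by rewrite mulrA ler_wpM2r.
move=> eb; have {}eb : e <= G * (lam * wm) + 1/4 * e + G * r.
  by apply: (le_trans eb); rewrite !mulrDr !lerD2r lerD2l.
have [e1 e2] : e < psi /\ e < 1.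
  move: eb Gr1 Gr2 g_psi g_half psi_gt0; move: (G * r) (G * (lam * wm)) => x y.
  by move=> h1 h2 h3 h4 h5 h6; split; lra.
by move=> j; split; apply: le_lt_trans (ve j) _.
Qed.

Lemma sgr_close (a c : R) : `|a - c| < `|c| -> Num.sg a = Num.sg c.
Proof.
have [c0|c0|->] := ltgtP c 0.
- rewrite (ltr0_norm c0) ltr_norml => /andP[_ h].
  by rewrite (ltr0_sg c0) ltr0_sg//; lra.
- rewrite (gtr0_norm c0) ltr_norml => /andP[h _].
  by rewrite (gtr0_sg c0) gtr0_sg//; lra.
- by rewrite normr0 normr_lt0.
Qed.

Lemma column_sign b : supported U b ->
  (forall j, j \in U -> `|mxapply Q b j - basis_vec k j| <= lam * w j) ->
  forall j, j \in U -> Num.sg (b j) = Num.sg (th j).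
Proof.
move=> bU bf j jU; have [b1 b2] := column_error bU bf j.
apply: sgr_close; have [jk|jk] := eqVneq j k.
  by apply: lt_le_trans b2 _; rewrite jk (le_trans th_k)// ler_norm.
by apply: lt_le_trans b1 (th_psi jU jk).
Qed.

Lemma th_neq0 j : j \in U -> th j != 0.
Proof.
move=> jU; rewrite -normr_gt0; have [->|jk] := eqVneq j k.
  by rewrite (lt_le_trans _ (ler_norm _))// (lt_le_trans _ th_k).
exact: lt_le_trans (th_psi jU jk).
Qed.

(** How the lower bound on the weights off [U] is used: after multiplication
    by [om] it is a bound by 1. *)
Lemma weight_lb (x : R) j : j \notin U -> om * x <= 1 -> x <= w j.
Proof.
move=> jU omx; apply: le_trans (w_ge jU).
by rewrite -(ler_pM2l om_gt0) divff// gt_eqF.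
Qed.

(** The irrepresentability condition H om psi <= lam G converts a bound on
    G x, in units of [psi], into one on H om x, in units of [lam]. *)
Lemma irrepresentable_le x c : 0 <= x -> G * x <= c * psi -> H * om * x <= c * lam.
Proof.
move=> x0 Gx; rewrite -(ler_pM2r psi_gt0).
apply: (@le_trans _ _ (lam * G * x)).
  by rewrite mulrAC ler_wpM2r.
by rewrite -mulrA [leRHS]mulrAC [leRHS]mulrC ler_pM2l.
Qed.

(** Off [U] the residual is S (b - th) + (Q - S) b.  Relative to
    lam / om <= lam w j its parts amount to at most 1/3 + 1/8 for the first
    term and 1/2 for the second. *)
Lemma column_primal_off b : supported U b ->
  (forall j, j \in U -> `|mxapply Q b j - basis_vec k j| <= lam * w j) ->
  forall j, j \notin U -> `|mxapply Q b j| <= lam * w j.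
Proof.
move=> bU bf j jU.
have bb i : `|b i| <= psi + G.
  rewrite (le_trans _ (lerD (ltW (column_error bU bf i).1) (th_le i)))//.
  by rewrite -{1}(subrK (th i) (b i)) ler_normD.
pose v j := b j - th j.
have vU : supported U v by move=> i iU; rewrite /v bU// thU// subrr.
have pG0 : 0 <= psi + G by rewrite ltW// addr_gt0.
have jk : j != k by apply: contraNneq jU => ->.
have wm0 := ltW wm_gt0.
have Sv i : i \in U -> `|mxapply S v i| <= lam * wm + d * delta * (psi + G).
  move=> iU.
  have -> : mxapply S v i = (mxapply Q b i - basis_vec k i)
      - mxapply (Q - S) b i.
    by rewrite !mxapplyBl /v !mxapplyB Sth; ring.
  rewrite (le_trans (ler_normB _ _))// lerD//; last exact: D_boundU.
  by rewrite (le_trans (bf _ iU))// ler_wpM2l// ?w_le// ltW.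
have -> : mxapply Q b j = mxapply S v j + mxapply (Q - S) b j.
  rewrite !mxapplyBl /v !mxapplyB Sth /basis_vec (negbTE jk) subr0; ring.
have Svj : `|mxapply S v j| <= H * (lam * wm + d * delta * (psi + G)).
  by apply: H_bound => //; rewrite addr_ge0 ?mulr_ge0// ltW.
have Dvj : `|mxapply (Q - S) b j| <= 2 * (d * delta) * (psi + G).
  exact: D_bound.
rewrite (le_trans (ler_normD _ _))// (le_trans (lerD Svj Dvj))//.
rewrite -ler_pdivrMl//; apply: weight_lb => //.
rewrite mulrCA ler_pdivrMl// mulr1.
have h1 : H * om * (lam * wm) <= 1/3 * lam.
  by apply: irrepresentable_le; [rewrite mulr_ge0// ltW|move: g_psi; lra].
have h2 : H * om * (d * delta * (psi + G)) <= 1/8 * lam.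
  by apply: irrepresentable_le; [rewrite mulr_ge0//|move: Gdpsi; lra].
have h3 : om * (2 * (d * delta) * (psi + G)) <= 1/2 * lam.
  have h : d * om * (psi + G) <= 1/2.
    apply: (@le_trans _ _ (d * om * (psi + 2 * G))); last by move: dom; lra.
    by rewrite ler_pM2l ?mulr_gt0// lerD2l ler_peMl ?ler1n// ltW.
  have -> : om * (2 * (d * delta) * (psi + G)) = 2 * delta * (d * om * (psi + G)).
    ring.
  have l0 := lam_gt0; have dl2 : 2 * delta <= lam by move: delta_lam; lra.
  have : d * om * (psi + G) >= 0 by rewrite !mulr_ge0// ltW.
  move: (d * om * (psi + G)) h => x; nra.
have l0 := lam_gt0.
by move: h1 h2 h3; rewrite !mulrDr; lra.
Qed.

(** The dual vector has size at most (4/3) G wm.  Off [U] the parts of [Q u]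
    amount, relative to 1 / om <= w j, to at most 1/3, 1/6 and 1/3, which
    leaves a strict inequality. *)
Lemma column_dual_off u : supported U u ->
  (forall j, j \in U -> mxapply Q u j = w j * Num.sg (th j)) ->
  forall j, j \notin U -> `|mxapply Q u j| < w j.
Proof.
move=> uU uE j jU.
have mu0 := sup_norm_ge0 u; set mu := sup_norm u in mu0.
have umu i : `|u i| <= mu by exact: sup_norm_ge.
have wm0 := ltW wm_gt0.
have Su i : i \in U -> `|mxapply S u i| <= wm + d * delta * mu.
  move=> iU.
  have -> : mxapply S u i = w i * Num.sg (th i) - mxapply (Q - S) u i.
    by rewrite !mxapplyBl uE//; ring.
  rewrite (le_trans (ler_normB _ _))// lerD//; last exact: D_boundU.
  rewrite normrM normr_sg th_neq0// mulr1 gtr0_norm//; exact: w_le.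
have : mu <= G * (wm + d * delta * mu).
  apply: sup_norm_le.
    by rewrite mulr_ge0 ?addr_ge0 ?mulr_ge0// ltW.
  by apply: G_bound => //; rewrite !addr_ge0 ?mulr_ge0// ltW.
have Gde : G * (d * delta * mu) <= 1/4 * mu by rewrite mulrA ler_wpM2r.
rewrite mulrDr => mub; have {}mub : mu <= 4/3 * (G * wm) by lra.
have Suj : `|mxapply S u j| <= H * (wm + d * delta * mu).
  by apply: H_bound => //; rewrite addr_ge0 ?mulr_ge0// ltW.
have Duj : `|mxapply (Q - S) u j| <= 2 * (d * delta) * mu by exact: D_bound.
have -> : mxapply Q u j = mxapply S u j + mxapply (Q - S) u j.
  by rewrite mxapplyBl; ring.
rewrite (le_lt_trans (ler_normD _ _))// (le_lt_trans (lerD Suj Duj))//.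
apply: lt_le_trans (w_ge jU).
rewrite -(ltr_pM2l om_gt0) divff ?gt_eqF//.
rewrite -(ltr_pM2l lam_gt0) mulr1.
have h1 : H * om * (lam * wm) <= 1/3 * lam.
  by apply: irrepresentable_le; [rewrite mulr_ge0// ltW|move: g_psi; lra].
have h2 : H * om * (lam * (d * delta * mu)) <= 1/6 * lam.
  apply: irrepresentable_le; first by rewrite !mulr_ge0// ltW.
  have -> : G * (lam * (d * delta * mu)) = lam * (G * (d * delta)) * mu by ring.
  have : lam * mu <= 4/3 * (G * (lam * wm)).
    have -> : 4/3 * (G * (lam * wm)) = lam * (4/3 * (G * wm)) by ring.
    by rewrite ler_pM2l.
  have lmu : 0 <= lam * mu by rewrite mulr_ge0// ltW.
  have -> : lam * (G * (d * delta)) * mu = G * (d * delta) * (lam * mu) by ring.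
  have := ler_wpM2r lmu Gd.
  move: (G * (d * delta) * (lam * mu)) (lam * mu) lmu (G * (lam * wm)) g_psi.
  by move=> x y y0 z zp xy yz; have := psi_gt0; lra.
have h3 : lam * (om * (2 * (d * delta) * mu)) <= 1/3 * lam.
  have h : d * om * psi <= 1/2.
    apply: (@le_trans _ _ (d * om * (psi + 2 * G))); last by move: dom; lra.
    by rewrite ler_pM2l ?mulr_gt0// lerDl mulr_ge0// ltW.
  have l1 : lam * mu <= 4/9 * psi.
    apply: (@le_trans _ _ (4/3 * (G * (lam * wm)))); last by move: g_psi; lra.
    have -> : 4/3 * (G * (lam * wm)) = lam * (4/3 * (G * wm)) by ring.
    by rewrite ler_pM2l.
  have -> : lam * (om * (2 * (d * delta) * mu)) = 2 * delta * (d * om * (lam * mu)).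
    ring.
  have l2 : d * om * (lam * mu) <= 2 / 9.
    apply: (@le_trans _ _ (d * om * (4/9 * psi))); last by lra.
    by rewrite ler_wpM2l// mulr_ge0// ltW.
  have l3 : 0 <= d * om * (lam * mu) by rewrite !mulr_ge0// ltW.
  have l0 := lam_gt0; have dl2 : 2 * delta <= lam by move: delta_lam; lra.
  move: (d * om * (lam * mu)) l2 l3 => x l2 l3.
  nra.
have -> : lam * (om * (H * (wm + d * delta * mu) + 2 * (d * delta) * mu))
  = H * om * (lam * wm) + H * om * (lam * (d * delta * mu))
    + lam * (om * (2 * (d * delta) * mu)) by ring.
have l0 := lam_gt0.
by lra.
Qed.

(** On [U], the dual vector [u] solves Q u = w sgn th and the primal vector
    [beta] solves Q beta = e_k - lam w sgn u.  These are the slackness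
    equations of [dantzig_certificate], provided that sgn beta = sgn th on
    [U]; that is [column_sign], and the two preceding lemmas give feasibility
    off [U]. *)
Lemma column_witness : exists beta,
  [/\ dantzig_feasible Q lam w k beta,
      forall b, dantzig_feasible Q lam w k b ->
        weighted_l1 w beta <= weighted_l1 w b
    & forall b, dantzig_feasible Q lam w k b ->
        weighted_l1 w b <= weighted_l1 w beta ->
        supported U b /\ (forall j, j \in U -> Num.sg (b j) = Num.sg (th j))].
Proof.
have [u uU uE] := set_submx_solve (fun j => w j * Num.sg (th j)) column_Q_unit.
have [beta bU bE] := set_submx_solve
  (fun j => basis_vec k j - lam * (w j * Num.sg (u j))) column_Q_unit.
have bf j : j \in U -> `|mxapply Q beta j - basis_vec k j| <= lam * w j.
  move=> jU; rewrite bE// addrC addKr normrN normrM (gtr0_norm lam_gt0).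
  rewrite normrM (gtr0_norm (w_gt0 j)) normr_sg ler_pM2l// ler_piMr//.
    exact: ltW.
  by case: (_ != _).
have feas : dantzig_feasible Q lam w k beta.
  move=> j; have [/bf//|jU] := boolP (j \in U).
  have jk : j != k by apply: contraNneq jU => ->.
  by rewrite /basis_vec (negbTE jk) subr0; exact: column_primal_off.
have uoff := column_dual_off uU uE.
have uw j : `|mxapply Q u j| <= w j.
  have [jU|/uoff/ltW//] := boolP (j \in U).
  by rewrite uE// normrM normr_sg th_neq0// mulr1 gtr0_norm.
have ub j : mxapply Q u j * beta j = w j * `|beta j|.
  have [jU|jU] := boolP (j \in U); last by rewrite bU// normr0 !mulr0.
  rewrite uE// -mulrA; congr (_ * _).
  by rewrite -(column_sign bU bf jU) -normrEsg.
have bu j :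
    (mxapply Q beta j - basis_vec k j) * u j = - (lam * (w j * `|u j|)).
  have [jU|jU] := boolP (j \in U); last by rewrite uU// normr0 !mulr0 oppr0.
  by rewrite bE// normrEsg; ring.
have [opt slack] := dantzig_certificate Qs uw ub bu.
exists beta; split => // b bfe bopt.
have bsupp : supported U b by move=> j jU; apply: (slack b bfe bopt); exact: uoff.
by split => // j jU; apply: column_sign.
Qed.

End column.
End weighted_dantzig.

(** * Existence of minimizers and reduction to columns *)

Section existence.
Context {R : realType} {p : nat}.
Implicit Types (Q S : 'M[R]_p) (u v w b : 'I_p -> R).

Lemma continuous_coord i : continuous (fun v : 'rV[R]_p => v 0 i : R).
Proof. by move=> v; have := @coord_continuous R 1 p 0 i v. Qed.

Lemma continuous_linear_form (a : 'I_p -> R) :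
  continuous (fun v : 'rV[R]_p => \sum_i a i * v 0 i).
Proof.
apply: continuous_big; first exact: add_continuous.
move=> i _ v; have h := @continuous_coord i v.
exact: (cvgM (cvg_cst (a i)) h).
Qed.

Lemma continuous_l1 : continuous (fun v : 'rV[R]_p => \sum_i `|v 0 i|).
Proof.
apply: continuous_big; first exact: add_continuous.
move=> i _ v; have h := @continuous_coord i v; exact: (cvg_norm h).
Qed.

(** The feasible vectors whose norm does not exceed that of [b0] form a
    compact set, on which the continuous objective attains its minimum.  Unit
    weights suffice: in the second stage the witness itself is optimal. *)
Lemma dantzig_exists Q lam (k : 'I_p) b0 : dantzig_feasible Q lam (fun=> 1) k b0 ->
  exists b, dantzig_feasible Q lam (fun=> 1) k b /\
    forall b', dantzig_feasible Q lam (fun=> 1) k b' ->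
      weighted_l1 (fun=> 1) b <= weighted_l1 (fun=> 1) b'.
Proof.
move=> b0f.
have l1E b : weighted_l1 (fun=> 1) b = \sum_i `|b i|.
  by apply: eq_bigr => i _; rewrite mul1r.
pose C : R := \sum_i `|b0 i|.
pose A := [set v : 'rV[R]_p | \sum_i `|v 0 i| <= C] `&`
  \bigcap_j [set v : 'rV[R]_p | `|mxapply Q (v 0) j - basis_vec k j| <= lam].
have rowK b : (\row_i b i : 'rV[R]_p) 0 = b by apply/funext => i; rewrite mxE.
have A0 : A !=set0.
  exists (\row_i b0 i); split => /=; first by under eq_bigr do rewrite mxE.
  by move=> j _ /=; rewrite rowK; have := b0f j; rewrite mulr1.
have Acl : closed A.
  apply: closedI.
    by apply: (preimage_closed _ (@closed_le _ C)) => v _; exact: continuous_l1.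
  apply: closed_bigI => j _.
  apply: (preimage_closed _ (@closed_le _ lam)) => v _ /=.
  have h := @continuous_linear_form (Q j) v.
  exact: (cvg_norm (cvgB h (cvg_cst (basis_vec k j)))).
have Ab : bounded_set A.
  exists C; split; first by rewrite num_real.
  move=> x Cx v [/= vC _]; rewrite /Num.norm /= mx_normrE.
  apply/bigmax_leP; split=> [|[i j] _ /=].
    by rewrite (le_trans _ (ltW Cx))//; apply: sumr_ge0.
  rewrite ord1 (le_trans _ (ltW Cx))// (le_trans _ vC)//.
  by rewrite (bigD1 j)//= lerDl sumr_ge0.
have [v vA vmin] := EVT_min_rV A0 (bounded_closed_compact Ab Acl)
  (continuous_subspaceT continuous_l1).
move: vA; rewrite inE => -[/= vC vf].
exists (v 0); split=> [j|b bf]; first by rewrite mulr1; exact: vf.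
rewrite !l1E; have [bC|/ltW bC] := leP (\sum_i `|b i|) C; last exact: le_trans vC bC.
have := vmin (\row_i b i); under [leRHS]eq_bigr do rewrite mxE.
apply; rewrite inE; split => /=; first by under eq_bigr do rewrite mxE.
by move=> j _ /=; rewrite rowK; have := bf j; rewrite mulr1.
Qed.

(** When the constraints and the objective split over the columns, changing
    one column of an optimal matrix to a competitor leaves the others
    unaffected. *)
Lemma argmin_on_columns (F : 'M[R]_p -> Prop) (O : 'M[R]_p -> R)
    (f : 'I_p -> ('I_p -> R) -> Prop) (o : 'I_p -> ('I_p -> R) -> R) :
  (forall T : 'M[R]_p, F T <-> forall k, f k (T^~ k)) ->
  (forall T : 'M[R]_p, O T = \sum_k o k (T^~ k)) ->
  forall T : 'M[R]_p, argmin_on F O T <->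
    forall k, f k (T^~ k) /\ forall b, f k b -> o k (T^~ k) <= o k b.
Proof.
move=> FE OE T; split=> [[/FE Tf Tmin] k|Tk]; last first.
  split; first by apply/FE => k; have [] := Tk k.
  move=> T' /FE T'f; rewrite !OE; apply: ler_sum => k _.
  by have [_ ->] := Tk k.
split=> // b bf; pose T' : 'M[R]_p := \matrix_(i, j) if j == k then b i else T i j.
have T'k : T'^~ k = b by apply/funext => i; rewrite mxE eqxx.
have T'j j : j != k -> T'^~ j = T^~ j.
  by move=> jk; apply/funext => i; rewrite mxE (negbTE jk).
have /Tmin : F T'.
  by apply/FE => j; have [->|/T'j ->] := eqVneq j k; rewrite ?T'k.
rewrite !OE (bigD1 k)//= [leRHS](bigD1 k)//= T'k.
by under [X in _ <= _ + X -> _]eq_bigr => j jk do rewrite (T'j _ jk); rewrite lerD2r.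
Qed.

End existence.

(** * Bounds on the precision matrix *)

Section precision.
Context {R : realType} {p : nat}.
Variable S : 'M[R]_p.
Hypothesis Scorr : correlation_mx S.

Let Spos : posdef S. Proof. by case: Scorr. Qed.
Let S1 i : S i i = 1. Proof. by case: Scorr. Qed.
Let Ssym : S^T = S. Proof. by case: Spos. Qed.

Lemma corr_sym i j : S i j = S j i. Proof. by rewrite -{1}Ssym mxE. Qed.

Lemma Theta_sym i j : Theta S i j = Theta S j i.
Proof. by rewrite /Theta -{1}Ssym -trmx_inv mxE. Qed.

Lemma mxapply_Theta k j : mxapply S ((Theta S)^~ k) j = basis_vec k j.
Proof. by rewrite -mxapplyE mulmxV ?posdef_unitmx// mxE. Qed.

Lemma quad_form_ge0 v : 0 <= quad_form S v.
Proof.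
have [[j vj]|v0] := pselect (exists j, v j != 0).
  exact/ltW/(posdef_quad_form Spos (ex_intro _ j vj)).
rewrite /quad_form big1// => i _; have [->|vi] := eqVneq (v i) 0.
  by rewrite mul0r.
by exfalso; apply: v0; exists i.
Qed.

Lemma mxapply_basis (Q : 'M[R]_p) k j : mxapply Q (basis_vec k) j = Q j k.
Proof.
rewrite /mxapply (bigD1 k)//= /basis_vec eqxx mulr1 big1 ?addr0//.
by move=> i /negbTE ->; rewrite mulr0.
Qed.

(** Evaluate the quadratic form of [S] at the difference of column [k] of
    [Theta S] and the [k]-th basis vector: since [S] has unit diagonal the
    value is Theta k k - 1. *)
Lemma Theta_diag_ge1 k : 1 <= Theta S k k.
Proof.
have := quad_form_ge0 (fun i => Theta S i k - basis_vec k i).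
rewrite /quad_form.
under eq_bigr do rewrite mxapplyB mxapply_Theta mxapply_basis mulrBl.
rewrite sumrB.
under [X in _ - X]eq_bigr do rewrite mulrBr.
rewrite sumrB.
have -> : \sum_i Theta S i k * (basis_vec k i - S i k) = Theta S k k - 1.
  under eq_bigr do rewrite mulrBr; rewrite sumrB; congr (_ - _).
    by rewrite -[RHS](basis_vecE k (fun i => Theta S i k)); apply: eq_bigr => i _; rewrite mulrC.
  have <- : mxapply S ((Theta S)^~ k) k = 1.
    by rewrite mxapply_Theta /basis_vec eqxx.
  by apply: eq_bigr => i _; rewrite corr_sym mulrC.
rewrite !basis_vecE S1 /basis_vec eqxx /=; lra.
Qed.

Lemma corr_le1 i j : `|S i j| <= 1.
Proof.
have [->|ij] := eqVneq i j; first by rewrite S1 normr1.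
have Sij := corr_sym j i.
have q (s : R) : 0 <= 1 + s * S i j + s * (S i j + s).
  have := quad_form_ge0 (fun l => basis_vec i l + s * basis_vec j l).
  have sE l : mxapply S (fun l => basis_vec i l + s * basis_vec j l) l
      = S l i + s * S l j.
    rewrite /mxapply -(mxapply_basis S i) -(mxapply_basis S j) /mxapply.
    by rewrite mulr_sumr -big_split; apply: eq_bigr => m _ /=; ring.
  rewrite /quad_form; under eq_bigr do rewrite sE mulrDl -mulrA.
  by rewrite big_split /= -mulr_sumr !basis_vecE !S1 Sij; lra.
have := q 1; have := q (-1); rewrite ler_norml => *; apply/andP; split; lra.
Qed.

(** The entry (k, k) of S * Theta is 1, and the entries of [S] are at most 1
    in absolute value. *)
Lemma M_ge1 (k : 'I_p) : 1 <= M_ S.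
Proof.
apply: le_trans (norm_l1_ge (Theta S) k).
have <- : mxapply S ((Theta S)^~ k) k = 1.
    by rewrite mxapply_Theta /basis_vec eqxx.
apply: ler_sum => i _; rewrite (le_trans (ler_norm _))// normrM.
by rewrite ler_piMl// corr_le1.
Qed.

Lemma G_ge1 k : 1 <= G_ S k.
Proof.
have kU : k \in Defs.adj1 S k by rewrite finset.setU11.
set U := Defs.adj1 S k in kU.
have Su : set_submx U U S \in unitmx by exact: posdef_set_submx_unit.
pose a := enum_rank_in kU k.
have ak : enum_val a = k by rewrite enum_rankK_in.
apply: le_trans (norm_loo_ge (invmx (set_submx U U S)) a).
have <- : (invmx (set_submx U U S) *m set_submx U U S) a a = 1.
  by rewrite mulVmx// mxE eqxx.
rewrite mxE.
apply: ler_sum => i _; rewrite (le_trans (ler_norm _))// normrM.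
by rewrite ler_piMr// mxE corr_le1.
Qed.

(** The infimum over the finite set of edges is attained, hence positive. *)
Lemma psi_minP : edges S != finset.set0 ->
  0 < psi_min S /\ forall i j, (i, j) \in edges S -> psi_min S <= `|Theta S i j|.
Proof.
move=> /finset.set0Pn[ij0 ij0E].
pose f (ij : 'I_p * 'I_p) := `|Theta S ij.1 ij.2|.
split; last first.
  move=> i j ijE; apply: ge_inf; last by exists (i, j).
  by exists 0 => _ /= [ij _ <-].
have [ij ijE ijmin] := arg_minP f ij0E.
have f0 : 0 < f ij.
  have : ij \in edges S by exact: ijE.
  by rewrite finset.inE => /andP[_]; rewrite normr_gt0.
apply: (lt_le_trans f0); apply: lb_le_inf; first by exists (f ij), ij.
by move=> _ /= [kl klE <-]; exact: ijmin.
Qed.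

Lemma card_adj_le k : (#|adj S k| <= max_degree S)%N.
Proof. exact: (@leq_bigmax _ (fun k => #|adj S k|)). Qed.

Lemma max_degree_gt0 : edges S != finset.set0 -> (0 < max_degree S)%N.
Proof.
move=> /finset.set0Pn[[i j]]; rewrite finset.inE /= => /andP[ij Sij].
apply: leq_trans (card_adj_le i); apply/card_gt0P; exists j.
by rewrite finset.inE eq_sym ij.
Qed.

End precision.

(** * Sign recovery from an accurate correlation estimate *)

Section deterministic.
Context {R : realType} {p : nat}.
Variables (S Q : 'M[R]_p) (n : nat) (lc lac delta : R).
Hypothesis n_gt0 : (0 < n)%N.
Hypothesis Scorr : correlation_mx S.
Hypothesis Sedges : edges S != finset.set0.
Let psi := psi_min S.
Let M := M_ S.
Let d : R := (max_degree S)%:R.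
Hypothesis lc_psi : lc <= psi / (4 * M).
Hypothesis lc_gt0 : 0 < lc.
Hypothesis lac_gt0 : 0 < lac.
Hypothesis lc_G : forall k, lc <= 1 / (4 * M * (psi + 2 * G_ S k) * d) - 2 / (M * n%:R).
Hypothesis lac_psi : forall k, lac <= psi ^+ 2 / (8 * G_ S k).
Hypothesis lac_H : forall k, (2 * M * lc + 1 / n%:R) * (H_ S k * psi / G_ S k) <= lac.
Hypothesis dlac_G : forall k, d * lac <= 1 / (2 * G_ S k).
Hypothesis dlac_psi : forall k, d * lac <= psi / (4 * G_ S k * (psi + G_ S k)).
Hypothesis Qs : Q^T = Q.
Hypothesis Q1 : forall i, Q i i = 1.
Hypothesis QS : forall i j, `|(Q - S) i j| <= delta.
Hypothesis delta_lac : delta <= lac / 2.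
Hypothesis delta_lc : M * delta <= lc / 2.

Let psi_gt0 : 0 < psi. Proof. by have [] := psi_minP Sedges. Qed.
Let psi_le i j : (i, j) \in edges S -> psi <= `|Theta S i j|.
Proof. by have [_ h] := psi_minP Sedges; exact: h. Qed.
Let d_ge1 : 1 <= d. Proof. by rewrite ler1n max_degree_gt0. Qed.
Let G_ge1k k : 1 <= G_ S k. Proof. exact: G_ge1. Qed.
Let M1 : 'I_p -> 1 <= M. Proof. exact: M_ge1. Qed.
Let N : R := n%:R^-1.
Let N_gt0 : 0 < N. Proof. by rewrite invr_gt0 ltr0n. Qed.
Let om : R := 2 * M * lc + N.
Let delta_ge0 : 'I_p -> 0 <= delta.
Proof. by move=> k; exact: le_trans (QS k k). Qed.
Let adjE k j : (j \in adj S k) = (j != k) && (Theta S k j != 0).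
Proof. by rewrite finset.inE. Qed.
Let adj1E k j : (j \in Defs.adj1 S k) = (j == k) || (Theta S k j != 0).
Proof. by rewrite finset.in_setU1 adjE; case: eqP. Qed.

(* The upper bound on lambda_c, solved for [om], the bound on the entries of
   |Tc| + 1 / n off the support. *)
Let om_G k : 2 * (d * om * (psi + 2 * G_ S k)) <= 1.
Proof.
have M0 : 0 < M by apply: lt_le_trans (M1 k).
have G1 := G_ge1k k; have d0 : 0 < d by apply: lt_le_trans d_ge1.
have pG : 0 < psi + 2 * G_ S k by rewrite addr_gt0// mulr_gt0//; lra.
have := lc_G k; rewrite -(ler_pM2l M0).
have -> : M * (1 / (4 * M * (psi + 2 * G_ S k) * d) - 2 / (M * n%:R))
    = 1 / (4 * ((psi + 2 * G_ S k) * d)) - 2 * N.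
  rewrite /N; field; rewrite !gt_eqF//=; by rewrite ltr0n.
set g := (psi + 2 * G_ S k) in pG *.
move=> h; have {}h : om <= 1 / (2 * (g * d)).
  have -> : 1 / (2 * (g * d)) = 2 * (1 / (4 * (g * d))) by field; rewrite !gt_eqF.
  by rewrite /om; have := N_gt0; lra.
have -> : 2 * (d * om * g) = om * (2 * (g * d)) by ring.
by rewrite -ler_pdivlMr// !mulr_gt0.
Qed.

Let Mlc_quarter (k : 'I_p) : 2 * M * lc <= 1 / 4.
Proof.
have G1 := G_ge1k k; have := om_G k; have := psi_gt0; have := N_gt0.
have l0 := lc_gt0; have m1 := M1 k.
have x0 : 0 <= 2 * M * lc by rewrite !mulr_ge0//; lra.
rewrite /om => N0 p0 h.
have : d * (2 * M * lc + N) * (psi + 2 * G_ S k) >= 2 * (2 * M * lc).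
  have h2 : 2 <= d * (psi + 2 * G_ S k).
    by apply: (@le_trans _ _ (psi + 2 * G_ S k)); [|rewrite ler_peMl//]; lra.
  have -> : d * (2 * M * lc + N) * (psi + 2 * G_ S k)
      = (2 * M * lc + N) * (d * (psi + 2 * G_ S k)) by ring.
  apply: (@le_trans _ _ ((2 * M * lc + N) * 2)); first by lra.
  by rewrite ler_wpM2l//; lra.
by lra.
Qed.

Let Mlc_psi (k : 'I_p) : 2 * M * lc <= psi / 2.
Proof.
have M0 : 0 < M by apply: lt_le_trans (M1 k).
have := lc_psi; rewrite -(ler_pM2l M0).
have -> : M * (psi / (4 * M)) = psi / 4 by field; rewrite gt_eqF.
by lra.
Qed.

Let thS k j : mxapply S ((Theta S)^~ k) j = basis_vec k j.
Proof. exact: mxapply_Theta. Qed.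

Let D_l1 b j : `|mxapply (Q - S) b j| <= delta * \sum_i `|b i|.
Proof.
rewrite /mxapply (le_trans (ler_norm_sum _ _ _))// mulr_sumr.
by apply: ler_sum => i _; rewrite normrM ler_wpM2r.
Qed.

Let Th_l1 k : \sum_i `|Theta S i k| <= M. Proof. exact: norm_l1_ge. Qed.

(** The residual of the true column is (Q - S) theta, at most delta * M. *)
Lemma Theta_feasible k : dantzig_feasible Q lc (fun=> 1) k ((Theta S)^~ k).
Proof.
move=> j; rewrite mulr1 -thS -mxapplyBl (le_trans (D_l1 _ _))//.
have d0 := delta_ge0 k.
rewrite (@le_trans _ _ (delta * M))// ?ler_wpM2l//.
by have := lc_gt0; have := delta_lc; lra.
Qed.

Let clime_obj (T : 'M[R]_p) : norm1 T = \sum_k weighted_l1 (fun=> 1) (T^~ k).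
Proof.
rewrite /norm1 exchange_big; apply: eq_bigr => k _.
by apply: eq_bigr => j _; rewrite mul1r.
Qed.

Let clime_feas (T : 'M[R]_p) : norm_max (Q *m T - 1%:M) <= lc <->
  forall k, dantzig_feasible Q lc (fun=> 1) k (T^~ k).
Proof.
rewrite norm_max_leP; last exact: ltW.
split=> h k j; first by have := h j k; rewrite !mxE mulr1 -mxapplyE mxE.
by have := h j k; rewrite !mxE mulr1 -mxapplyE mxE.
Qed.

Let clime_columns := @argmin_on_columns R p _ _ _
  (fun=> weighted_l1 (fun=> 1)) clime_feas clime_obj.

(** As the true column is feasible, the norm of the solution is at most [M];
    then S (Tc - Theta) has entries at most lc + delta M, and multiplying by
    Theta costs another factor [M]. *)
Lemma clime_error (Tc : 'M[R]_p) :
  argmin_on (fun T => norm_max (Q *m T - 1%:M) <= lc) norm1 Tc ->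
  forall j k, `|Tc j k - Theta S j k| <= 2 * M * lc.
Proof.
move=> /clime_columns Tcol j k.
have [Tf Tmin] := Tcol k.
have Tl1 : \sum_i `|Tc i k| <= M.
  have := Tmin _ (Theta_feasible k).
  rewrite /weighted_l1; under eq_bigr do rewrite mul1r.
  by under [leRHS]eq_bigr do rewrite mul1r; move=> /le_trans; apply.
pose v i := Tc i k - Theta S i k.
have Sv i : `|mxapply S v i| <= 2 * lc.
  have -> : mxapply S v i = (mxapply Q (Tc^~ k) i - basis_vec k i)
     - mxapply (Q - S) (Tc^~ k) i.
    by rewrite mxapplyBl /v mxapplyB thS; ring.
  have h1 := Tf i; rewrite mulr1 in h1.
  have h2 : `|mxapply (Q - S) (Tc^~ k) i| <= lc / 2.
    rewrite (le_trans (D_l1 _ _))// (le_trans _ delta_lc)// mulrC ler_wpM2r//.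
    exact: delta_ge0 k.
  by rewrite (le_trans (ler_normB _ _))//; have := lc_gt0; lra.
have -> : Tc j k - Theta S j k = mxapply (Theta S) (mxapply S v) j.
  rewrite /mxapply.
  under [RHS]eq_bigr => i _ do rewrite mulr_sumr.
  rewrite exchange_big /=.
  under eq_bigr => i _ do under eq_bigr do rewrite mulrA.
  under eq_bigr => i _ do rewrite -mulr_suml.
  have ThS a b : \sum_i Theta S a i * S i b = (a == b)%:R.
    by have /matrixP/(_ a b) := mulVmx (posdef_unitmx Scorr.1); rewrite !mxE.
  under eq_bigr do rewrite ThS.
  by rewrite (bigD1 j)//= eqxx mul1r big1 ?addr0// => i /negbTE; rewrite eq_sym => ->; rewrite mul0r.
rewrite (le_trans (mxapply_le _ _ Sv))// [2 * M]mulrC -mulrA ler_wpM2r//.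
  by rewrite mulr_ge0// ltW.
apply: le_trans (Th_l1 j).
by apply: ler_sum => i _; rewrite (Theta_sym Scorr).
Qed.

(* A pilot entry is at least psi / 2 in absolute value at a neighbour and at
   least 1 - 1 / 4 on the diagonal: this gives the two reciprocals. *)
Let wm : R := Num.max (2 / psi) (4 / 3).

Let g_bounds k : G_ S k * (lac * wm) <= psi / 3 /\ G_ S k * (lac * wm) <= 1 / 2.
Proof.
have G1 := G_ge1k k; have G0 : 0 < G_ S k by lra.
have p0 := psi_gt0; have l0 := lac_gt0; have d1 := d_ge1.
have h1 : 8 * (G_ S k * lac) <= psi ^+ 2.
  have := lac_psi k; rewrite -(@ler_pM2r _ (8 * G_ S k)) ?mulr_gt0// divfK; last first.
    by rewrite mulf_neq0// gt_eqF.
  by rewrite mulrC -mulrA.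
have h2 : 4 * (G_ S k * lac) * (psi + G_ S k) <= psi.
  have pG : 0 < psi + G_ S k by lra.
  have := dlac_psi k; rewrite -(@ler_pM2r _ (4 * G_ S k * (psi + G_ S k))) ?mulr_gt0// divfK; last first.
    by rewrite !mulf_neq0// gt_eqF.
  apply: le_trans.
  have -> : d * lac * (4 * G_ S k * (psi + G_ S k)) = d * (4 * (G_ S k * lac) * (psi + G_ S k)) by ring.
  by rewrite ler_peMl// !mulr_ge0//; lra.
have h3 : 4 * (G_ S k * lac) <= psi.
  apply: le_trans h2; rewrite ler_peMr ?mulr_ge0//; lra.
have h4 : 4 * (G_ S k * lac) <= 1.
  rewrite -(ler_pM2r p0) mul1r; apply: le_trans h2.
  by rewrite ler_wpM2l ?mulr_ge0//; lra.
rewrite mulrA; set x := G_ S k * lac in h1 h2 h3 h4 *.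
have x0 : 0 < x by rewrite mulr_gt0.
have ux : x * (2 / psi) <= psi / 4.
  by rewrite mulrA ler_pdivrMr//; move: h1; rewrite expr2; lra.
have ux' : x * (2 / psi) <= 1 / 2 by rewrite mulrA ler_pdivrMr//; lra.
by rewrite /wm; case: (leP (2 / psi) (4 / 3)) => _; split; lra.
Qed.

(** Under the entrywise error bound of the first stage the weights separate
    the support from its complement. *)
Section weights.
Variables (Tc : 'M[R]_p) (k : 'I_p).
Hypothesis Tc_err : forall j k, `|Tc j k - Theta S j k| <= 2 * M * lc.

Let w j := clime_weight n Tc j k.

Let wE j : w j = (`|Tc j k| + N)^-1. Proof. by rewrite /w /clime_weight mxE. Qed.

Let tN_gt0 (t : R) : 0 < `|t| + N. Proof. by rewrite ltr_wpDl. Qed.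

Let w_gt0 j : 0 < w j. Proof. by rewrite wE invr_gt0. Qed.

Let w_le j : j \in Defs.adj1 S k -> w j <= wm.
Proof.
rewrite adj1E wE => h; rewrite /wm le_max.
have tT : `|Theta S j k| <= `|Tc j k| + 2 * M * lc.
  have := Tc_err j k; rewrite distrC => e.
  by rewrite -lerBlDl (le_trans (lerB_dist _ _)).
have p0 := psi_gt0; have N0 := N_gt0.
have [jk|jk] := eqVneq j k.
  apply/orP; right; rewrite jk -[leRHS]invrK lef_pV2 ?posrE ?invr_gt0 ?tN_gt0//; last first.
  have := Theta_diag_ge1 Scorr k; rewrite jk in tT.
  have := ler_norm (Theta S k k); have := Mlc_quarter k.
  rewrite invf_div; lra.
apply/orP; left; rewrite -[leRHS]invrK lef_pV2 ?posrE ?invr_gt0 ?tN_gt0//; last first.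
  by rewrite divr_gt0.
have := psi_le (i := j) (j := k).
rewrite finset.inE /= jk (Theta_sym Scorr) /=.
move: h; rewrite (negbTE jk) /= => -> /(_ isT); rewrite (Theta_sym Scorr) => h.
rewrite invf_div; have := Mlc_psi k; lra.
Qed.

Let w_ge j : j \notin Defs.adj1 S k -> om^-1 <= w j.
Proof.
rewrite adj1E negb_or negbK => /andP[_ /eqP T0]; rewrite wE.
have M0 : 0 < M by apply: lt_le_trans (M1 k).
rewrite lef_pV2 ?posrE ?tN_gt0// ?addr_gt0 ?mulr_gt0//.
rewrite lerD2r.
by have := Tc_err j k; rewrite (Theta_sym Scorr) T0 subr0.
Qed.

(** The hypotheses of [column_witness] are verified with [G_], [H_] and the
    bounds on the weights, [U] being the closed neighbourhood [adj1 S k]. *)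
Lemma aclime_column : exists beta,
  [/\ dantzig_feasible Q lac w k beta,
      forall b, dantzig_feasible Q lac w k b ->
        weighted_l1 w beta <= weighted_l1 w b
    & forall b, dantzig_feasible Q lac w k b ->
        weighted_l1 w b <= weighted_l1 w beta ->
        supported (Defs.adj1 S k) b /\
        (forall j, j \in Defs.adj1 S k -> Num.sg (b j) = Num.sg (Theta S j k))].
Proof.
have Su := posdef_set_submx_unit (Defs.adj1 S k) Scorr.1.
have G1 := G_ge1k k; have G0 : 0 < G_ S k by lra.
have d1 := d_ge1; have p0 := psi_gt0; have l0 := lac_gt0; have de0 := delta_ge0 k.
have M0 : 0 < M by apply: lt_le_trans (M1 k).
have thU : supported (Defs.adj1 S k) ((Theta S)^~ k).
  move=> j; rewrite adj1E negb_or negbK => /andP[_ /eqP T0].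
  by rewrite (Theta_sym Scorr).
have th_le j : `|Theta S j k| <= G_ S k.
  rewrite -[leRHS]mulr1; apply: (@inv_set_submx_bound R p _ S ((Theta S)^~ k) 1 j Su thU) => // i _.
  by rewrite thS /basis_vec; case: eqP; rewrite ?normr1 ?normr0.
have D_card v (b : R) (U : {set 'I_p}) j : (forall i, `|v i| <= b) ->
    `|\sum_(i in U) (Q - S) j i * v i| <= #|U|%:R * (delta * b).
  move=> vb; rewrite (le_trans (ler_norm_sum _ _ _))//.
  rewrite -sum1_card natr_sum mulr_suml; apply: ler_sum => i _.
  by rewrite mul1r normrM ler_pM.
have cardU : (#|adj S k|%:R : R) <= d by rewrite ler_nat card_adj_le.
apply: (@column_witness R p S Q (Defs.adj1 S k) k ((Theta S)^~ k) w
  (G_ S k) (H_ S k) psi lac delta d M om wm) => //.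
- by rewrite adj1E eqxx.
- by move=> v b vU b0 Sv j; exact: inv_set_submx_bound.
- by move=> v b vU b0 Sv j; exact: off_set_submx_bound.
- move=> v b vU b0 vb j jU.
  rewrite (mxapply_supported _ _ vU) (big_setD1 j)//= !mxE Q1 (Scorr.2 j) subrr.
  rewrite mul0r add0r (le_trans (D_card _ _ _ _ vb))// mulrA !ler_wpM2r//.
  apply: le_trans cardU; rewrite ler_nat.
  have := cardsD1 j (Defs.adj1 S k); rewrite jU /Defs.adj1 cardsU1.
  by rewrite adjE eqxx /= !add1n => -[->].
- move=> v b vU b0 vb j.
  rewrite (mxapply_supported _ _ vU) (le_trans (D_card _ _ _ _ vb))//.
  rewrite !mulrA !ler_wpM2r// /Defs.adj1 cardsU1 adjE eqxx /= natrD; lra.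
- by move=> j; rewrite (le_trans (D_l1 _ _))// ler_wpM2l.
- move=> j; rewrite adj1E => /orP[/eqP ->|T0 jk]; first by rewrite eqxx.
  by apply: psi_le; rewrite finset.inE /= jk (Theta_sym Scorr).
- exact: Theta_diag_ge1.
- by rewrite addr_gt0// !mulr_gt0.
- by lra.
- exact: ltW.
- by have [] := g_bounds k.
- by have [] := g_bounds k.
- have := dlac_G k; rewrite ler_pdivlMr ?mulr_gt0// => h.
  have h' : d * delta <= d * (lac / 2) by rewrite ler_wpM2l//; lra.
  have := ler_wpM2l (ltW G0) h'; lra.
- have pG : 0 < psi + G_ S k by lra.
  have := dlac_psi k; rewrite ler_pdivlMr ?mulr_gt0// => h.
  have h' : d * delta <= d * (lac / 2) by rewrite ler_wpM2l//; lra.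
  have h2 := ler_wpM2r (ltW (mulr_gt0 G0 pG)) h'.
  have -> : G_ S k * (d * delta * (psi + G_ S k)) = d * delta * (G_ S k * (psi + G_ S k)) by ring.
  apply: (le_trans h2); lra.
- have M1k := M1 k; have l1 := lc_gt0.
  have h : 8 * (M * lc * G_ S k) <= 1.
    apply: le_trans (om_G k).
    have x0 : 0 <= M * lc by rewrite mulr_ge0// ltW.
    have N0 := N_gt0.
    have -> : 8 * (M * lc * G_ S k) = 2 * (2 * M * lc * (2 * G_ S k)) by ring.
    rewrite ler_pM2l//; apply: ler_pM; rewrite ?mulr_ge0//; try lra.
    rewrite /om; apply: (@le_trans _ _ (2 * M * lc + N)); first by lra.
    by rewrite ler_peMl//; lra.
  have h2 : lc * G_ S k <= M * lc * G_ S k.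
    by rewrite -mulrA ler_peMl// mulr_ge0//; lra.
  have h3 := ler_wpM2l (ltW G0) delta_lc; rewrite [delta * M]mulrC.
  by apply: (le_trans h3); move: h h2; move: (M * lc * G_ S k) => x; lra.
- have := lac_H k; rewrite div1r -/N -/om mulrA ler_pdivrMr//.
  by rewrite mulrCA mulrA.
Qed.

End weights.

(** The first-stage minimizer exists by compactness, the second-stage one by
    the witnesses of its columns, which also determine the support and the
    signs of every solution. *)
Theorem clime_sign_recovery :
  (exists Tc, argmin_on (fun T => norm_max (Q *m T - 1%:M) <= lc) norm1 Tc) /\
  forall Tc, argmin_on (fun T => norm_max (Q *m T - 1%:M) <= lc) norm1 Tc ->
    let opt := argmin_on
      (fun T => forall i j, `|(Q *m T - 1%:M) i j| <= lac * clime_weight n Tc i j)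
      (fun T => norm1 (hadamard (clime_weight n Tc) T)) in
    (exists T, opt T) /\ forall T, opt T -> sign_consistent S T.
Proof.
split.
  have /choice [b bP] : forall k, exists b, dantzig_feasible Q lc (fun=> 1) k b /\
      forall b', dantzig_feasible Q lc (fun=> 1) k b' ->
        weighted_l1 (fun=> 1) b <= weighted_l1 (fun=> 1) b'.
    by move=> k; exact: dantzig_exists (Theta_feasible k).
  exists (\matrix_(i, j) b j i); apply/clime_columns => k.
  have -> : (\matrix_(i, j) b j i)^~ k = b k by apply/funext => i; rewrite mxE.
  exact: bP.
move=> Tc /clime_error Tc_err; set W := clime_weight n Tc.
have feasE (T : 'M[R]_p) : (forall i j, `|(Q *m T - 1%:M) i j| <= lac * W i j) <->
    forall k, dantzig_feasible Q lac (W^~ k) k (T^~ k).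
  by split=> h i j; have := h j i; rewrite !mxE.
have Wgt0 i j : 0 < W i j.
  by rewrite /W /clime_weight mxE invr_gt0 ltr_wpDl.
have objE (T : 'M[R]_p) : norm1 (hadamard W T) = \sum_k weighted_l1 (W^~ k) (T^~ k).
  rewrite /norm1 exchange_big; apply: eq_bigr => k _.
  by apply: eq_bigr => j _; rewrite mxE normrM gtr0_norm.
have columns := @argmin_on_columns R p _ _
  (fun k => dantzig_feasible Q lac (W^~ k) k)
  (fun k => weighted_l1 (W^~ k)) feasE objE.
have /choice [beta betaP] := fun k => aclime_column k Tc_err.
split.
  exists (\matrix_(i, j) beta j i); apply/columns => k.
  have -> : (\matrix_(i, j) beta j i)^~ k = beta k by apply/funext => i; rewrite mxE.
  by have [bf bmin _] := betaP k.
move=> T /columns Topt.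
have Tk k : supported (Defs.adj1 S k) (T^~ k) /\
    (forall j, j \in Defs.adj1 S k -> Num.sg (T j k) = Num.sg (Theta S j k)).
  have [bf bmin bsign] := betaP k; have [Tf Tmin] := Topt k.
  exact: (bsign _ Tf (Tmin _ bf)).
split=> [i j|i j ij].
  rewrite finset.inE /= => /andP[ij Tij]; apply: (Tk j).2.
  by rewrite adj1E (Theta_sym Scorr) Tij orbT.
rewrite finset.inE /= ij /= negbK => /eqP Tij.
rewrite ((Tk j).1 i) ?sgr0// adj1E negb_or ij negbK /=.
by rewrite (Theta_sym Scorr) Tij.
Qed.

End deterministic.

(** * Rotation invariance of the standard Gaussian measure of the plane *)

Section plane.
Context {R : realType}.
Local Notation mu := (@lebesgue_measure R).
Local Notation mu2 := (mu \x mu)%E.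
Local Notation gamma := (normal_prob (0 : R) 1).

(** Lebesgue measure is determined by its values on intervals. *)
Lemma lebesgue_measure_translation (t : R) (A : set (measurableTypeR R)) :
  measurable A -> mu ((fun y => y + t) @^-1` A) = mu A.
Proof.
have mt : measurable_fun [set: measurableTypeR R]
    (fun y : measurableTypeR R => (y + t : measurableTypeR R)).
  exact: measurable_funD.
move=> mA; apply/esym.
rewrite -[RHS]/(pushforward mu (fun y : measurableTypeR R => (y + t : measurableTypeR R)) A).
apply: lebesgue_measure_unique => //.
move=> X [[a b] _ <-] /=; rewrite /pushforward.
rewrite [X in _ = mu X](_ : _ = `](a - t), (b - t)]%classic); last first.
  by apply/seteqP; split => y /=; rewrite !in_itv/= ltrBlDr lerBrDr.
rewrite !lebesgue_measure_itv/= !lte_fin ltrD2r; case: ifP => // _.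
by rewrite -!EFinD; congr (_%:E); ring.
Qed.

Lemma integral_translation (f : R -> \bar R) (t : R) :
  measurable_fun [set: R] f -> (forall y, 0 <= f y)%E ->
  (\int[mu]_y f (y + t)%R = \int[mu]_y f y)%E.
Proof.
move=> mf f0.
have mt : measurable_fun [set: measurableTypeR R]
    (fun y : measurableTypeR R => (y + t : measurableTypeR R)).
  exact: measurable_funD.
have := @ge0_integral_pushforward _ _ _ _ R _ mt mu setT f measurableT mf (fun y _ => f0 y).
rewrite preimage_setT => <-.
apply: eq_measure_integral => A mA _; exact: lebesgue_measure_translation.
Qed.

(** A shear translates each line parallel to an axis, so Fubini's theorem
    reduces its invariance to that of translations. *)
Lemma integral2_shear2 (f : R * R -> \bar R) (t : R) :
  measurable_fun [set: R * R] f -> (forall z, 0 <= f z)%E ->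
  (\int[mu2]_z f (z.1, z.2 + t * z.1)%R = \int[mu2]_z f z)%E.
Proof.
move=> mf f0.
have msh : measurable_fun [set: R * R] (fun z : R * R => (z.1, z.2 + t * z.1)).
  apply: measurable_fun_pair => //; apply: measurable_funD => //.
  exact: measurable_funM.
have msf := measurableT_comp mf msh.
rewrite fubini_tonelli1// fubini_tonelli1//.
apply: eq_integral => x _; rewrite /fubini_F /=.
apply: (integral_translation (f := fun y => f (x, y)) (t * x)) => //.
by apply: (measurableT_comp mf); exact: measurable_fun_pair.
Qed.

Lemma integral2_shear1 (f : R * R -> \bar R) (t : R) :
  measurable_fun [set: R * R] f -> (forall z, 0 <= f z)%E ->
  (\int[mu2]_z f (z.1 + t * z.2, z.2)%R = \int[mu2]_z f z)%E.
Proof.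
move=> mf f0.
have msh : measurable_fun [set: R * R] (fun z : R * R => (z.1 + t * z.2, z.2)).
  apply: measurable_fun_pair => //; apply: measurable_funD => //.
  exact: measurable_funM.
have msf := measurableT_comp mf msh.
rewrite fubini_tonelli2// fubini_tonelli2//.
apply: eq_integral => y _; rewrite /fubini_G /=.
apply: (integral_translation (f := fun x => f (x, y)) (t * y)) => //.
by apply: (measurableT_comp mf); exact: measurable_fun_pair.
Qed.

(** A rotation other than the half-turn is a product of three shears, with
    parameters - s / (1 + c), s and - s / (1 + c), that is - tan (a / 2),
    sin a and - tan (a / 2) for the angle a.  This avoids a general change of
    variables. *)
Lemma integral2_rotation_aux (f : R * R -> \bar R) (c s : R) :
  c ^+ 2 + s ^+ 2 = 1 -> c != -1 ->
  measurable_fun [set: R * R] f -> (forall z, 0 <= f z)%E ->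
  (\int[mu2]_z f (c * z.1 - s * z.2, s * z.1 + c * z.2)%R = \int[mu2]_z f z)%E.
Proof.
move=> cs c1 mf f0; pose t := s / (1 + c).
have c10 : 1 + c != 0 by rewrite addrC addr_eq0.
rewrite -[RHS](integral2_shear1 (- t))//.
pose f1 z := f (z.1 + - t * z.2, z.2).
have mf1 : measurable_fun [set: R * R] f1.
  apply: measurableT_comp => //; apply: measurable_fun_pair => //.
  by apply: measurable_funD => //; exact: measurable_funM.
rewrite -[RHS](@integral2_shear2 f1 s)//; last by move=> z; exact: f0.
pose f2 z := f1 (z.1, z.2 + s * z.1).
have mf2 : measurable_fun [set: R * R] f2.
  apply: measurableT_comp => //; apply: measurable_fun_pair => //.
  by apply: measurable_funD => //; exact: measurable_funM.
rewrite -[RHS](@integral2_shear1 f2 (- t))//; last by move=> z; exact: f0.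
apply: eq_integral => z _; congr f; rewrite /= /t.
have ts : s * (s / (1 + c)) = 1 - c.
  have -> : s * (s / (1 + c)) = s ^+ 2 / (1 + c) by ring.
  have -> : s ^+ 2 = 1 - c ^+ 2 by rewrite -cs; ring.
  by field.
congr pair.
  have -> : z.1 + - (s / (1 + c)) * z.2 + - (s / (1 + c)) * (z.2 + s * (z.1 + - (s / (1 + c)) * z.2))
     = z.1 - (s * (s / (1 + c))) * z.1 - s / (1 + c) * z.2 * (2 - s * (s / (1 + c))) by ring.
  by rewrite ts; field.
have -> : z.2 + s * (z.1 + - (s / (1 + c)) * z.2) = z.2 + s * z.1 - (s * (s / (1 + c))) * z.2 by ring.
by rewrite ts; ring.
Qed.

Lemma integral2_rotation (f : R * R -> \bar R) (c s : R) :
  c ^+ 2 + s ^+ 2 = 1 ->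
  measurable_fun [set: R * R] f -> (forall z, 0 <= f z)%E ->
  (\int[mu2]_z f (c * z.1 - s * z.2, s * z.1 + c * z.2)%R = \int[mu2]_z f z)%E.
Proof.
move=> cs mf f0; have [c1|c1] := eqVneq c (-1); last exact: integral2_rotation_aux.
have s0 : s = 0.
  by apply/eqP; rewrite -sqrf_eq0; apply/eqP; move: cs; rewrite c1; lra.
(* The half-turn, which the three shears miss, is twice the quarter-turn. *)
have N1 : (0 : R) != -1 by rewrite eq_sym oppr_eq0 oner_eq0.
have q : (0 : R) ^+ 2 + 1 ^+ 2 = 1 by ring.
rewrite -[RHS](integral2_rotation_aux q N1)//.
pose f1 z := f (0 * z.1 - 1 * z.2, 1 * z.1 + 0 * z.2).
have mf1 : measurable_fun [set: R * R] f1.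
  apply: measurableT_comp => //; apply: measurable_fun_pair => //.
    by apply: measurable_funB => //; exact: measurable_funM.
  by apply: measurable_funD => //; exact: measurable_funM.
rewrite -[RHS](@integral2_rotation_aux f1 _ _ q N1)//; last by move=> z; exact: f0.
by apply: eq_integral => z _; congr f; rewrite /= c1 s0; congr pair; ring.
Qed.

Definition gauss2_pdf (z : R * R) : R := normal_pdf 0 1 z.1 * normal_pdf 0 1 z.2.

Lemma measurable_gauss2_pdf : measurable_fun [set: R * R] gauss2_pdf.
Proof.
apply: measurable_funM; apply: measurableT_comp => //; exact: measurable_normal_pdf.
Qed.

Lemma gauss2_pdf_ge0 z : 0 <= gauss2_pdf z.
Proof. by rewrite mulr_ge0// normal_pdf_ge0. Qed.

Lemma gauss2_pdf_rotation (c s : R) (z : R * R) : c ^+ 2 + s ^+ 2 = 1 ->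
  gauss2_pdf (c * z.1 - s * z.2, s * z.1 + c * z.2) = gauss2_pdf z.
Proof.
move=> cs; rewrite /gauss2_pdf /= !normal_pdfE ?oner_neq0// /normal_fun !subr0.
rewrite mulrACA [RHS]mulrACA -!expRD; congr (_ * expR _).
rewrite -!mulrDl; congr (_ / _).
have -> : - (c * z.1 - s * z.2) ^+ 2 - (s * z.1 + c * z.2) ^+ 2
  = - (c ^+ 2 + s ^+ 2) * (z.1 ^+ 2 + z.2 ^+ 2) by ring.
by rewrite cs; ring.
Qed.

(** Given by its density and not as a product measure, so that the invariance
    of Lebesgue measure applies directly; [gauss2_rect] identifies it as the
    product of two standard normal laws. *)
Definition gauss2 (A : set (R * R)) : \bar R :=
  (\int[mu2]_(z in A) (gauss2_pdf z)%:E)%E.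

Let gauss2_0 : gauss2 set0 = 0%E.
Proof. by rewrite /gauss2 integral_set0. Qed.

Let gauss2_ge0 A : (0 <= gauss2 A)%E.
Proof. by apply: integral_ge0 => z _; rewrite lee_fin gauss2_pdf_ge0. Qed.

Let gauss2_sigma_additive : semi_sigma_additive gauss2.
Proof.
move=> F mF tF mUF; rewrite /gauss2 ge0_integral_bigcup//.
- by apply: is_cvg_ereal_nneg_natsum_cond => n _ _; exact: gauss2_ge0.
- apply: measurable_funTS; apply/measurable_EFinP; exact: measurable_gauss2_pdf.
- by move=> z _; rewrite lee_fin gauss2_pdf_ge0.
Qed.

HB.instance Definition _ := isMeasure.Build _ _ _
  gauss2 gauss2_0 gauss2_ge0 gauss2_sigma_additive.

Lemma gauss2_rect (A B : set R) : measurable A -> measurable B ->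
  gauss2 (A `*` B) = (gamma A * gamma B)%E.
Proof.
move=> mA mB; rewrite /gauss2 integral_mkcond.
have mpd (C : set R) : measurable C ->
    measurable_fun [set: R] (fun x => (normal_pdf 0 1 x * \1_C x)%:E : \bar R).
  move=> mC; apply/measurable_EFinP; apply: measurable_funM.
    exact: measurable_normal_pdf.
  exact: measurable_indic.
have pd0 (C : set R) x : (0 <= (normal_pdf 0 1 x * \1_C x : R)%:E)%E.
  by rewrite lee_fin mulr_ge0// normal_pdf_ge0.
have gE (C : set R) : measurable C ->
    gamma C = (\int[mu]_x (normal_pdf 0 1 x * \1_C x)%:E)%E.
  move=> mC; rewrite /normal_prob integral_mkcond; apply: eq_integral => x _.
  by rewrite patchE indicE; case: (x \in C); rewrite ?mulr1 ?mulr0.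
transitivity (\int[mu2]_z ((normal_pdf 0 1 z.1 * \1_A z.1)%:E * (normal_pdf 0 1 z.2 * \1_B z.2)%:E))%E.
  apply: eq_integral => z _; rewrite patchE /gauss2_pdf !indicE in_setX.
  by case: (_ \in A); case: (_ \in B); rewrite -EFinM ?mulr1 ?mulr0 ?mul0r.
rewrite fubini_tonelli1 /=; last 2 first.
- by apply: emeasurable_funM; apply: (measurableT_comp (mpd _ _)).
- by move=> z; rewrite mule_ge0.
transitivity (\int[mu]_x ((normal_pdf 0 1 x * \1_A x)%:E * gamma B))%E.
  apply: eq_integral => x _; rewrite (gE B mB) /fubini_F /=.
  apply: ge0_integralZl => //; exact: mpd.
rewrite (gE A mA); apply: ge0_integralZr => //; exact: mpd.
Qed.

(** The density depends only on the distance to the origin. *)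
Lemma gauss2_rotation (c s : R) (A : set (R * R)) : c ^+ 2 + s ^+ 2 = 1 ->
  measurable A ->
  gauss2 [set z | A (c * z.1 - s * z.2, s * z.1 + c * z.2)] = gauss2 A.
Proof.
move=> cs mA; rewrite /gauss2 integral_mkcond [RHS]integral_mkcond.
rewrite -[RHS](integral2_rotation cs).
- apply: eq_integral => z _; rewrite !patchE gauss2_pdf_rotation//.
- apply/(measurable_restrictT _ mA); apply: measurable_funTS.
  by apply/measurable_EFinP; exact: measurable_gauss2_pdf.
- by move=> z; rewrite patchE; case: ifP => // _; rewrite lee_fin gauss2_pdf_ge0.
Qed.

Lemma gauss2T : gauss2 setT = 1%E.
Proof. by rewrite -setXTT gauss2_rect// probability_setT mule1. Qed.

End plane.

(** * Sheppard's formula in the plane *)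

(** Cauchy's functional equation on an interval.  A nonnegative additive
    function is monotone, so that [t] may be compared with the multiples of
    [L / m]: this gives |f t - (t / L) f L| <= f L / m for every [m]. *)
Lemma additive_ge0_linear (R : realType) (f : R -> R) (L : R) : 0 < L ->
  (forall t, 0 <= t <= L -> 0 <= f t) ->
  (forall s t, 0 <= s -> 0 <= t -> s + t <= L -> f (s + t) = f s + f t) ->
  forall t, 0 <= t <= L -> f t = t / L * f L.
Proof.
move=> L0 f0 fD.
have fmono s t : 0 <= s -> s <= t -> t <= L -> f s <= f t.
  move=> s0 st tL; have -> : t = s + (t - s) by ring.
  by rewrite fD ?subr_ge0//; [rewrite lerDl f0//; apply/andP; split; lra|lra].
have fk k t : 0 <= t -> k%:R * t <= L -> f (k%:R * t) = k%:R * f t.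
  move=> t0; elim: k => [_|k ih kL].
    rewrite !mul0r; have := fD 0 0 (lexx _) (lexx _); rewrite addr0 => /(_ (ltW L0)); lra.
  rewrite -natr1 mulrDl mul1r fD ?mulr_ge0//; last by move: kL; rewrite -natr1; lra.
  by rewrite ih ?mulrDl ?mul1r//; move: kL; rewrite -natr1; lra.
have fLm m : (0 < m)%N -> m%:R * f (L / m%:R) = f L.
  move=> m0; have mR : 0 < m%:R :> R by rewrite ltr0n.
  have e : m%:R * (L / m%:R) = L by field; rewrite gt_eqF.
  by rewrite -fk ?e// divr_ge0// ltW.
move=> t /andP[t0]; rewrite le_eqVlt => /predU1P[->|tL].
  by rewrite divff ?mul1r// gt_eqF.
have fL0 : 0 <= f L by rewrite f0// lexx ltW.
have main m : (0 < m)%N -> `|f t - t / L * f L| * m%:R <= f L.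
  move=> m0; have mR : 0 < m%:R :> R by rewrite ltr0n.
  have x0 : 0 <= m%:R * t / L by rewrite divr_ge0 ?mulr_ge0// ltW.
  have /andP[k1 k2] := truncn_itv x0.
  set k := Num.truncn _ in k1 k2.
  pose h := L / m%:R.
  have h0 : 0 <= h by rewrite divr_ge0// ltW.
  have kt : k%:R * h <= t by rewrite /h mulrA ler_pdivrMr// -ler_pdivlMr// [t * _]mulrC.
  have tk : t < k.+1%:R * h by rewrite /h mulrA ltr_pdivlMr// -ltr_pdivrMr// [t * _]mulrC.
  have km : (k.+1 <= m)%N.
    rewrite -(ltr_nat R) (le_lt_trans k1)// ltr_pdivrMr// ltr_pM2l//.
  have kL : k.+1%:R * h <= L.
    by rewrite /h mulrA ler_pdivrMr// mulrC ler_pM2l// ler_nat.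
  have f1 : k%:R * f h <= f t.
    by rewrite -fk//; [rewrite fmono ?mulr_ge0// ltW|lra].
  have f2 : f t <= k.+1%:R * f h by rewrite -fk// fmono// ltW.
  have fh : f h = f L / m%:R by rewrite -(fLm m m0) mulrC mulKf// gt_eqF.
  have q1 : m%:R * f h = f L by exact: fLm.
  have fh0 : 0 <= f h by rewrite fh divr_ge0// ltW.
  have -> : f L = f h * m%:R by rewrite mulrC.
  rewrite ler_pM2r// mulrA -mulrAC.
  have e1 : t / L * m%:R * f h = m%:R * t / L * f h by ring.
  have e2 : k%:R * f h <= m%:R * t / L * f h by rewrite ler_wpM2r.
  have e3 : m%:R * t / L * f h <= k.+1%:R * f h by rewrite ler_wpM2r// ltW.
  have -> : t / L * m%:R * f h = m%:R * t / L * f h by ring.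
  rewrite -natr1 mulrDl mul1r in f2 e3.
  by rewrite ler_norml; apply/andP; split; lra.
apply/eqP; rewrite -subr_eq0 -normr_eq0; apply/negPn/negP => neq.
have e0 : 0 < `|f t - t / L * f L| by rewrite lt_def neq normr_ge0.
set e := `|_| in main e0 neq.
have q0 : 0 <= f L / e by rewrite divr_ge0// ltW.
have /andP[_ k2] := truncn_itv q0.
have := main _ (ltn0Sn (Num.truncn (f L / e))).
by rewrite leNgt mulrC -ltr_pdivrMr// k2.
Qed.

Section measurable_bool.
Context d (T : measurableType d).
Implicit Types f g : T -> bool.

Lemma measurable_set_bool f : measurable_fun setT f -> measurable [set x | f x].
Proof.
move=> mf; have -> : [set x | f x] = setT `&` f @^-1` [set true].
  by rewrite setTI.
exact: mf.
Qed.

Lemma measurable_fun_neqb f g : measurable_fun setT f -> measurable_fun setT g ->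
  measurable_fun setT (fun x => f x != g x).
Proof.
move=> mf mg.
have -> : (fun x => f x != g x) = (fun x => (f x && ~~ g x) || (~~ f x && g x)).
  by apply/funext => x; case: (f x); case: (g x).
by apply: measurable_or; apply: measurable_and => //; exact: measurable_neg.
Qed.

End measurable_bool.

Section sector.
Context {R : realType}.
Local Notation G2 := (@gauss2 R).
Local Notation gamma := (normal_prob (0 : R) 1).

(** A double sector with apex at the origin; the zeros of a form count as
    negative, which only matters on two lines. *)
Definition disagree (a b : R * R) : set (R * R) :=
  [set z | (0 < a.1 * z.1 + a.2 * z.2) != (0 < b.1 * z.1 + b.2 * z.2)].

Lemma measurable_disagree a b : measurable (disagree a b).
Proof.
apply: measurable_set_bool; apply: measurable_fun_neqb;
  apply: measurable_fun_ltr => //; apply: measurable_funD => //;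
  exact: measurable_funM.
Qed.

Lemma gauss2_fin (A : set (R * R)) : measurable A -> (G2 A \is a fin_num)%E.
Proof.
move=> mA; rewrite ge0_fin_numE; last exact: measure_ge0.
apply: (@le_lt_trans _ _ (G2 setT)); first by rewrite le_measure ?inE.
by rewrite gauss2T ltry.
Qed.

Let axis : set (R * R) := [set z | z.1 = 0].

Let axisE : axis = [set 0] `*` setT.
Proof. by apply/seteqP; split => -[x y] //= []. Qed.

Let measurable_axis : measurable axis.
Proof. by rewrite axisE; exact: measurableX. Qed.

Lemma normal_prob_set1 (x : R) : gamma [set x] = 0%E.
Proof.
have /null_content_dominatesP := @normal_prob_dominates R 0 1.
apply; [exact: measurable_set1|exact: lebesgue_measure_set1].
Qed.

Let gauss2_axis : G2 axis = 0%E.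
Proof. by rewrite axisE gauss2_rect// normal_prob_set1 mul0e. Qed.

(* The axis z.1 = 0 is removed because the strict sign [0 < z.1] treats its
   points asymmetrically, which would spoil the additivity of sectors. *)
Let gauss2_off_axis A : measurable A -> G2 (A `\` axis) = G2 A.
Proof.
move=> mA.
have -> : G2 A = (G2 (A `\` axis) + G2 (A `&` axis))%E.
  exact: (measureDI G2 mA measurable_axis).
have -> : G2 (A `&` axis) = 0%E; last by rewrite adde0.
apply/eqP; rewrite eq_le measure_ge0 andbT -[leRHS]gauss2_axis.
by rewrite le_measure ?inE//; exact: measurableI.
Qed.

Lemma disagree_rotate (a b : R * R) (c s : R) : c ^+ 2 + s ^+ 2 = 1 ->
  G2 (disagree (c * a.1 + s * a.2, c * a.2 - s * a.1)
               (c * b.1 + s * b.2, c * b.2 - s * b.1))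
  = G2 (disagree a b).
Proof.
move=> cs; rewrite -(gauss2_rotation cs (measurable_disagree a b)).
congr G2; apply/seteqP; split => z; rewrite /disagree /=.
  have e (u : R * R) : u.1 * (c * z.1 - s * z.2) + u.2 * (s * z.1 + c * z.2)
    = (c * u.1 + s * u.2) * z.1 + (c * u.2 - s * u.1) * z.2 by ring.
  by rewrite !e.
have e (u : R * R) : u.1 * (c * z.1 - s * z.2) + u.2 * (s * z.1 + c * z.2)
  = (c * u.1 + s * u.2) * z.1 + (c * u.2 - s * u.1) * z.2 by ring.
by rewrite !e.
Qed.

Let sector (t : R) := disagree (1, 0) (cos t, sin t).

(** As the angle grows from 0 to [s + t] the sign of the form along it changes
    at most once: for 0 < s + t < pi the form at angle [s] is a nonnegative
    combination of those at angles 0 and [s + t], by the identity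
    sin (s + t) u_s = sin t u_0 + sin s u_(s+t). *)
Lemma between_sign (s t : R) (z : R * R) : 0 <= s -> 0 <= t -> s + t <= pi ->
  z.1 != 0 ->
  (0 < z.1) = (0 < cos (s + t) * z.1 + sin (s + t) * z.2) ->
  (0 < cos s * z.1 + sin s * z.2) = (0 < z.1).
Proof.
move=> s0 t0 stpi z10; set us := cos s * _ + _; set ut := cos (s + t) * _ + _.
have st0 : 0 <= s + t by rewrite addr_ge0.
have [st_eq0|st_neq0] := eqVneq (s + t) 0.
  have -> : us = z.1; last by [].
  have s_eq0 : s = 0 by lra.
  by rewrite /us s_eq0 cos0 sin0 mul1r mul0r addr0.
have [st_pi|st_npi] := eqVneq (s + t) pi.
  have -> : ut = - z.1 by rewrite /ut st_pi cospi sinpi; ring.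
  by move: z10; rewrite oppr_gt0; case: (ltgtP z.1 0).
have sst : 0 < sin (s + t).
  by apply: sin_gt0_pi; rewrite lt_def st_neq0 st0 lt_neqAle st_npi.
have ss : 0 <= sin s by apply: sin_ge0_pi; apply/andP; split; lra.
have st : 0 <= sin t by apply: sin_ge0_pi; apply/andP; split; lra.
have key : sin (s + t) * us = sin t * z.1 + sin s * ut.
  rewrite /us /ut cosD sinD.
  have := cos2Dsin2 s => e.
  have -> : sin t * z.1 = (cos s ^+ 2 + sin s ^+ 2) * (sin t * z.1) by rewrite e mul1r.
  ring.
have [z1p|z1n] := ltP 0 z.1 => /esym.
  move=> utp; rewrite -(pmulr_rgt0 _ sst) key.
  have [ss0|ss0] := eqVneq (sin s) 0; last first.
    have ssp : 0 < sin s by rewrite lt_def ss0.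
    by rewrite ltr_wpDl ?mulr_ge0 ?mulr_gt0// ltW.
  rewrite ss0 mul0r addr0 mulr_gt0// lt_def st andbT.
  by apply: contraTneq sst => st_0; rewrite sinD ss0 st_0 mul0r mulr0 addr0 ltxx.
move=> /negbT; rewrite -leNgt => utn.
rewrite -(pmulr_rgt0 _ sst) key; apply/negbTE; rewrite -leNgt.
by rewrite -oppr_ge0 opprD addr_ge0// -mulrN mulr_ge0// oppr_ge0.
Qed.

(* Off the axis the sector of angle [s + t] is the disjoint union of that of
   angle [s] and of [Y], which is the sector of angle [t] rotated by [s]. *)
Let sectorD (s t : R) : 0 <= s -> 0 <= t -> s + t <= pi ->
  (G2 (sector (s + t)) = G2 (sector s) + G2 (sector t))%E.
Proof.
move=> s0 t0 stpi.
pose Y := disagree (cos s, sin s) (cos (s + t), sin (s + t)).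
have YE : G2 Y = G2 (sector t).
  have e1 := cos2Dsin2 s.
  rewrite /sector.
  have <- : (cos s * cos s + sin s * sin s, cos s * sin s - sin s * cos s) = (1, 0) :> R * R.
    by rewrite -e1; congr pair; ring.
  have <- : (cos s * cos (s + t) + sin s * sin (s + t),
             cos s * sin (s + t) - sin s * cos (s + t)) = (cos t, sin t).
    by rewrite cosD sinD; congr pair; rewrite -[RHS]mul1r -e1; ring.
  exact/esym/(disagree_rotate (cos s, sin s) (cos (s + t), sin (s + t)) e1).
rewrite -YE -(gauss2_off_axis (measurable_disagree _ _)).
rewrite -(gauss2_off_axis (measurable_disagree (1, 0) (cos s, sin s))).
rewrite -(gauss2_off_axis (measurable_disagree (cos s, sin s) _)).
have sec (z : R * R) : 1 * z.1 + 0 * z.2 = z.1 by ring.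
rewrite -measureU.
- congr G2; apply/seteqP; split => z; rewrite /disagree /= !sec.
    by move=> [+ z0]; case: (0 < z.1); case: (0 < cos s * _ + _);
      case: (0 < cos (s + t) * _ + _) => //= _; [right|left|left|right].
  move=> h; have z0 : z.1 != 0 by case: h => -[_ /eqP].
  have bs := between_sign s0 t0 stpi z0; split; last exact/eqP.
  move: bs; case: h => -[+ _];
    move: (0 < z.1) (0 < cos s * z.1 + sin s * z.2)
      (0 < cos (s + t) * z.1 + sin (s + t) * z.2).
    by case=> -[] [] //= _ /(_ erefl).
  by case=> -[] [] //= _ /(_ erefl).
- by apply: measurableD => //; exact: measurable_disagree.
- by apply: measurableD => //; exact: measurable_disagree.
- apply/seteqP; split => // z; rewrite /disagree /= !sec => -[[+ /eqP z0] [+ _]].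
  have := between_sign s0 t0 stpi z0.
  by case: (0 < z.1); case: (0 < cos s * _ + _);
      case: (0 < cos (s + t) * _ + _) => //= /(_ erefl).
Qed.

Let sector_pi : G2 (sector pi) = 1%E.
Proof.
rewrite -(@gauss2T R) -(gauss2_off_axis measurableT).
rewrite -(gauss2_off_axis (measurable_disagree _ _)); congr G2.
apply/seteqP; split => z [_ z0]; split => //.
have : z.1 != 0 by exact/eqP.
rewrite /disagree /= cospi sinpi.
have -> : 1 * z.1 + 0 * z.2 = z.1 by ring.
have -> : -1 * z.1 + 0 * z.2 = - z.1 by ring.
by rewrite oppr_gt0; case: (ltgtP z.1 0).
Qed.

Lemma gauss2_sector (t : R) : 0 <= t <= pi -> G2 (sector t) = (t / pi)%:E.
Proof.
have fin u : (G2 (sector u) \is a fin_num)%E.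
  by apply: gauss2_fin; exact: measurable_disagree.
move=> tpi; rewrite -(fineK (fin t)); congr (_%:E).
rewrite (@additive_ge0_linear _ (fun u => fine (G2 (sector u))) pi)//.
- by rewrite sector_pi mulr1.
- exact: pi_gt0.
- by move=> u _; apply: fine_ge0; exact: measure_ge0.
- by move=> s u s0 u0 su; rewrite sectorD// fineD.
Qed.

Lemma disagreeC (a b : R * R) : disagree a b = disagree b a.
Proof. by apply/seteqP; split => z; rewrite /disagree /= eq_sym. Qed.

(** Rotate so that [a] becomes the first axis and use the symmetry in [a] and
    [b] to have [b] in the upper half-plane; then [b] lies at the angle
    acos <a, b>. *)
Lemma gauss2_disagree (a b : R * R) :
  a.1 ^+ 2 + a.2 ^+ 2 = 1 -> b.1 ^+ 2 + b.2 ^+ 2 = 1 ->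
  G2 (disagree a b) = (acos (a.1 * b.1 + a.2 * b.2) / pi)%:E.
Proof.
move=> a1 b1.
wlog e0 : a b a1 b1 / 0 <= a.1 * b.2 - a.2 * b.1.
  move=> wl; have [|e0] := leP 0 (a.1 * b.2 - a.2 * b.1); first exact: wl.
  rewrite disagreeC wl//; last by lra.
  by congr ((acos _ / _)%:E); ring.
have key : (a.1 * b.1 + a.2 * b.2) ^+ 2 + (a.1 * b.2 - a.2 * b.1) ^+ 2 = 1.
  transitivity ((a.1 ^+ 2 + a.2 ^+ 2) * (b.1 ^+ 2 + b.2 ^+ 2)); first by ring.
  by rewrite a1 b1 mulr1.
set x := a.1 * b.1 + _ in key *; set e := _ - _ in key e0.
have x1 : -1 <= x <= 1.
  have : x ^+ 2 <= 1 by rewrite -key lerDl sqr_ge0.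
  by move=> x2; apply/andP; split; nra.
rewrite -(disagree_rotate a b a1).
rewrite -gauss2_sector ?acos_ge0 ?acos_lepi// /sector acosK ?in_itv//= sin_acos//.
have -> : Num.sqrt (1 - x ^+ 2) = e.
  have -> : 1 - x ^+ 2 = e ^+ 2 by move: key; lra.
  by rewrite sqrtr_sqr ger0_norm.
have -> : (a.1 * a.1 + a.2 * a.2, a.1 * a.2 - a.2 * a.1) = (1, 0) :> R * R.
  by rewrite -a1; congr pair; ring.
by [].
Qed.

End sector.

(** * Sheppard's formula for independent normal variables *)

Section iid_normal.
Context {R : realType} d (T : measurableType d) (P : probability T R) (I : finType).
Local Notation gamma := (normal_prob (0 : R) 1).
Implicit Types (G : I -> T -> R) (u v w : I -> R) (i j k : I).

(** Independence through rectangles, as in the model; [iid_normal_pair] extends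
    it to arbitrary events in one pair of coordinates. *)
Definition iid_normal G :=
  (forall i, measurable_fun setT (G i)) /\
  forall B : I -> set R, (forall i, measurable (B i)) ->
    P [set w | forall i, B i (G i w)] = (\prod_i gamma (B i))%E.

Lemma measurable_rect (G : I -> T -> R) (B : I -> set R) : (forall i, measurable_fun setT (G i)) ->
  (forall i, measurable (B i)) -> measurable [set w | forall i, B i (G i w)].
Proof.
move=> mG mB; rewrite (_ : [set w | _] = \bigcap_(i in [set: I]) (G i @^-1` B i)).
  apply: fin_bigcap_measurable => // i _.
  by rewrite -[X in measurable X]setTI; exact: mG.
by apply/seteqP; split => w /= h i; [move=> _|]; exact: h.
Qed.

(** As functions of [A] both sides are finite measures that agree on
    rectangles, which form a generating class closed under intersection. *)
Lemma iid_normal_pair G (B : I -> set R) i j (A : set (R * R)) :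
  iid_normal G -> i != j -> (forall k, measurable (B k)) -> measurable A ->
  P [set w | A (G i w, G j w) /\ forall k, k != i -> k != j -> B k (G k w)]
  = (gauss2 A * \prod_(k | (k != i) && (k != j)) gamma (B k))%E.
Proof.
move=> [mG GP] ij mB mA.
pose c : \bar R := (\prod_(k | (k != i) && (k != j)) gamma (B k))%E.
have c0 : (0 <= c)%E by apply: prode_ge0 => k _; exact: measure_ge0.
have cfin : (c \is a fin_num)%E.
  apply: prode_fin_num => k _.
  by apply: (@fin_num_measure _ _ _ (normal_prob (0 : R) 1)); exact: mB.
pose E := [set w | forall k, k != i -> k != j -> B k (G k w)].
have mE : measurable E.
  rewrite (_ : E = [set w | forall k, (if (k != i) && (k != j) then B k else setT) (G k w)]).
    by apply: (@measurable_rect G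
      (fun k => if (k != i) && (k != j) then B k else setT)) => // k; case: ifP.
  apply/seteqP; split => w /= h k; last by move=> ki kj; have := h k; rewrite ki kj.
  by case: ifPn => // /andP[ki kj]; exact: h.
have mpair : measurable_fun [set: T] (fun t : T => (G i t, G j t)).
  exact: measurable_fun_pair.
have fc0 : 0 <= fine c by exact: fine_ge0.
pose m1 := pushforward (mrestr P mE) (fun t : T => (G i t, G j t)).
pose m2 := mscale (NngNum fc0) (@gauss2 R).
suff : m1 A = m2 A.
  rewrite /m1 /m2 /pushforward /mrestr /mscale /= fineK// => m12.
  by rewrite muleC; exact: m12.
pose Rect : set (set (R * R)) := [set C | exists C1, measurable C1 /\ exists C2, measurable C2 /\ C = C1 `*` C2].
have RectT : Rect setT.
  by exists setT; split => //; exists setT; split => //; rewrite setXTT.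
apply: (measure_unique Rect (fun=> setT)) => //.
- rewrite measurable_prod_measurableType; congr (<<s _ >>).
  rewrite predeqE; split => [[C1 mC1 [C2 mC2 <-]]|[C1 [mC1 [C2 [mC2 ->]]]]].
    by exists C1; split => //; exists C2.
  by exists C1 => //; exists C2.
- move=> /= _ _ [X1 [mX1 [X2 [mX2 ->]]]] [Y1 [mY1 [Y2 [mY2 ->]]]].
  rewrite -setXI; exists (X1 `&` Y1); split; first exact: measurableI.
  by exists (X2 `&` Y2); split => //; exact: measurableI.
- by apply/seteqP; split => // x _; exists 0%N.
- move=> _ [C1 [mC1 [C2 [mC2 ->]]]].
  transitivity (c * (gamma C1 * gamma C2))%E; last first.
    transitivity ((fine c)%:E * gauss2 (C1 `*` C2))%E; last by [].
    by rewrite gauss2_rect// fineK.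
  rewrite /m1 /pushforward /mrestr /=.
  pose B' k := if k == i then C1 else if k == j then C2 else B k.
  have mB' k : measurable (B' k) by rewrite /B'; case: ifP => //; case: ifP.
  transitivity (P [set w | forall k, B' k (G k w)]).
    congr (P _); apply/seteqP; split => w /=.
      move=> [[/= h1 h2] hE] k; rewrite /B'.
      have [->//|ki] := eqVneq k i; have [->//|kj] := eqVneq k j; exact: hE.
    move=> h; split; last first.
      by move=> k ki kj; have := h k; rewrite /B' (negbTE ki) (negbTE kj).
    split => /=; first by have := h i; rewrite /B' eqxx.
    by have := h j; rewrite /B' eqxx eq_sym (negbTE ij).
  rewrite GP// (bigD1 i)//= (bigD1 j) 1?eq_sym//= muleA muleC.
  rewrite /B' eqxx eq_sym (negbTE ij) eqxx; congr (_ * _)%E.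
  by apply: eq_bigr => k /andP[/negbTE -> /negbTE ->].
- move=> _; change (P (((fun t : T => (G i t, G j t)) @^-1` setT) `&` E) < +oo)%E.
  by rewrite preimage_setT setTI (le_lt_trans (probability_le1 _ mE))// ltry.
Qed.

Definition plane_rot i j (c s : R) v : I -> R := fun k =>
  if k == i then c * v i - s * v j else if k == j then s * v i + c * v j else v k.

Definition dotp v w : R := \sum_k v k * w k.

Lemma dotp_split i j v w : i != j -> dotp v w =
  v i * w i + v j * w j + \sum_(k | (k != i) && (k != j)) v k * w k.
Proof.
by move=> ij; rewrite /dotp (bigD1 i)//= (bigD1 j) 1?eq_sym//= addrA.
Qed.

Lemma dotp_rot i j c s v w : i != j -> c ^+ 2 + s ^+ 2 = 1 ->
  dotp (plane_rot i j c s v) (plane_rot i j c s w) = dotp v w.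
Proof.
move=> ij cs; rewrite !(dotp_split _ _ ij); congr (_ + _); last first.
  by apply: eq_bigr => k /andP[ki kj]; rewrite /plane_rot (negbTE ki) (negbTE kj).
rewrite /plane_rot !eqxx eq_sym (negbTE ij).
transitivity ((c ^+ 2 + s ^+ 2) * (v i * w i + v j * w j)); first by ring.
by rewrite cs mul1r.
Qed.

Lemma iid_normal_rot G i j c s : i != j -> c ^+ 2 + s ^+ 2 = 1 ->
  iid_normal G -> iid_normal (fun k (t : T) => plane_rot i j c s (G^~ t) k).
Proof.
move=> ij cs nG; have [mG GP] := nG; split=> [k|B mB].
  rewrite /plane_rot; case: eqP => _; last case: eqP => _ //.
    by apply: measurable_funB; exact: measurable_funM.
  by apply: measurable_funD; exact: measurable_funM.
pose A := [set z : R * R | (B i `*` B j) (c * z.1 - s * z.2, s * z.1 + c * z.2)].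
have mBij : measurable (B i `*` B j) by exact: measurableX.
have mA : measurable A.
  rewrite -[A]setTI.
  have : measurable_fun [set: R * R] (fun z : R * R => (c * z.1 - s * z.2, s * z.1 + c * z.2)).
    apply: measurable_fun_pair.
      by apply: measurable_funB => //; exact: measurable_funM.
    by apply: measurable_funD => //; exact: measurable_funM.
  by apply.
transitivity (P [set w | A (G i w, G j w) /\ forall k, k != i -> k != j -> B k (G k w)]).
  congr (P _); apply/seteqP; split => w /=.
    move=> h; split.
      split => /=; first by have := h i; rewrite /plane_rot eqxx.
      by have := h j; rewrite /plane_rot eqxx eq_sym (negbTE ij).
    by move=> k ki kj; have := h k; rewrite /plane_rot (negbTE ki) (negbTE kj).
  move=> [[/= h1 h2] h] k; rewrite /plane_rot.
  have [->//|ki] := eqVneq k i; have [->//|kj] := eqVneq k j; exact: h.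
rewrite (iid_normal_pair nG ij mB mA) (gauss2_rotation cs mBij) gauss2_rect//.
by apply/esym; rewrite (bigD1 i)//= (bigD1 j) 1?eq_sym//= muleA.
Qed.

(** Both clauses hold for a plane rotation and are stable under composition;
    this replaces orthogonal matrices. *)
Definition normal_isometry (F : (I -> R) -> (I -> R)) :=
  (forall v w, dotp (F v) (F w) = dotp v w) /\
  (forall G, iid_normal G -> iid_normal (fun k (t : T) => F (G^~ t) k)).

Lemma normal_isometry_comp F1 F2 : normal_isometry F1 -> normal_isometry F2 ->
  normal_isometry (F2 \o F1).
Proof.
move=> [d1 n1] [d2 n2]; split=> [v w|G nG] /=; first by rewrite d2 d1.
exact: (n2 _ (n1 _ nG)).
Qed.

(** Givens elimination: one rotation in the plane of the coordinates [j] and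
    [k], for each [k] in [s], moves the component along [k] into coordinate
    [j].  The third clause lets two eliminations be performed in
    succession. *)
Lemma eliminate_coordinates j (s : seq I) v : j \notin s -> exists F,
  [/\ normal_isometry F, forall k, k \in s -> F v k = 0
    & forall u, (forall k, k \in j :: s -> u k = 0) -> F u = u].
Proof.
elim: s => [_|k s ih]; first by exists id; split => //; split.
rewrite inE negb_or => /andP[jk js]; have [F [isoF Fv Ffix]] := ih js.
have [v0|v0] := eqVneq (F v k) 0.
  exists F; split => // [l|u u0]; first by rewrite inE => /predU1P[->//|]; exact: Fv.
  apply: Ffix => l; rewrite inE => /predU1P[->|ls]; apply: u0; rewrite !inE ?eqxx//.
  by rewrite ls !orbT.
pose r := Num.sqrt (F v j ^+ 2 + F v k ^+ 2).
have r2 : r ^+ 2 = F v j ^+ 2 + F v k ^+ 2 by rewrite sqr_sqrtr// addr_ge0// sqr_ge0.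
have r0 : r != 0.
  rewrite -sqrf_eq0 r2 gt_eqF// ltr_wpDl ?sqr_ge0//.
  by rewrite lt_def sqrf_eq0 v0 sqr_ge0.
pose c := F v j / r; pose sn := - (F v k / r).
have cs : c ^+ 2 + sn ^+ 2 = 1.
  rewrite sqrrN !expr_div_n -mulrDl -r2 divff//; by rewrite sqrf_eq0.
exists (plane_rot j k c sn \o F); split.
- apply: normal_isometry_comp => //; split => [x y|G nG]; first exact: dotp_rot.
  exact: iid_normal_rot.
- move=> l ls /=; rewrite /plane_rot.
  have [lj|lj] := eqVneq l j.
    by move: ls; rewrite lj inE (negbTE jk) (negbTE js).
  have [lk|lk] := eqVneq l k; first by rewrite /sn /c; ring.
  by apply: Fv; move: ls; rewrite inE (negbTE lk).
- move=> u u0 /=; rewrite Ffix; last first.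
    move=> l; rewrite inE => /predU1P[->|ls]; apply: u0; rewrite !inE ?eqxx//.
    by rewrite ls !orbT.
  apply/funext => l; rewrite /plane_rot.
  have uj : u j = 0 by apply: u0; rewrite inE eqxx.
  have uk : u k = 0 by apply: u0; rewrite !inE eqxx orbT.
  have [->|lj] := eqVneq l j; first by rewrite uj uk; ring.
  by have [->|lk] := eqVneq l k; first by rewrite uj uk; ring.
Qed.

(** The elimination applied to [v] with pivot [i], and then to the image of
    [w] with pivot [j], brings both vectors into the plane of the coordinates
    [i] and [j], preserving the law of [G] and the inner products; there the
    formula is [gauss2_disagree]. *)
Lemma sheppard G i j v w : iid_normal G -> i != j ->
  dotp v v = 1 -> dotp w w = 1 ->
  P [set t | (0 < dotp v (G^~ t)) != (0 < dotp w (G^~ t))]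
  = (acos (dotp v w) / pi)%:E.
Proof.
move=> nG ij v1 w1.
have iE : i \notin [seq k <- index_enum I | k != i] by rewrite mem_filter eqxx.
have [F1 [iso1 F1v _]] := eliminate_coordinates v iE.
have jE : j \notin [seq k <- index_enum I | (k != i) && (k != j)].
  by rewrite mem_filter eqxx andbF.
have [F2 [iso2 F2w F2fix]] := eliminate_coordinates (F1 w) jE.
have [dF nF] := normal_isometry_comp iso1 iso2.
set F := F2 \o F1 in dF nF.
have Fv : forall k, k != i -> k != j -> F v k = 0.
  move=> k ki kj; rewrite /F /= F2fix; first by apply: F1v; rewrite mem_filter ki mem_index_enum.
  move=> l lE; apply: F1v; move: lE; rewrite inE !mem_filter !mem_index_enum !andbT.
  by case/predU1P => [->|/andP[]//]; rewrite eq_sym.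
have Fw : forall k, k != i -> k != j -> F w k = 0.
  by move=> k ki kj; rewrite /F /= F2w// mem_filter ki kj mem_index_enum.
have dot2 x y : (forall k, k != i -> k != j -> x k = 0) ->
    dotp x y = x i * y i + x j * y j.
  move=> x0; rewrite (dotp_split _ _ ij) big1 ?addr0//.
  by move=> k /andP[ki kj]; rewrite x0// mul0r.
pose a := (F v i, F v j); pose b := (F w i, F w j).
have a1 : a.1 ^+ 2 + a.2 ^+ 2 = 1 by rewrite -v1 -dF dot2// !expr2.
have b1 : b.1 ^+ 2 + b.2 ^+ 2 = 1 by rewrite -w1 -dF dot2// !expr2.
have ab : a.1 * b.1 + a.2 * b.2 = dotp v w by rewrite -dF dot2.
rewrite -ab -(gauss2_disagree a1 b1).
have := iid_normal_pair (nF _ nG) ij (fun _ => measurableT) (measurable_disagree a b).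
rewrite big1 ?mule1 => [<-|k _]; last exact: probability_setT.
congr (P _); apply/seteqP; split => t /=; rewrite /disagree /=.
  by move=> h; split => //; move: h; rewrite -dF -[dotp w _]dF !dot2.
by move=> [+ _]; rewrite -[dotp v _]dF -[dotp w _]dF !dot2.
Qed.

End iid_normal.

(** * Independence, sure events and laws of random vectors *)

Section independence.
Context {R : realType} d (T : measurableType d) (P : probability T R) (J : finType).

Definition indep_sets (F : J -> set (set T)) :=
  forall A : J -> set T, (forall j, F j (A j)) ->
    P [set w | forall j, A j w] = (\prod_j P (A j))%E.

Lemma measurable_forall (A : J -> set T) : (forall j, measurable (A j)) ->
  measurable [set w | forall j, A j w].
Proof.
move=> mA; rewrite (_ : [set w | _] = \bigcap_(j in [set: J]) A j).
  by apply: fin_bigcap_measurable => // j _.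
by apply/seteqP; split => w /= h j; [move=> _|]; exact: h.
Qed.

(** The classes are replaced by the generated sigma-algebras one at a time:
    when all the other events are fixed, both sides are finite measures of the
    remaining one and agree on a class closed under intersection. *)
Lemma indep_sets_sigma (F : J -> set (set T)) :
  (forall j, F j `<=` measurable) -> (forall j, setI_closed (F j)) ->
  (forall j, F j setT) -> indep_sets F -> indep_sets (fun j => <<s F j>>).
Proof.
move=> Fm FI FT Find.
have sFm j : <<s F j>> `<=` measurable.
  by apply: smallest_sub => //; exact: sigma_algebra_measurable.
have main (s : seq J) : forall A : J -> set T, (forall j, j \in s -> <<s F j>> (A j)) ->
    (forall j, j \notin s -> F j (A j)) ->
    P [set w | forall j, A j w] = (\prod_j P (A j))%E.
  elim: s => [A _ FA|j s ih A sA FA]; first by apply: Find => j; exact: FA.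
  have [js|js] := boolP (j \in s).
    apply: ih => i iE; first by apply: sA; rewrite inE iE orbT.
    by apply: FA; rewrite inE negb_or iE andbT; apply: contraNneq iE => ->.
  have mA i : measurable (A i).
    have [/sA/sFm//|/FA/Fm//] := boolP (i \in j :: s).
  pose B := [set w | forall i, i != j -> A i w].
  pose A' (X : set T) i := if i == j then X else A i.
  have BE : B = [set w | forall i, A' setT i w].
    apply/seteqP; split => w /= h i; first by rewrite /A'; case: eqVneq => // ij; exact: h.
    by move=> ij; have := h i; rewrite /A' (negbTE ij).
  have mB : measurable B.
    by rewrite BE; apply: measurable_forall => i; rewrite /A'; case: ifP.
  have A'E X : [set w | forall i, A' X i w] = X `&` B.
    apply/seteqP; split => w /=.
      move=> h; split; first by have := h j; rewrite /A' eqxx.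
      by move=> i ij; have := h i; rewrite /A' (negbTE ij).
    by move=> [Xw h] i; rewrite /A'; case: eqVneq => // ij; exact: h.
  pose c : \bar R := (\prod_(i | i != j) P (A i))%E.
  have c0 : (0 <= c)%E by apply: prode_ge0.
  have cfin : (c \is a fin_num)%E.
    by apply: prode_fin_num => k _; exact: fin_num_measure.
  have fc0 : 0 <= fine c by exact: fine_ge0.
  have A'P X : (\prod_i P (A' X i) = P X * c)%E.
    rewrite (bigD1 j)//= /A' eqxx; congr (_ * _)%E.
    by apply: eq_bigr => i /negbTE ->.
  have AA' : A = A' (A j).
    by apply/funext => i; rewrite /A'; case: eqVneq => // ->.
  have m12 X : F j X -> mrestr P mB X = mscale (NngNum fc0) P X.
    move=> FX; transitivity (P [set w | forall i, A' X i w]); first by rewrite A'E.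
    rewrite ih; last first.
    - move=> i iE; rewrite /A'; case: eqVneq => [->//|ij].
      by apply: FA; rewrite inE negb_or ij.
    - move=> i iE; rewrite /A'; case: eqVneq => [ij|ij].
        by move: js; rewrite -ij iE.
      by apply: sA; rewrite inE iE orbT.
    rewrite A'P muleC; transitivity ((fine c)%:E * P X)%E; last by [].
    by rewrite fineK.
  rewrite [in LHS]AA' A'E [in RHS]AA' A'P muleC.
  transitivity ((fine c)%:E * P (A j))%E; last by rewrite fineK.
  apply: (g_sigma_algebra_measure_unique (F j) (Fm j) (fun=> setT) _ _
    (mrestr P mB) (mscale (NngNum fc0) P) (FI j) m12 _ (A j)) => //.
  - by apply/seteqP; split => // x _; exists 0%N.
  - move=> _; change (P (setT `&` B) < +oo)%E.
    by rewrite setTI (le_lt_trans (probability_le1 _ mB))// ltry.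
  - by apply: sA; rewrite inE eqxx.
move=> A sA; apply: (main (index_enum J)) => j; first by move=> _; exact: sA.
by rewrite mem_index_enum.
Qed.

End independence.

Section rectangles.
Context {R : realType}.

(** The rectangles restricted only in the coordinates of the block [a]; the
    sigma-algebra they generate is that of the random vector formed by
    these coordinates. *)
Definition block_rects (T : Type) (I : finType) (X : I -> T -> R) (a : pred I) : set (set T) :=
  [set A | exists B : I -> set R, [/\ forall i, measurable (B i),
     forall i, ~~ a i -> B i = setT & A = [set w | forall i, B i (X i w)]]].

Lemma block_rectsT (T : Type) (I : finType) (X : I -> T -> R) (a : pred I) : block_rects X a setT.
Proof. by exists (fun=> setT); split => //; apply/seteqP; split. Qed.

Lemma block_rectsI (T : Type) (I : finType) (X : I -> T -> R) (a : pred I) : setI_closed (block_rects X a).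
Proof.
move=> _ _ [B [mB Ba ->]] [C [mC Ca ->]].
exists (fun i => B i `&` C i); split=> [i|i ai|]; first exact: measurableI.
  by rewrite Ba// Ca// setTI.
apply/seteqP; split => w /=; first by move=> [h1 h2] i; split.
by move=> h; split => i; have [] := h i.
Qed.

Lemma block_rects_measurable d (T : measurableType d) (I : finType) (X : I -> T -> R) (a : pred I) :
  (forall i, measurable_fun setT (X i)) -> block_rects X a `<=` measurable.
Proof. by move=> mX _ [B [mB _ ->]]; exact: measurable_rect. Qed.

Lemma measurable_block (T : pointedType) (I : finType) (X : I -> T -> R) (a : pred I) i : a i ->
  @measurable_fun _ _ (g_sigma_algebraType (block_rects X a)) R setT (X i).
Proof.
move=> ai _ B mB; rewrite setTI; apply: sub_sigma_algebra.
exists (fun j => if j == i then B else setT); split=> [j|j aj|].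
- by case: ifP.
- by case: eqP => // ji; move: aj; rewrite ji ai.
- apply/seteqP; split => w /=; last by move=> /(_ i); rewrite eqxx.
  by move=> Bw j; case: eqP => // ->.
Qed.

(** For a family whose joint law is a product, the product over coordinates
    may be regrouped by blocks, every coordinate being restricted by at most
    one of them. *)
Lemma block_rects_indep d (T : measurableType d) (P : probability T R)
    (I J : finType) (X : I -> T -> R) (m : I -> set R -> \bar R)
    (a : J -> pred I) :
  (forall i, m i setT = 1%E) ->
  (forall B : I -> set R, (forall i, measurable (B i)) ->
    P [set w | forall i, B i (X i w)] = (\prod_i m i (B i))%E) ->
  (forall i j j', a j i -> a j' i -> j = j') ->
  indep_sets P (fun j => block_rects X (a j)).
Proof.
move=> m1 PX adisj A /choice[B BP].
have mB j i : measurable (B j i) by have [] := BP j.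
have Ba j i : ~~ a j i -> B j i = setT by have [_ h _] := BP j; exact: h.
have AE j : A j = [set w | forall i, B j i (X i w)] by have [] := BP j.
pose C i := [set x | forall j, B j i x].
have mC i : measurable (C i) by exact: measurable_forall.
transitivity (P [set w | forall i, C i (X i w)]).
  congr (P _); apply/seteqP; split => w /=; first by move=> h i j; have := h j; rewrite AE.
  by move=> h j; rewrite AE => i; exact: h.
rewrite PX//; under [RHS]eq_bigr do rewrite AE PX//.
rewrite exchange_big /=; apply: eq_bigr => i _.
have [[j aji]|na] := pselect (exists j, a j i); last first.
  rewrite big1 => [|j _]; last by rewrite Ba// ?m1//; apply/negP => aji; apply: na; exists j.
  rewrite (_ : C i = setT) ?m1//; apply/seteqP; split => // x _ j.
  by rewrite Ba//; apply/negP => aji; apply: na; exists j.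
have Bj' j' : j' != j -> B j' i = setT.
  move=> j'j; rewrite Ba//; apply: contra j'j => aj'i.
  by rewrite (adisj _ _ _ aj'i aji).
rewrite (bigD1 j)//= big1 => [|j' /Bj' ->]; last exact: m1.
rewrite mule1; congr (m i _); apply/seteqP; split => x; first by move=> /(_ j).
by move=> Bx j'; have [->//|/Bj' ->] := eqVneq j' j.
Qed.

End rectangles.

Section almost_sure.
Context {R : realType} d (T : measurableType d) (P : probability T R).

Lemma prob_setI_sure (A D : set T) : measurable A -> measurable D ->
  P D = 1%E -> P (A `&` D) = P A.
Proof.
move=> mA mD PD.
have -> : P A = (P (A `\` D) + P (A `&` D))%E by exact: measureDI.
have -> : P (A `\` D) = 0%E; last by rewrite add0e.
apply/eqP; rewrite eq_le measure_ge0 andbT.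
have -> : 0%E = P (~` D) by rewrite probability_setC// PD subee.
by rewrite le_measure ?inE//; [exact: measurableD|exact: measurableC].
Qed.

Lemma eq_prob_sure (A B D : set T) : measurable A -> measurable B -> measurable D ->
  P D = 1%E -> (forall w, D w -> A w <-> B w) -> P A = P B.
Proof.
move=> mA mB mD PD AB; rewrite -(prob_setI_sure mA mD PD) -(prob_setI_sure mB mD PD).
by congr (P _); apply/seteqP; split => w [Aw Dw]; split => //; apply/(AB w Dw).
Qed.

Lemma prob_forall_sure (I : finType) (A : I -> set T) :
  (forall i, measurable (A i)) -> (forall i, P (A i) = 1%E) ->
  P [set w | forall i, A i w] = 1%E.
Proof.
move=> mA PA.
have main (s : seq I) : measurable [set w | forall i, i \in s -> A i w] /\
    P [set w | forall i, i \in s -> A i w] = 1%E.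
  elim: s => [|i s [ms Ps]].
    rewrite (_ : [set w | _] = setT) ?probability_setT//.
    by apply/seteqP; split.
  have -> : [set w | forall j, j \in i :: s -> A j w]
      = A i `&` [set w | forall j, j \in s -> A j w].
    apply/seteqP; split => w /=.
      move=> h; split; first by apply: h; rewrite inE eqxx.
      by move=> j js; apply: h; rewrite inE js orbT.
    by move=> [Ai h] j; rewrite inE => /predU1P[->//|]; exact: h.
  by split; [exact: measurableI|rewrite prob_setI_sure].
have [_] := main (index_enum I); congr (P _ = _); apply/seteqP; split => w /= h i.
  by apply: h; rewrite mem_index_enum.
by move=> _; exact: h.
Qed.

End almost_sure.

Section random_vectors.
Context {R : realType} (p : nat).

(** These generate the product sigma-algebra on the space of vectors. *)
Definition coord_rects : set (set ('I_p -> R)) :=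
  block_rects (fun (i : 'I_p) (v : 'I_p -> R) => v i) predT.
Local Notation V := (g_sigma_algebraType coord_rects).

Lemma measurable_coord (i : 'I_p) : measurable_fun [set: V] (fun v : V => v i).
Proof. exact: (@measurable_block R ('I_p -> R) 'I_p (fun i v => v i) predT i). Qed.

Lemma measurable_vector d (T : measurableType d) (Y : 'I_p -> T -> R) :
  (forall i, measurable_fun setT (Y i)) ->
  @measurable_fun _ _ T V setT (fun w => Y^~ w).
Proof.
move=> mY; apply: (@measurability _ _ T V setT (fun w => Y^~ w) coord_rects) => // _ [_ [B [mB _ ->]] <-].
by rewrite setTI; exact: measurable_rect.
Qed.

(** Rectangles determine the law of a random vector. *)
Lemma same_law d d0 (T : measurableType d) (T0 : measurableType d0)
    (P : probability T R) (P0 : probability T0 R)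
    (Y : 'I_p -> T -> R) (X : 'I_p -> T0 -> R) :
  (forall i, measurable_fun setT (Y i)) -> (forall i, measurable_fun setT (X i)) ->
  (forall B : 'I_p -> set R, (forall i, measurable (B i)) ->
     P [set w | forall i, B i (Y i w)] = P0 [set w | forall i, B i (X i w)]) ->
  forall C : set V, measurable C -> P [set w | C (Y^~ w)] = P0 [set w | C (X^~ w)].
Proof.
move=> mY mX YX C mC.
have mY' := measurable_vector mY; have mX' := measurable_vector mX.
pose m1 := @pushforward _ _ T V R P (fun w => Y^~ w).
pose m2 := @pushforward _ _ T0 V R P0 (fun w => X^~ w).
suff : m1 C = m2 C by [].
apply: (@measure_unique _ R V coord_rects (fun=> setT)) => //.
- exact: block_rectsI.
- by move=> _; exact: block_rectsT.
- by apply/seteqP; split => // x _; exists 0%N.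
- by move=> _ [B [mB _ ->]]; exact: YX.
- move=> _; change (P ((fun w => Y^~ w) @^-1` setT) < +oo)%E.
  by rewrite preimage_setT probability_setT ltry.
Qed.

(** The preimage of a half-line under a monotone function is an interval. *)
Lemma monotone_itv_measurable (D : interval R) (f : R -> R) :
  {in D &, {homo f : x y / x <= y}} -> measurable_fun [set` D] f.
Proof.
move=> fD; apply: (measurability (@RGenCInfty.G R)) => [|/= _ [_] [r] -> <-].
  exact: RGenCInfty.measurableE.
apply: is_interval_measurable => s t /= [Ds fs] [Dt ft] u /andP[su ut].
have Du : u \in D by apply: (interval_is_interval Ds Dt); rewrite su.
split => //; move: fs; rewrite !in_itv/= !andbT => fs.
by rewrite (le_trans fs)// fD.
Qed.

End random_vectors.

(** * The latent Gaussian sample *)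

Section sample.
Context {R : realType} (n p : nat).
Context d0 (T0 : measurableType d0) (P0 : probability T0 R).
Context d (T : measurableType d) (P : probability T R).
Variables (X : 'I_p -> {RV P0 >-> R}) (x : 'I_n -> 'I_p -> {RV P >-> R}).
Hypothesis iidx : iid_copies X x.
Local Notation gamma := (normal_prob (0 : R) 1).

Let mX i : measurable_fun setT (X i). Proof. exact: measurable_funPT. Qed.
Let mx l i : measurable_fun setT (x l i). Proof. exact: measurable_funPT. Qed.

Let xs (li : 'I_n * 'I_p) : T -> R := x li.1 li.2.

(** Leave all the rows but [l] unrestricted. *)
Lemma iid_row_law l (B : 'I_p -> set R) : (forall i, measurable (B i)) ->
  P [set w | forall i, B i (x l i w)] = P0 [set w | forall i, B i (X i w)].
Proof.
move=> mB.
have := iidx (B := fun l' i => if l' == l then B i else setT).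
have -> : [set w | forall l' i, (if l' == l then B i else setT) (x l' i w)]
    = [set w | forall i, B i (x l i w)].
  apply/seteqP; split => w /= h; first by move=> i; have := h l i; rewrite eqxx.
  by move=> l' i; case: eqP => // ->.
move=> ->; last by move=> l' i; case: ifP.
rewrite (bigD1 l)//= big1 ?mule1 => [|l' /negbTE l'l].
  by congr (P0 _); apply/seteqP; split => w /= h i; have := h i; rewrite eqxx.
rewrite (_ : [set w | _] = setT) ?probability_setT//.
by apply/seteqP; split => // w _ i; rewrite l'l.
Qed.

Lemma iid_rows_indep :
  indep_sets P (fun l => block_rects xs (fun li => li.1 == l)).
Proof.
move=> A /choice[B BP].
have mB l li : measurable (B l li) by have [] := BP l.
have AE l : A l = [set w | forall i, B l (l, i) (x l i w)].
  have [_ Bl ->] := BP l; apply/seteqP; split => w /= h; first by move=> i; exact: (h (l, i)).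
  move=> [l' i]; have [->|l'l] := eqVneq l' l; first exact: h.
  by rewrite (Bl (l', i)).
transitivity (P [set w | forall l i, B l (l, i) (x l i w)]).
  by congr (P _); apply/seteqP; split => w /= h l; have := h l; rewrite AE.
rewrite (iidx (B := fun l i => B l (l, i)))//; apply: eq_bigr => l _.
by rewrite AE (@iid_row_law l (fun i => B l (l, i))).
Qed.

(** As [A] is invertible, the normal vector is a function of the transformed
    observation, Z = A^-1 f(X).  Applying this function to every row of the
    sample, rather than to [X], defines the variables [z] on the space of the
    sample; their joint law is that of independent copies of [Z] because the
    rows are independent and have the law of [X]. *)
Lemma latent_sample (S : 'M[R]_p) : S \in unitmx -> nonparanormal X S ->
  exists (A : 'M[R]_p) (f : 'I_p -> R -> R) (D : 'I_p -> interval R)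
    (z : 'I_n * 'I_p -> T -> R),
  [/\ A *m A^T = S, iid_normal P z,
      forall i, {in D i &, {homo f i : a b / a <= b}},
      forall l i, P (x l i @^-1` [set` D i]) = 1%E
    & forall l i w, x l i w \in D i -> f i (x l i w) = \sum_k A i k * z (l, k) w].
Proof.
move=> Su [f [D [XD fD [A [Z [AS ZP YZ]]]]]].
have Au : A \in unitmx.
  have : A *m (A^T *m invmx S) = 1%:M by rewrite mulmxA AS mulmxV.
  by move=> /mulmx1_unit[].
(* Cut off outside [D i], where [f i] need not be measurable. *)
pose f' i (t : R) := if t \in D i then f i t else 0.
have mf' i : measurable_fun setT (f' i).
  have -> : f' i = (f i) \_ [set` D i].
    by apply/funext => t; rewrite patchE /f' mem_setE.
  by apply/(measurable_restrictT _ (measurable_itv (D i))); exact: monotone_itv_measurable.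
pose g k (v : 'I_p -> R) := \sum_i invmx A k i * f' i (v i).
pose z (lk : 'I_n * 'I_p) w := g lk.2 (fun i => x lk.1 i w).
have mg k : @measurable_fun _ _ (g_sigma_algebraType (@coord_rects R p)) R setT (g k).
  apply: measurable_sum => i; apply: measurable_funM => //.
  by apply: measurableT_comp => //; exact: measurable_coord.
have mz lk : measurable_fun setT (z lk).
  apply: measurable_sum => i; apply: measurable_funM => //.
  exact: measurableT_comp.
have mD i : measurable (X i @^-1` [set` D i]).
  by rewrite -[X in measurable X]setTI; apply: mX => //; exact: measurable_itv.
exists A, f, D, z; split => //.
- split=> // B mB.
  pose C l := [set v : 'I_p -> R | forall k, B (l, k) (g k v)].
  have mC l : @measurable _ (g_sigma_algebraType (@coord_rects R p)) (C l).
    exact: (@measurable_rect R _ (g_sigma_algebraType (@coord_rects R p)) 'I_p g (fun k => B (l, k))).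
  transitivity (P [set w | forall l, C l (fun i => x l i w)]).
    by congr (P _); apply/seteqP; split => w /= h; [move=> l k; exact: (h (l, k))|move=> [l k]; exact: h].
  rewrite (indep_sets_sigma _ _ _ iid_rows_indep); last first.
  - move=> l.
    have := @measurable_rect R _ (g_sigma_algebraType (block_rects xs (fun li => li.1 == l))) 'I_p
      (fun k w => g k (fun i => x l i w)) (fun k => B (l, k)).
    apply => // k; apply: measurable_sum => i; apply: measurable_funM => //.
    apply: measurableT_comp => //.
    exact: (@measurable_block R T _ xs (fun li => li.1 == l) (l, i) (eqxx l)).
  - by move=> l; exact: block_rectsT.
  - by move=> l; exact: block_rectsI.
  - by move=> l; apply: block_rects_measurable => li; exact: mx.
  rewrite [RHS](eq_bigr (fun lk => gamma (B (lk.1, lk.2)))); last by case.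
  rewrite -(pair_bigA _ (fun l k => gamma (B (l, k)))) /=.
  apply: eq_bigr => l _.
  transitivity (P0 [set w | C l (fun i => X i w)]).
    exact: (same_law (mx l) mX (iid_row_law l)).
  rewrite -ZP//.
  apply: (@eq_prob_sure _ _ _ P0 _ _ [set w | forall i, X i w \in D i]).
  - have := @measurable_rect R _ T0 'I_p (fun k w => g k (fun i => X i w)) (fun k => B (l, k)).
    apply => // k; apply: measurable_sum => i; apply: measurable_funM => //.
    exact: measurableT_comp.
  - by apply: (@measurable_rect R _ T0 'I_p Z (fun k => B (l, k))) => // k; exact: measurable_funPT.
  - by apply: measurable_forall => i; exact: mD.
  - exact: (prob_forall_sure mD XD).
  - move=> w Dw.
    suff gZ k : g k (fun i => X i w) = Z k w.
      by split=> /= h k; have := h k; rewrite gZ.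
    rewrite /g; under eq_bigr do rewrite /f' Dw YZ mulr_sumr.
    rewrite exchange_big /=.
    under eq_bigr do under eq_bigr do rewrite mulrA.
    under eq_bigr do rewrite -mulr_suml.
    have AV j : \sum_i invmx A k i * A i j = (k == j)%:R.
      by have /matrixP/(_ k j) := mulVmx Au; rewrite !mxE.
    under eq_bigr do rewrite AV.
    by rewrite (bigD1 k)//= eqxx mul1r big1 ?addr0// => j /negbTE; rewrite eq_sym => ->; rewrite mul0r.
- move=> l i; rewrite -(XD i).
  have := @iid_row_law l (fun j => if j == i then [set` D i] else setT).
  have e Q (Y : 'I_p -> Q -> R) :
      [set w | forall j, (if j == i then [set` D i] else setT) (Y j w)] = Y i @^-1` [set` D i].
    by apply/seteqP; split => w /= h; [have := h i; rewrite eqxx|move=> j; case: eqP => // ->].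
  by rewrite !e; apply => j; case: ifP => // _; exact: measurable_itv.
- move=> l i w xD; rewrite /z /=.
  under eq_bigr do rewrite /g mulr_sumr.
  rewrite exchange_big /=.
  under eq_bigr do under eq_bigr do rewrite mulrA.
  under eq_bigr do rewrite -mulr_suml.
  have AV j : \sum_k A i k * invmx A k j = (i == j)%:R.
    by have /matrixP/(_ i j) := mulmxV Au; rewrite !mxE.
  under eq_bigr do rewrite AV.
  rewrite (bigD1 i)//= eqxx mul1r big1 ?addr0; first by rewrite /f' xD.
  by move=> j /negbTE; rewrite eq_sym => ->; rewrite mul0r.
Qed.

End sample.

(** * Concentration of U-statistics of order three *)

Section exponential.
Context {R : realType}.

(** From exp y (1 - y) <= 1, at y = x if x <= 0 and at y = x / 2, squared, if
    x > 0.  The second case needs 1 <= (1 + x + x^2) (1 - x / 2)^2, that is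
    0 <= 1 - 3 x + x^2, which fails for x slightly larger than 1 / 3. *)
Lemma expR_quadratic (x : R) : `|x| <= 1 / 3 -> expR x <= 1 + x + x ^+ 2.
Proof.
rewrite ler_norml => /andP[x1 x2].
have key (y : R) : expR y * (1 - y) <= 1.
  have := expR_ge1Dx (- y); rewrite -(ler_pM2l (expR_gt0 y)) -expRD subrr expR0.
  by [].
have [x0|x0] := leP x 0.
  have d0 : 0 < 1 - x by lra.
  by rewrite -(ler_pM2r d0) (le_trans (key x))//; nra.
have d0 : 0 < (1 - x / 2) ^+ 2 by rewrite exprn_gt0//; lra.
have e2 : expR x = expR (x / 2) ^+ 2 by rewrite expr2 -expRD; congr expR; field.
rewrite -(ler_pM2r d0) {1}e2 -exprMn.
apply: (@le_trans _ _ 1); last by rewrite expr2; nra.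
rewrite expr_le1// mulr_ge0 ?expR_ge0//; lra.
Qed.

(** A bound of Hoeffding's type for a centred Bernoulli variable: the linear
    terms of [expR_quadratic] cancel and the variance r (1 - r) is at most
    1. *)
Lemma bernoulli_mgf (r h : R) : 0 <= r <= 1 -> `|h| <= 1 / 3 ->
  r * expR (h * (1 - r)) + (1 - r) * expR (h * (0 - r)) <= expR (h ^+ 2).
Proof.
move=> /andP[r0 r1] h3.
have b1 : `|h * (1 - r)| <= 1 / 3.
  by rewrite normrM; apply: le_trans h3; rewrite ler_piMr// ger0_norm; lra.
have b2 : `|h * (0 - r)| <= 1 / 3.
  by rewrite normrM; apply: le_trans h3; rewrite ler_piMr// sub0r normrN ger0_norm.
have r1' : 0 <= 1 - r by lra.
have e1 := ler_wpM2l r0 (expR_quadratic b1).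
have e2 := ler_wpM2l r1' (expR_quadratic b2).
apply: (le_trans (lerD e1 e2)); apply: (le_trans _ (expR_ge1Dx _)).
have -> : r * (1 + h * (1 - r) + (h * (1 - r)) ^+ 2) +
  (1 - r) * (1 + h * (0 - r) + (h * (0 - r)) ^+ 2) = 1 + h ^+ 2 * (r * (1 - r)) by ring.
by rewrite lerD2l ler_piMr ?sqr_ge0//; nra.
Qed.

(** Jensen's inequality: the tangent of the exponential at the average lies
    below it. *)
Lemma expR_avg (I : finType) (a : I -> R) : (0 < #|I|)%N ->
  expR ((\sum_i a i) / #|I|%:R) <= (\sum_i expR (a i)) / #|I|%:R.
Proof.
move=> I0; have I0' : 0 < #|I|%:R :> R by rewrite ltr0n.
set m := (\sum_i a i) / _.
rewrite ler_pdivlMr//.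
have h i : expR m * (1 + (a i - m)) <= expR (a i).
  have e : a i = m + (a i - m) by ring.
  by rewrite [in leRHS]e expRD ler_pM2l ?expR_gt0// expR_ge1Dx.
apply: (@le_trans _ _ (\sum_i (expR m * (1 + (a i - m))))); last exact: ler_sum.
rewrite -mulr_sumr big_split sumrB /= !sumr_const -[m *+ _]mulr_natr.
have -> : m * #|{: I}|%:R = \sum_i a i by rewrite /m divfK// gt_eqF.
by rewrite subrr addr0.
Qed.

End exponential.

Section finite_law.
Context {R : realType} d (T : measurableType d) (P : probability T R).
Variables (F : finType) (xi : T -> F).
Hypothesis mxi : forall v, measurable [set w | xi w = v].

(** Expectations of functions of a variable with finitely many values, as
    finite sums: all the expectations in the concentration argument are of
    this kind, so that no integration theory enters. *)
Definition law_mean (phi : F -> R) : R :=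
  \sum_v fine (P [set w | xi w = v]) * phi v.

Lemma law_mean_le phi psi : (forall v, phi v <= psi v) -> law_mean phi <= law_mean psi.
Proof.
move=> h; apply: ler_sum => v _; rewrite ler_wpM2l//.
by apply: fine_ge0; exact: measure_ge0.
Qed.

Lemma law_mean_sum (I : finType) (phi : I -> F -> R) :
  law_mean (fun v => \sum_i phi i v) = \sum_i law_mean (phi i).
Proof.
rewrite /law_mean; under eq_bigr do rewrite mulr_sumr.
by rewrite exchange_big.
Qed.

Lemma law_meanZ (c : R) phi : law_mean (fun v => c * phi v) = c * law_mean phi.
Proof. by rewrite /law_mean mulr_sumr; apply: eq_bigr => v _; ring. Qed.

Lemma measurable_law (a : pred F) : measurable [set w | a (xi w)].
Proof.
rewrite (_ : [set w | _] = \bigcup_(v in [set v | a v]) [set w | xi w = v]).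
  by apply: fin_bigcup_measurable => // v _; exact: mxi.
by apply/seteqP; split => w /=; [move=> aw; exists (xi w)|move=> [v av ->]].
Qed.

Lemma law_mean_indic (a : pred F) :
  fine (P [set w | a (xi w)]) = law_mean (fun v => (a v)%:R).
Proof.
have main (s : seq F) : uniq s ->
    fine (P [set w | xi w \in s]) = \sum_(v <- s) fine (P [set w | xi w = v]).
  elim: s => [_|v s ih /= /andP[vs us]].
    by rewrite big_nil (_ : [set w | _] = set0) ?measure0//; apply/seteqP; split.
  rewrite big_cons -ih//.
  have -> : [set w | xi w \in v :: s] = [set w | xi w = v] `|` [set w | xi w \in s].
    apply/seteqP; split => w /=; first by rewrite inE => /predU1P.
    by rewrite inE => /predU1P.
  rewrite measureU//.
  - by rewrite fineD// fin_num_measure//; exact: (measurable_law (mem s)).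
  - exact: (measurable_law (mem s)).
  - by apply/seteqP; split => // w [/= xv]; rewrite xv (negbTE vs).
have := main (enum a) (enum_uniq _).
have -> : [set w | xi w \in enum a] = [set w | a (xi w)].
  by apply/seteqP; split => w /=; rewrite mem_enum.
move=> ->; rewrite big_enum /law_mean [RHS](bigID (mem a))/= [X in _ + X]big1 ?addr0.
  apply: eq_bigr => v av; have -> : a v = true by exact: av.
  by rewrite mulr1.
move=> v va; have -> : a v = false by exact/negbTE.
by rewrite mulr0.
Qed.

End finite_law.

Section permutation_average.
Context {R : realType} (n : nat).
Notation triple := ('I_n * 'I_n * 'I_n)%type.
Implicit Types (t : triple) (s : 'S_n) (f : triple -> R).

Definition distinct t : bool := [&& t.1.1 != t.1.2, t.1.1 != t.2 & t.1.2 != t.2].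

Definition perm_triple s t : triple := (s t.1.1, s t.1.2, s t.2).

Lemma distinct_perm s t : distinct (perm_triple s t) = distinct t.
Proof. by rewrite /distinct /= !(inj_eq perm_inj). Qed.

(** The symmetric group is transitive on triples of distinct indices: three
    transpositions place the three entries one after the other. *)
Lemma perm_distinct t t' : distinct t -> distinct t' ->
  exists s, perm_triple s t = t'.
Proof.
case: t => -[a b] c; case: t' => -[a' b'] c'; rewrite /distinct /=.
move=> /and3P[ab ac bc] /and3P[ab' ac' bc'].
pose s1 := tperm a a'; pose b1 := s1 b; pose s2 := tperm b1 b'.
pose c1 := s2 (s1 c); pose s3 := tperm c1 c'.
have s1a : s1 a = a' by rewrite tpermL.
have b1a : b1 != a' by rewrite -s1a (inj_eq perm_inj) eq_sym.
have s2a : s2 a' = a' by rewrite tpermD// eq_sym.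
have c1a : c1 != a' by rewrite -s2a (inj_eq perm_inj) -s1a (inj_eq perm_inj) eq_sym.
have s2b : s2 b1 = b' by rewrite tpermL.
have c1b : c1 != b' by rewrite -s2b !(inj_eq perm_inj) eq_sym.
exists (s1 * s2 * s3)%g; rewrite /perm_triple /= !permM s1a s2a -/b1 s2b -/c1.
rewrite /s3 tpermL !tpermD//; by rewrite eq_sym.
Qed.

Lemma sum_perm_eq f t t' : distinct t -> distinct t' ->
  \sum_s f (perm_triple s t) = \sum_s f (perm_triple s t').
Proof.
move=> td td'; have [s0 <-] := perm_distinct td td'.
rewrite (reindex_inj (mulgI s0)); apply: eq_bigr => s _.
by rewrite /perm_triple /= !permM.
Qed.

(** By transitivity, averaging over the permuted copies of any one triple is
    the same as averaging over all triples of distinct indices. *)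
Lemma sum_perm_triple f t : distinct t ->
  #|distinct|%:R * \sum_s f (perm_triple s t)
  = #|{: 'S_n}|%:R * \sum_(t' | distinct t') f t'.
Proof.
move=> td.
have -> : #|distinct|%:R * \sum_s f (perm_triple s t)
    = \sum_(t' | distinct t') \sum_s f (perm_triple s t').
  under [RHS]eq_bigr => t' td' do rewrite -(sum_perm_eq f td td').
  by rewrite sumr_const mulr_natl.
rewrite exchange_big /=.
have -> : #|{: 'S_n}|%:R * \sum_(t' | distinct t') f t'
    = \sum_(s : 'S_n) \sum_(t' | distinct t') f t' by rewrite sumr_const mulr_natl.
apply: eq_bigr => s _.
have bij : {on [pred t' | distinct t'], bijective (perm_triple s)}.
  exists (perm_triple s^-1%g) => -[[a b] c] _; rewrite /perm_triple /=.
    by rewrite !permK.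
  by rewrite !permKV.
rewrite [RHS](reindex _ bij) /=; apply: eq_bigl => t'.
by rewrite distinct_perm.
Qed.

End permutation_average.

Section u_statistic.
Context {R : realType} d (T : measurableType d) (P : probability T R) (n : nat).
Notation triple := ('I_n * 'I_n * 'I_n)%type.
Variable E : triple -> T -> bool.
Variable r : R.
Hypothesis mE : forall t, measurable_fun setT (E t).
Hypothesis Er : forall t, distinct t -> P [set w | E t w] = r%:E.
(* Pairwise disjoint triples involve disjoint sets of observations. *)
Hypothesis Eindep : forall (K : nat) (tau : 'I_K -> triple) (u : 'I_K -> bool),
  (forall b b' i i', i \in [:: (tau b).1.1; (tau b).1.2; (tau b).2] ->
     i' \in [:: (tau b').1.1; (tau b').1.2; (tau b').2] -> i = i' -> b = b') ->
  P [set w | forall b, E (tau b) w = u b]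
  = (\prod_b P [set w | E (tau b) w = u b])%E.
Hypothesis n3 : (3 <= n)%N.

Definition ustat (v : triple -> bool) : R :=
  (\sum_(t | distinct t) (v t)%:R) / #|distinct (n := n)|%:R.

Let K := (n %/ 3)%N.
Let K_gt0 : (0 < K)%N. Proof. by rewrite divn_gt0. Qed.

Lemma pos_subproof (b : 'I_K) (j : 'I_3) : (3 * b + j < n)%N.
Proof.
apply: leq_trans (leq_divM n 3); rewrite -/K mulnC.
case: b j => b bK [j j3] /=.
apply: (@leq_trans (b * 3 + 3)); first by rewrite ltn_add2l.
by rewrite -mulSnr leq_mul2r.
Qed.

Let pos b j : 'I_n := Ordinal (pos_subproof b j).

Let pos_inj b b' j j' : pos b j = pos b' j' -> b = b' /\ j = j'.
Proof.
move=> /(congr1 val) /= e.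
have ej : (j : nat) = j'.
  have := congr1 (modn^~ 3%N) e; rewrite ![(3 * _)%N]mulnC !modnMDl.
  by rewrite !modn_small.
have eb : (b : nat) = b' by apply/eqP; rewrite -(eqn_pmul2l (m := 3))// -(eqn_add2r j) {2}ej e.
by split; exact: val_inj.
Qed.

Let j0 : 'I_3 := @Ordinal 3 0 isT.
Let j1 : 'I_3 := @Ordinal 3 1 isT.
Let j2 : 'I_3 := @Ordinal 3 2 isT.

(* The first 3 K indices, cut into K consecutive disjoint triples. *)
Let block_triple (b : 'I_K) : triple := (pos b j0, pos b j1, pos b j2).

Let distinct_block b : distinct (block_triple b).
Proof. by rewrite /distinct /=; apply/and3P; split; apply/eqP => /pos_inj[]. Qed.

Let blocks_disjoint (s : 'S_n) (b b' : 'I_K) i i' :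
  i \in [:: (perm_triple s (block_triple b)).1.1;
            (perm_triple s (block_triple b)).1.2;
            (perm_triple s (block_triple b)).2] ->
  i' \in [:: (perm_triple s (block_triple b')).1.1;
             (perm_triple s (block_triple b')).1.2;
             (perm_triple s (block_triple b')).2] -> i = i' -> b = b'.
Proof.
rewrite !inE /= => /or3P[] /eqP -> /or3P[] /eqP -> /perm_inj /pos_inj[] //.
Qed.

Let xi w : {ffun triple -> bool} := [ffun t => E t w].

Let mEb t c : measurable [set w | E t w = c].
Proof. by rewrite -[X in measurable X]setTI; exact: (mE t measurableT (Y := [set c])). Qed.

Let mxi v : measurable [set w | xi w = v].
Proof.
rewrite (_ : [set w | _] = [set w | forall t, E t w = v t]).
  by apply: measurable_forall => t; exact: mEb.
apply/seteqP; split => w /=; first by move=> <- t; rewrite ffunE.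
by move=> h; apply/ffunP => t; rewrite ffunE.
Qed.

Let PE t c : distinct t ->
  fine (P [set w | E t w = c]) = if c then r else 1 - r.
Proof.
move=> td; case: c; first by rewrite Er.
have -> : [set w | E t w = false] = ~` [set w | E t w].
  by apply/seteqP; split => w /= => [->|/negP/negbTE].
by rewrite probability_setC ?Er//; exact: (mEb t true).
Qed.

Lemma kernel_prob01 (t : triple) : distinct t -> 0 <= r <= 1.
Proof.
move=> td; have mA : measurable [set w | E t w] by exact: (mEb t true).
by rewrite -!lee_fin -(Er td) measure_ge0 probability_le1.
Qed.

Lemma measurable_ustat_event (a : pred (triple -> bool)) :
  measurable [set w | a (E^~ w)].
Proof.
have xiE w : E^~ w = xi w by apply/funext => t; rewrite ffunE.
under eq_set do rewrite xiE.
exact: (measurable_law mxi (fun v : {ffun triple -> bool} => a v)).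
Qed.

(** Independence of events gives independence of functions of the indicators:
    both sides are expanded over the values of the indicators. *)
Lemma law_mean_prod (m : nat) (tau : 'I_m -> triple) (g : bool -> R) :
  (forall b b' i i', i \in [:: (tau b).1.1; (tau b).1.2; (tau b).2] ->
     i' \in [:: (tau b').1.1; (tau b').1.2; (tau b').2] -> i = i' -> b = b') ->
  law_mean P xi (fun v => \prod_b g (v (tau b)))
  = \prod_b \sum_c g c * fine (P [set w | E (tau b) w = c]).
Proof.
move=> tauD; rewrite bigA_distr_bigA /=.
have gE (v : {ffun triple -> bool}) : \prod_b g (v (tau b))
    = \sum_(u : {ffun 'I_m -> bool}) (\prod_b g (u b)) * [forall b, v (tau b) == u b]%:R.
  rewrite [RHS](bigD1 [ffun b => v (tau b)])//= [X in _ = _ + X]big1 ?addr0.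
    have -> : [forall b, v (tau b) == [ffun b => v (tau b)] b].
      by apply/forallP => b; rewrite ffunE.
    by rewrite mulr1; apply: eq_bigr => b _; rewrite ffunE.
  move=> u uv; rewrite (_ : [forall b, _] = false) ?mulr0//.
  apply/negbTE; apply: contra uv => /forallP h; apply/eqP/ffunP => b.
  by rewrite ffunE; apply/esym/eqP.
transitivity (law_mean P xi (fun v => \sum_(u : {ffun 'I_m -> bool})
    (\prod_b g (u b)) * [forall b, v (tau b) == u b]%:R)).
  by apply: eq_bigr => v _; rewrite gE.
rewrite law_mean_sum; apply: eq_bigr => u _.
rewrite law_meanZ big_split /=; congr (_ * _).
rewrite -(law_mean_indic P mxi (fun v => [forall b, v (tau b) == u b])).
have -> : [set w | [forall b, xi w (tau b) == u b]] = [set w | forall b, E (tau b) w = u b].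
  apply/seteqP; split => w /=; first by move=> /forallP h b; have := h b; rewrite ffunE => /eqP.
  by move=> h; apply/forallP => b; rewrite ffunE h.
rewrite Eindep// -[RHS]/(fine (\prod_(b < m) fine (P [set w | E (tau b) w = u b]))%:E).
congr fine; rewrite (big_morph EFin EFinM (erefl _)); apply: eq_bigr => b _.
by rewrite fineK// fin_num_measure.
Qed.

Lemma ustat_perm (v : triple -> bool) b :
  \sum_(s : 'S_n) (v (perm_triple s (block_triple b)))%:R = #|{: 'S_n}|%:R * ustat v.
Proof.
have N0 : (#|distinct (n := n)|%:R : R) != 0.
  by rewrite pnatr_eq0 -lt0n; apply/card_gt0P; exists (block_triple b); exact: distinct_block.
rewrite /ustat mulrA -(sum_perm_triple (fun t => (v t)%:R : R) (distinct_block b)).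
by rewrite [X in _ = X / _]mulrC mulfK.
Qed.

(** Hoeffding's device: the centred U-statistic is the average over the
    permutations [s] of the means over the K blocks permuted by [s], so
    Jensen's inequality reduces to one permutation, for which the blocks are
    independent and [bernoulli_mgf] applies with h = a / K. *)
Lemma ustat_mgf (a : R) : `|a / K%:R| <= 1 / 3 ->
  law_mean P xi (fun v => expR (a * (ustat v - r))) <= expR (a ^+ 2 / K%:R).
Proof.
set h := a / K%:R => h3.
have K0 : K%:R != 0 :> R by rewrite pnatr_eq0 -lt0n.
have Sn : (0 < #|{: 'S_n}|)%N by apply/card_gt0P; exists 1%g.
have Sn0 : 0 < #|{: 'S_n}|%:R :> R by rewrite ltr0n.
pose A (v : triple -> bool) (s : 'S_n) : R :=
  \sum_(b < K) h * ((v (perm_triple s (block_triple b)))%:R - r).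
have AE v : a * (ustat v - r) = (\sum_s A v s) / #|{: 'S_n}|%:R.
  apply: (@mulIf _ #|{: 'S_n}|%:R); first by rewrite gt_eqF.
  rewrite divfK ?gt_eqF// exchange_big /=.
  under eq_bigr do rewrite -mulr_sumr sumrB ustat_perm sumr_const -[r *+ _]mulr_natl.
  rewrite sumr_const card_ord -[_ *+ _]mulr_natr /h.
  by field.
apply: (@le_trans _ _ (law_mean P xi (fun v =>
    #|{: 'S_n}|%:R^-1 * \sum_s expR (A v s)))).
  by apply: law_mean_le => v; rewrite AE [leRHS]mulrC; exact: (expR_avg (A v) Sn).
rewrite law_meanZ law_mean_sum mulrC ler_pdivrMr// mulr_natr -sumr_const.
apply: ler_sum => s _.
pose g (c : bool) := expR (h * (c%:R - r)).
apply: (@le_trans _ _ (law_mean P xi (fun v => \prod_b g (v (perm_triple s (block_triple b)))))).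
  by rewrite le_eqVlt; apply/orP; left; apply/eqP; apply: eq_bigr => v _; rewrite expR_sum.
rewrite (law_mean_prod g (@blocks_disjoint s)).
have -> : expR (a ^+ 2 / K%:R) = \prod_(b < K) expR (h ^+ 2).
  rewrite -expR_sum sumr_const card_ord -[_ *+ _]mulr_natr /h; congr expR; field.
  exact: K0.
apply: ler_prod => b _.
have bd : distinct (perm_triple s (block_triple b)) by rewrite distinct_perm distinct_block.
rewrite big_bool /= !PE//= /g; apply/andP; split.
  have /andP[r0 r1] := kernel_prob01 bd.
  by rewrite addr_ge0// mulr_ge0 ?expR_ge0//; lra.
rewrite mulrC [X in _ + X]mulrC; apply: bernoulli_mgf => //; exact: (kernel_prob01 bd).
Qed.

(** Chernoff's bound with the parameter K t / 2, both tails being covered by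
    e = 1 and e = -1.  The condition t <= 1 / 2 keeps h = t / 2 in the range
    of [bernoulli_mgf]. *)
Lemma ustat_tail1 (e t : R) : e ^+ 2 = 1 -> 0 <= t <= 1 / 2 ->
  fine (P [set w | t < e * (ustat (E^~ w) - r)]) <= expR (- (K%:R * t ^+ 2 / 4)).
Proof.
move=> e2 /andP[t0 t1].
have K0 : K%:R != 0 :> R by rewrite pnatr_eq0 -lt0n.
have Kp : 0 <= K%:R :> R by [].
pose s : R := K%:R * t / 2.
have s0 : 0 <= s by rewrite /s divr_ge0// mulr_ge0.
have xiE w : E^~ w = xi w by apply/funext => t'; rewrite ffunE.
under eq_set do rewrite xiE.
rewrite (law_mean_indic P mxi (fun v : {ffun triple -> bool} => t < e * (ustat v - r))).
apply: (@le_trans _ _ (law_mean P xi (fun v =>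
    expR (- (s * t)) * expR ((s * e) * (ustat v - r))))).
  apply: law_mean_le => v; rewrite -expRD.
  case: ltP => h; last exact: expR_ge0.
  rewrite -[leLHS]expR0 ler_expR.
  have -> : - (s * t) + s * e * (ustat v - r) = s * (e * (ustat v - r) - t) by ring.
  by rewrite mulr_ge0// subr_ge0 ltW.
rewrite law_meanZ.
have sK : s * e / K%:R = e * (t / 2) by rewrite /s; field.
have e1 : `|e| = 1.
  by apply/eqP; rewrite -(@eqrXn2 _ 2)// ?expr1n -?normrX ?e2 ?normr1.
apply: (@le_trans _ _ (expR (- (s * t)) * expR ((s * e) ^+ 2 / K%:R))).
  rewrite ler_pM2l ?expR_gt0//; apply: ustat_mgf.
  by rewrite sK normrM e1 mul1r ger0_norm; lra.
rewrite -expRD ler_expR exprMn e2 mulr1 /s.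
by rewrite le_eqVlt; apply/orP; left; apply/eqP; field.
Qed.

Lemma ustat_concentration (t : R) : 0 <= t <= 1 / 2 ->
  fine (P [set w | t < `|ustat (E^~ w) - r|]) <= 2 * expR (- (n%:R * t ^+ 2 / 24)).
Proof.
move=> t01.
have xiE w : E^~ w = xi w by apply/funext => t'; rewrite ffunE.
have h1 := ustat_tail1 (expr1n _ 2) t01.
have h2 : fine (P [set w | t < -1 * (ustat (E^~ w) - r)]) <= expR (- (K%:R * t ^+ 2 / 4)).
  by apply: ustat_tail1 => //; rewrite sqrrN expr1n.
(* For n >= 3, K = n %/ 3 is at least n / 6, hence 24 = 4 * 6. *)
have nK : n%:R <= 6 * K%:R :> R.
  rewrite -natrM ler_nat {1}(divn_eq n 3) -/K.
  have := ltn_pmod n (isT : 0 < 3)%N; have := K_gt0; lia.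
have h3 : expR (- (K%:R * t ^+ 2 / 4)) <= expR (- (n%:R * t ^+ 2 / 24)).
  rewrite ler_expR lerN2; have := ler_wpM2r (sqr_ge0 t) nK; lra.
apply: (@le_trans _ _ (expR (- (K%:R * t ^+ 2 / 4)) + expR (- (K%:R * t ^+ 2 / 4)))); last by lra.
apply: le_trans (lerD h1 h2).
under eq_set do rewrite xiE.
under [X in _ <= fine (P X) + _]eq_set do rewrite xiE.
under [X in _ <= _ + fine (P X)]eq_set do rewrite xiE.
rewrite (law_mean_indic P mxi (fun v : {ffun triple -> bool} => t < `|ustat v - r|)).
rewrite (law_mean_indic P mxi (fun v : {ffun triple -> bool} => t < 1 * (ustat v - r))).
rewrite (law_mean_indic P mxi (fun v : {ffun triple -> bool} => t < -1 * (ustat v - r))).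
rewrite /law_mean -big_split; apply: ler_sum => v _ /=.
rewrite -mulrDr ler_wpM2l//; first by apply: fine_ge0; exact: measure_ge0.
rewrite mul1r mulN1r; case: ltP => //= h; last by rewrite addr_ge0.
move: h; case: (ger0P (ustat v - r)) => _ ->; first by rewrite lerDl.
by rewrite lerDr.
Qed.

End u_statistic.

(** * Ranks and Spearman's correlation *)

Section sums.
Context {R : realType} (n : nat).
Notation triple := ('I_n * 'I_n * 'I_n)%type.

Lemma sum_triple (F : triple -> R) : \sum_t F t = \sum_l \sum_m \sum_m' F (l, m, m').
Proof.
rewrite (eq_bigr (fun t => F (t.1, t.2))); last by case.
rewrite -(pair_bigA _ (fun lm m' => F (lm, m'))) /=.
rewrite (eq_bigr (fun lm => \sum_m' F (lm.1, lm.2, m'))); last by case.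
by rewrite -(pair_bigA _ (fun l m => \sum_m' F (l, m, m'))).
Qed.

Lemma sum_distinct (F : triple -> R) :
  \sum_l \sum_(m | m != l) \sum_(m' | m' != l) F (l, m, m')
  = \sum_(t | distinct t) F t + \sum_l \sum_(m | m != l) F (l, m, m).
Proof.
have -> : \sum_(t | distinct t) F t
    = \sum_l \sum_(m | m != l) \sum_(m' | (m' != l) && (m' != m)) F (l, m, m').
  rewrite big_mkcond sum_triple.
  apply: eq_bigr => l _; rewrite [RHS]big_mkcond; apply: eq_bigr => m _.
  rewrite /distinct /=; case: eqVneq => [->|ml] /=.
    by rewrite big1 // => m' _; rewrite eqxx.
  rewrite [RHS]big_mkcond; apply: eq_bigr => m' _.
  by rewrite (eq_sym l) (eq_sym m).
rewrite -big_split; apply: eq_bigr => l _ /=; rewrite -big_split.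
apply: eq_bigr => m ml /=; rewrite (bigD1 m)//= addrC; congr (_ + _).
Qed.

Lemma sum_off_diag (c : R) : \sum_(l < n) \sum_(m < n | m != l) c = n%:R * (n%:R - 1) * c.
Proof.
have e l : \sum_(m < n | m != l) c = (n%:R - 1) * c.
  have := sumr_const 'I_n c; rewrite (bigD1 l)//= card_ord => h.
  by rewrite mulrBl mul1r mulr_natl -h addrAC subrr add0r.
under eq_bigr do rewrite e.
by rewrite sumr_const card_ord -[LHS]mulr_natl mulrA.
Qed.

Lemma card_distinct : #|distinct (n := n)|%:R = n%:R * (n%:R - 1) * (n%:R - 2) :> R.
Proof.
have := sum_distinct (fun=> 1); rewrite sum_off_diag mulr1 sumr_const.
have e l : \sum_(m' < n | m' != l) (1 : R) = n%:R - 1.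
  have := sumr_const 'I_n (1 : R); rewrite (bigD1 l)//= card_ord => h.
  by rewrite -h addrAC subrr add0r.
under eq_bigr => l _ do under eq_bigr do rewrite e.
rewrite sum_off_diag => h.
have -> : n%:R * (n%:R - 1) * (n%:R - 2)
  = n%:R * (n%:R - 1) * (n%:R - 1) - n%:R * (n%:R - 1) :> R by ring.
by rewrite h addrK.
Qed.

End sums.

Section ranks.
Context {R : realType} (n : nat).
Implicit Types u v : 'I_n -> R.

Definition sgn u (l m : 'I_n) : R := Num.sg (u l - u m).

Definition rk u (l : 'I_n) : R := (Defs.rank u l)%:R.

Lemma sgnN u l m : sgn u m l = - sgn u l m.
Proof. by rewrite /sgn -sgrN opprB. Qed.

Lemma sgn_diag u l : sgn u l l = 0.
Proof. by rewrite /sgn subrr sgr0. Qed.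

(** A rank counts the observations [m] with u m <= u l, and without ties the
    indicator of this is (1 + (m == l) + sgn u l m) / 2. *)
Lemma rkE u l : injective u -> rk u l = (n%:R + 1) / 2 + (\sum_m sgn u l m) / 2.
Proof.
move=> u_inj; rewrite /rk /Defs.rank -sum1_card natr_sum big_mkcond /=.
have -> : (n%:R + 1) / 2 + (\sum_m sgn u l m) / 2
    = \sum_m ((1 + (m == l)%:R + sgn u l m) / 2).
  have diag : \sum_m (m == l)%:R = 1 :> R.
    by rewrite (bigD1 l)//= eqxx big1 ?addr0// => m /negbTE ->.
  by rewrite -mulr_suml !big_split /= sumr_const card_ord diag -mulrDl.
apply: eq_bigr => m _; rewrite inE /sgn.
case: (ltgtP (u m) (u l)) => [ml|lm|/u_inj ->].
- rewrite gtr0_sg ?subr_gt0//; have -> : (m == l) = false.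
    by apply: contraTF ml => /eqP ->; rewrite ltxx.
  by rewrite addr0 divff.
- rewrite ltr0_sg ?subr_lt0//; have -> : (m == l) = false.
    by apply: contraTF lm => /eqP ->; rewrite ltxx.
  by rewrite addr0 subrr mul0r.
- by rewrite eqxx subrr sgr0 addr0 divff.
Qed.

Lemma sum_sgn u : \sum_l \sum_m sgn u l m = 0.
Proof.
have : \sum_l \sum_m sgn u l m = - \sum_l \sum_m sgn u l m.
  rewrite [in LHS]exchange_big -sumrN; apply: eq_bigr => l _.
  by rewrite -sumrN; apply: eq_bigr => m _; rewrite sgnN.
by lra.
Qed.

Lemma mean_rk u : (0 < n)%N -> injective u -> Defs.mean (rk u) = (n%:R + 1) / 2.
Proof.
move=> n0 u_inj; rewrite /Defs.mean; under eq_bigr do rewrite rkE//.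
rewrite big_split /=.
have -> : \sum_l (\sum_m sgn u l m) / 2 = 0 by rewrite -mulr_suml sum_sgn mul0r.
rewrite addr0 sumr_const card_ord.
by rewrite -[_ *+ _]mulr_natr mulfK// pnatr_eq0 -lt0n.
Qed.

Lemma rank_lt u l m : u l < u m -> (Defs.rank u l < Defs.rank u m)%N.
Proof.
move=> lm; apply: proper_card; apply/properP; split.
  by apply/fintype.subsetP => k; rewrite !inE => kl; exact: le_trans kl (ltW lm).
by exists m; rewrite !inE// -ltNge.
Qed.

(** Without ties the ranks are 1, ..., n in some order, which determines their
    variance. *)
Lemma rank_bij u : injective u ->
  exists s : 'S_n, forall l, Defs.rank u l = (s l).+1.
Proof.
move=> u_inj.
have rk0 l : (0 < Defs.rank u l)%N.
  by apply/card_gt0P; exists l; rewrite inE.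
have rkn l : ((Defs.rank u l).-1 < n)%N.
  rewrite prednK//; apply: leq_trans (max_card _) _; by rewrite card_ord.
have inj : injective (fun l => Ordinal (rkn l)).
  move=> l m /(congr1 val) /= e.
  have {}e : Defs.rank u l = Defs.rank u m by rewrite -(prednK (rk0 l)) e prednK.
  apply: u_inj; case: (ltgtP (u l) (u m)) => // /rank_lt; by rewrite e ltnn.
by exists (perm inj) => l; rewrite permE /= prednK.
Qed.

Lemma sum_sq_ord (k : nat) (c : R) :
  \sum_(i < k) (i.+1%:R - c) ^+ 2
  = k%:R * (k%:R + 1) * (2 * k%:R + 1) / 6 - c * k%:R * (k%:R + 1) + k%:R * c ^+ 2.
Proof.
elim: k => [|k ih]; first by rewrite big_ord0; field.
by rewrite big_ord_recr /= ih -natr1; field.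
Qed.

Lemma sum_sq_rk u : injective u ->
  \sum_l (rk u l - (n%:R + 1) / 2) ^+ 2 = n%:R * (n%:R ^+ 2 - 1) / 12.
Proof.
move=> /rank_bij[s sE]; under eq_bigr do rewrite /rk sE.
transitivity (\sum_(k < n) (k.+1%:R - (n%:R + 1) / 2) ^+ 2 : R).
  by rewrite [RHS](reindex_inj (@perm_inj _ s)).
by rewrite sum_sq_ord; field.
Qed.

(** The kernel of order three of Spearman's correlation. *)
Definition discordant u v (t : 'I_n * 'I_n * 'I_n) : bool :=
  (u t.1.2 < u t.1.1) != (v t.2 < v t.1.1).

Lemma sgn_neq u l m : injective u -> m != l -> sgn u l m = if u m < u l then 1 else -1.
Proof.
move=> u_inj ml; rewrite /sgn; case: (ltgtP (u m) (u l)) => [h|h|/u_inj e].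
- by rewrite gtr0_sg// subr_gt0.
- by rewrite ltr0_sg// subr_lt0.
- by rewrite e eqxx in ml.
Qed.

Lemma pearson_rank u v : (1 < n)%N -> injective u -> injective v ->
  pearson (rk u) (rk v) = (n%:R * (n%:R ^+ 2 - 1) / 12)^-1 *
    ((\sum_l (\sum_m sgn u l m) * (\sum_m sgn v l m)) / 4).
Proof.
move=> n1 u_inj v_inj; have n0 : (0 < n)%N by exact: ltnW.
rewrite /pearson !mean_rk// !sum_sq_rk// -expr2 sqr_sqrtr; last first.
  have : 1 < n%:R :> R by rewrite ltr1n.
  by move=> h; rewrite divr_ge0// mulr_ge0//; nra.
rewrite mulrC; congr (_ * _); rewrite mulr_suml; apply: eq_bigr => l _.
by rewrite !rkE//; field.
Qed.

Lemma pearson_rank_diag u : (1 < n)%N -> injective u -> pearson (rk u) (rk u) = 1.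
Proof.
move=> n1 u_inj; have n0 : (0 < n)%N by exact: ltnW.
have h : 1 < n%:R :> R by rewrite ltr1n.
have V0 : 0 < n%:R * (n%:R ^+ 2 - 1) / 12 :> R by rewrite divr_gt0// mulr_gt0//; nra.
rewrite /pearson !mean_rk//.
have -> : \sum_l (rk u l - (n%:R + 1) / 2) * (rk u l - (n%:R + 1) / 2)
    = n%:R * (n%:R ^+ 2 - 1) / 12 by rewrite -(sum_sq_rk u_inj).
by rewrite ?sum_sq_rk// -expr2 sqr_sqrtr ?divff ?gt_eqF// ltW.
Qed.

(** For distinct indices the product of the two signs is 1 or -1 according to
    whether the triple is concordant; the remaining sum collects the triples
    with m = m'. *)
Lemma sum_sgn_mul u v : injective u -> injective v ->
  \sum_l (\sum_m sgn u l m) * (\sum_m sgn v l m)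
  = #|distinct (n := n)|%:R * (1 - 2 * @ustat R n (discordant u v))
    + \sum_l \sum_(m | m != l) sgn u l m * sgn v l m.
Proof.
move=> u_inj v_inj.
have sum_off w l : \sum_m sgn w l m = \sum_(m | m != l) sgn w l m.
  by rewrite (bigD1 l)//= sgn_diag add0r.
under eq_bigr => l _ do rewrite !sum_off mulr_suml.
under eq_bigr => l _ do under eq_bigr do rewrite mulr_sumr.
rewrite (sum_distinct (fun t => sgn u t.1.1 t.1.2 * sgn v t.1.1 t.2)) /=; congr (_ + _).
have -> : \sum_(t | distinct t) sgn u t.1.1 t.1.2 * sgn v t.1.1 t.2
    = \sum_(t | distinct t) (1 - 2 * (discordant u v t)%:R).
  apply: eq_bigr => -[[l m] m'] /and3P[/= lm lm' mm'].
  rewrite !sgn_neq 1?eq_sym// /discordant /=.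
  by case: (u m < u l); case: (v m' < v l) => /=; ring.
rewrite sumrB sumr_const -mulr_sumr /ustat mulrBr mulr1; congr (_ - _).
have [N0|N0] := eqVneq (#|distinct (n := n)|%:R : R) 0; last by field.
rewrite N0 mul0r big1 ?mulr0// => t td; exfalso.
move/eqP: N0; rewrite pnatr_eq0 => /eqP/card0_eq/(_ t).
by rewrite [LHS]td.
Qed.

(** Exactly, the correlation is (n - 2) / (n + 1) * 3 (1 - 2 U) plus
    3 / (n + 1) times an average [q / (n (n - 1))] of products of signs.
    Replacing the factor (n - 2) / (n + 1) by 1 costs 9 / (n + 1), and the
    average costs 3 / (n + 1): hence the constant 12. *)
Lemma spearman_ustat u v (r : R) : (3 <= n)%N -> injective u -> injective v ->
  0 <= r <= 1 ->
  `|pearson (rk u) (rk v) - 3 * (1 - 2 * r)|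
    <= 6 * `|ustat (discordant u v) - r| + 12 / (n%:R + 1).
Proof.
move=> n3 u_inj v_inj /andP[r0 r1].
have nR : 3 <= n%:R :> R by rewrite (ler_nat _ 3).
rewrite pearson_rank ?sum_sgn_mul//; last by exact: leq_trans n3.
rewrite card_distinct; set q := \sum_l \sum_(m | _) _.
set U := ustat _.
have q_le : `|q| <= n%:R * (n%:R - 1).
  rewrite -[leRHS]mulr1 -sum_off_diag (le_trans (ler_norm_sum _ _ _))//.
  apply: ler_sum => l _; rewrite (le_trans (ler_norm_sum _ _ _))//.
  apply: ler_sum => m _; rewrite normrM /sgn !normr_sg -natrM.
  by case: (_ != _); case: (_ != _); rewrite ?ler01.
move: (n%:R : R) nR q_le => N N3 q_le.
have N0 : N != 0 by apply/eqP; lra.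
have N1 : N + 1 != 0 by apply/eqP; lra.
have N2 : N - 1 != 0 by apply/eqP; lra.
have -> : (N * (N ^+ 2 - 1) / 12)^-1 *
    ((N * (N - 1) * (N - 2) * (1 - 2 * U) + q) / 4) - 3 * (1 - 2 * r)
  = - (6 * ((N - 2) / (N + 1))) * (U - r) + - (9 / (N + 1)) * (1 - 2 * r)
    + 3 / (N + 1) * (q / (N * (N - 1))).
  by field; rewrite N0 N1 N2 /=; apply/eqP; nra.
have Np : 0 < N + 1 by lra.
have NN : 0 < N * (N - 1) by nra.
have N1p : 0 <= N + 1 by exact: ltW.
have c9 : 0 <= 9 / (N + 1) by rewrite divr_ge0.
have c3 : 0 <= 3 / (N + 1) by rewrite divr_ge0.
have t1 : `|- (6 * ((N - 2) / (N + 1))) * (U - r)| <= 6 * `|U - r|.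
  rewrite normrM normrN ler_wpM2r// ger0_norm; last first.
    by rewrite mulr_ge0// divr_ge0//; lra.
  by rewrite -[leRHS]mulr1 ler_pM2l// ler_pdivrMr//; lra.
have t2 : `|- (9 / (N + 1)) * (1 - 2 * r)| <= 9 / (N + 1).
  rewrite normrM normrN (ger0_norm c9) ler_piMr//.
  by rewrite ler_norml; apply/andP; split; lra.
have t3 : `|3 / (N + 1) * (q / (N * (N - 1)))| <= 3 / (N + 1).
  rewrite normrM (ger0_norm c3) ler_piMr//.
  by rewrite normrM normfV (gtr0_norm NN) ler_pdivrMr// mul1r.
have -> : 12 / (N + 1) = 9 / (N + 1) + 3 / (N + 1) by field.
rewrite addrA (le_trans (ler_normD _ _))// lerD// (le_trans (ler_normD _ _))//.
exact: lerD.
Qed.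

End ranks.

(** * Two trigonometric facts and the union bound *)

Section trigonometry.
Context {R : realType}.

Lemma sin_lipschitz (a b : R) : `|sin a - sin b| <= `|a - b|.
Proof.
wlog ab : a b / a <= b.
  move=> h; have [/h//|/ltW/h] := leP a b; by rewrite distrC [leRHS]distrC.
have [->|ab'] := eqVneq a b; first by rewrite !subrr.
have alb : a < b by rewrite lt_neqAle ab' ab.
have [c _ e] := @MVT R sin cos a b alb (fun x _ => is_derive_sin x)
  (continuous_subspaceT (@continuous_sin R)).
by rewrite distrC e normrM [leRHS]distrC ler_piMl// cos_max.
Qed.

(** The triple angle formula makes s = sin (pi / 6) a root of
    (s + 1) (2 s - 1)^2. *)
Lemma sin_pi6 : sin (pi / 6) = 1 / 2 :> R.
Proof.
set s : R := sin _.
have s0 : 0 < s.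
  apply: sin_gt0_pihalf; have := @pi_gt0 R => h; apply/andP; split; lra.
have : sin (pi / 6 + pi / 6 + pi / 6) = 1 :> R.
  have -> : pi / 6 + pi / 6 + pi / 6 = pi / 2 :> R by field.
  exact: sin_pihalf.
rewrite !sinD cosD -/s; set c := cos _ => e.
have cs : c ^+ 2 = 1 - s ^+ 2 by rewrite /c cos2sin2.
have e3 : 3 * s - 4 * s ^+ 3 = 1.
  rewrite -[RHS]e.
  transitivity (3 * s * (1 - s ^+ 2) - s ^+ 3); first by ring.
  by rewrite -cs; ring.
have : (s + 1) * (2 * s - 1) ^+ 2 = 0.
  transitivity (1 - (3 * s - 4 * s ^+ 3)); first by ring.
  by rewrite e3 subrr.
move/eqP; rewrite mulf_eq0 sqrf_eq0 => /orP[/eqP|/eqP]; lra.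
Qed.

End trigonometry.

Section union_bound.
Context {R : realType} d (T : measurableType d) (P : probability T R).

Lemma union_bound (I : finType) (A : I -> set T) (e : R) :
  (forall i, measurable (A i)) -> (forall i, fine (P (~` A i)) <= e) ->
  1 - #|I|%:R * e <= fine (P [set w | forall i, A i w]).
Proof.
move=> mA PA.
have main (s : seq I) : measurable [set w | forall i, i \in s -> A i w] /\
    1 - (size s)%:R * e <= fine (P [set w | forall i, i \in s -> A i w]).
  elim: s => [|i s [ms Ps]].
    rewrite (_ : [set w | _] = setT) ?probability_setT/=.
      by split => //; rewrite mul0r subr0.
    by apply/seteqP; split.
  set B := [set w | _] in ms Ps.
  have -> : [set w | forall j, j \in i :: s -> A j w] = A i `&` B.
    apply/seteqP; split => w /=.
      move=> h; split; first by apply: h; rewrite inE eqxx.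
      by move=> j js; apply: h; rewrite inE js orbT.
    by move=> [Ai h] j; rewrite inE => /predU1P[->//|]; exact: h.
  split; first exact: measurableI.
  have PB : (P B <= P (~` A i) + P (A i `&` B))%E.
    have -> : P B = (P (B `\` A i) + P (A i `&` B))%E.
      by rewrite setIC; exact: measureDI.
    rewrite leeD2r// le_measure ?inE//; first exact: measurableD.
    exact: measurableC.
  have fin (C : set T) : measurable C -> (P C \is a fin_num)%E by exact: fin_num_measure.
  have mAB : measurable (A i `&` B) by exact: measurableI.
  have mAC : measurable (~` A i) by exact: measurableC.
  have : fine (P B) <= fine (P (~` A i)) + fine (P (A i `&` B)).
    by rewrite -fineD ?fin// fine_le// ?fin// fin_numD !fin.
  have := PA i; move: Ps => /=; rewrite -natr1 mulrDl mul1r; lra.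
have [_] := main (enum I); rewrite -cardE; congr (_ <= fine (P _)).
by apply/seteqP; split => w /= h i; [apply: h; rewrite mem_enum|move=> _; exact: h].
Qed.

End union_bound.

(** * Discordance in the latent Gaussian sample *)

Section latent.
Context {R : realType} d (T : measurableType d) (P : probability T R) (n p : nat).
Variables (S A : 'M[R]_p) (z : 'I_n * 'I_p -> T -> R).
Hypothesis AS : A *m A^T = S.
Hypothesis S1 : forall i, S i i = 1.
Hypothesis S_le1 : forall i j, `|S i j| <= 1.
Hypothesis nz : iid_normal P z.
Hypothesis p0 : (0 < p)%N.
Local Notation triple := ('I_n * 'I_n * 'I_n)%type.

Let k0 : 'I_p := Ordinal p0.

Definition latent (i : 'I_p) (l : 'I_n) (w : T) : R := \sum_k A i k * z (l, k) w.

Let mz lk : measurable_fun setT (z lk). Proof. by have [] := nz. Qed.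

Lemma measurable_latent i l : measurable_fun setT (latent i l).
Proof. by apply: measurable_sum => k; exact: measurable_funM. Qed.

(** A difference of latent variables is a linear form in the independent
    variables [z]; dividing by sqrt 2 makes its vector of coefficients a unit
    vector, as Sheppard's formula requires. *)
Let contrast (i : 'I_p) (l m : 'I_n) (lk : 'I_n * 'I_p) : R :=
  ((lk.1 == l)%:R - (lk.1 == m)%:R) * A i lk.2 / Num.sqrt 2.

Let sum_eqn (l : 'I_n) (f : 'I_n -> R) : \sum_l' (l' == l)%:R * f l' = f l.
Proof.
by rewrite (bigD1 l)//= eqxx mul1r big1 ?addr0// => m /negbTE ->; rewrite mul0r.
Qed.

Let dotp_pair (f g : 'I_n * 'I_p -> R) : dotp f g = \sum_l \sum_k f (l, k) * g (l, k).
Proof.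
rewrite /dotp (eq_bigr (fun lk => f (lk.1, lk.2) * g (lk.1, lk.2))); last by case.
by rewrite -(pair_bigA _ (fun l k => f (l, k) * g (l, k))).
Qed.

Let contrast_latent i l m w :
  dotp (contrast i l m) (z^~ w) = (latent i l w - latent i m w) / Num.sqrt 2.
Proof.
rewrite dotp_pair /contrast /=.
transitivity (\sum_l' ((l' == l)%:R - (l' == m)%:R) * (latent i l' w / Num.sqrt 2)).
  apply: eq_bigr => l' _; rewrite /latent mulr_suml mulr_sumr.
  by apply: eq_bigr => k _; ring.
under eq_bigr do rewrite mulrBl.
by rewrite sumrB !sum_eqn -mulrBl.
Qed.

Let sqrt2 : Num.sqrt 2 ^+ 2 = 2 :> R. Proof. by rewrite sqr_sqrtr. Qed.
Let sqrt2_gt0 : 0 < Num.sqrt 2 :> R. Proof. by rewrite sqrtr_gt0. Qed.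

Let dotp_contrast i j l m l' m' :
  dotp (contrast i l m) (contrast j l' m')
  = ((l == l')%:R - (l == m')%:R - ((m == l')%:R - (m == m')%:R)) * S i j / 2.
Proof.
have AA : \sum_k A i k * A j k = S i j.
  by rewrite -AS mxE; apply: eq_bigr => k _; rewrite mxE.
rewrite dotp_pair /contrast /=.
transitivity (\sum_h ((h == l)%:R - (h == m)%:R) *
    (((h == l')%:R - (h == m')%:R) * S i j / 2)).
  apply: eq_bigr => h _; rewrite -AA -[X in _ / X]sqrt2.
  rewrite !(mulr_sumr, mulr_suml); apply: eq_bigr => k _.
  by field; rewrite gt_eqF.
under eq_bigr do rewrite mulrBl.
by rewrite sumrB !sum_eqn -mulrBl -mulrBl.
Qed.

Let contrast_unit i l m : l != m -> dotp (contrast i l m) (contrast i l m) = 1.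
Proof.
by move=> lm; rewrite dotp_contrast !eqxx (negbTE lm) eq_sym (negbTE lm) S1 /=; field.
Qed.

Let contrast_pos i l m w :
  (0 < dotp (contrast i l m) (z^~ w)) = (latent i m w < latent i l w).
Proof. by rewrite contrast_latent pmulr_lgt0 ?invr_gt0// subr_gt0. Qed.

(** Sheppard's formula for a form and its opposite: they are at angle pi, and
    they have different signs exactly where neither vanishes. *)
Lemma latent_ties i l m : l != m -> P [set w | latent i l w != latent i m w] = 1%E.
Proof.
move=> lm; have ml : m != l by rewrite eq_sym.
have lk : (l, k0) != (m, k0) by rewrite xpair_eqE (negbTE lm).
have := sheppard nz lk (contrast_unit i lm) (contrast_unit i ml).
rewrite dotp_contrast !eqxx (negbTE lm) (negbTE ml) S1 /=.
have -> : (0 - 1 - (1 - 0)) * 1 / 2 = -1 :> R by field.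
rewrite acosN1 divff ?gt_eqF ?pi_gt0// => <-; congr (P _).
apply/seteqP; split => w /=; rewrite !contrast_pos; by case: ltgtP.
Qed.

(** The contrasts of (l, m) in variable [i] and of (l, m') in variable [j]
    share only the observation [l], hence have inner product S i j / 2. *)
Definition latent_discordance i j : R := acos (S i j / 2) / pi.

Lemma latent_discordance01 i j : 0 <= latent_discordance i j <= 1.
Proof.
have h : -1 <= S i j / 2 <= 1.
  by have := S_le1 i j; rewrite ler_norml => /andP[h1 h2]; apply/andP; split; lra.
rewrite /latent_discordance divr_ge0 ?acos_ge0 ?pi_ge0//=.
by rewrite ler_pdivrMr ?pi_gt0// mul1r acos_lepi.
Qed.

(** Why the rank correlation is corrected by 2 sin (pi / 6 * _): the limit of
    Spearman's correlation is 3 (1 - 2 acos (S i j / 2) / pi), which equals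
    6 / pi * asin (S i j / 2). *)
Lemma latent_correlation i j :
  S i j = 2 * sin (pi / 6 * (3 * (1 - 2 * latent_discordance i j))).
Proof.
have h : -1 <= S i j / 2 <= 1.
  by have := S_le1 i j; rewrite ler_norml => /andP[h1 h2]; apply/andP; split; lra.
have -> : pi / 6 * (3 * (1 - 2 * latent_discordance i j)) = - (acos (S i j / 2) - pi / 2).
  rewrite /latent_discordance; have := lt0r_neq0 (@pi_gt0 R).
  by move: (acos _) (pi : R) => a q q0; field.
by rewrite sinN sinBpihalf opprK acosK ?in_itv//=; field.
Qed.

Definition latent_discordant i j (t : triple) (w : T) : bool :=
  discordant (fun l => latent i l w) (fun l => latent j l w) t.

Lemma latent_discordantP i j t : distinct t ->
  P [set w | latent_discordant i j t w] = (latent_discordance i j)%:E.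
Proof.
case: t => -[l m] m' /and3P[/= lm lm' mm'].
have lk : (l, k0) != (m, k0) by rewrite xpair_eqE (negbTE lm).
have := sheppard nz lk (contrast_unit i lm) (contrast_unit j lm').
rewrite dotp_contrast !eqxx (negbTE lm') (negbTE mm') eq_sym (negbTE lm) /=.
have -> : (1 - 0 - (0 - 0)) * S i j / 2 = S i j / 2 by ring.
move=> <-; congr (P _); apply/seteqP; split => w /=;
  by rewrite !contrast_pos /latent_discordant /discordant.
Qed.

Lemma measurable_discordant d' (T' : measurableType d') (y y' : 'I_n -> T' -> R)
    (t : triple) : measurable_fun setT (y t.1.1) -> measurable_fun setT (y t.1.2) ->
  measurable_fun setT (y' t.1.1) -> measurable_fun setT (y' t.2) ->
  measurable_fun setT (fun w => discordant (y^~ w) (y'^~ w) t).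
Proof.
by move=> *; apply: measurable_fun_neqb; exact: measurable_fun_ltr.
Qed.

Lemma measurable_latent_discordant i j t : measurable_fun setT (latent_discordant i j t).
Proof. by apply: measurable_discordant; exact: measurable_latent. Qed.

(** The event of a triple depends only on the block of variables [z] of its
    three observations, and disjoint blocks are independent. *)
Lemma latent_discordant_indep i j (m : nat) (tau : 'I_m -> triple) (u : 'I_m -> bool) :
  (forall b b' l l', l \in [:: (tau b).1.1; (tau b).1.2; (tau b).2] ->
     l' \in [:: (tau b').1.1; (tau b').1.2; (tau b').2] -> l = l' -> b = b') ->
  P [set w | forall b, latent_discordant i j (tau b) w = u b]
  = (\prod_b P [set w | latent_discordant i j (tau b) w = u b])%E.
Proof.
move=> tauD.
pose a (b : 'I_m) (lk : 'I_n * 'I_p) :=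
  lk.1 \in [:: (tau b).1.1; (tau b).1.2; (tau b).2].
have ind : indep_sets P (fun b => block_rects z (a b)).
  apply: (@block_rects_indep R _ T P _ _ z (fun _ => normal_prob (0 : R) 1)).
  - by move=> _; exact: probability_setT.
  - by have [] := nz.
  - by move=> lk b b' h h'; exact: (tauD b b' _ _ h h').
apply: (indep_sets_sigma _ _ _ ind) => [b|b|b|b].
- exact: block_rects_measurable.
- exact: block_rectsI.
- exact: block_rectsT.
- have ml i' l : l \in [:: (tau b).1.1; (tau b).1.2; (tau b).2] ->
      @measurable_fun _ _ (g_sigma_algebraType (block_rects z (a b))) R setT (latent i' l).
    move=> lb; apply: measurable_sum => k; apply: measurable_funM => //.
    exact: (@measurable_block R T _ z (a b) (l, k)).
  have := @measurable_discordant _ (g_sigma_algebraType (block_rects z (a b)))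
    (latent i) (latent j) (tau b).
  move=> /(_ _ _ _ _) mD.
  have {}mD := mD (ml _ _ _) (ml _ _ _) (ml _ _ _) (ml _ _ _).
  have := mD _ _ _ _ measurableT [set u b].
  rewrite setTI; apply => //; rewrite !inE eqxx ?orbT//.
Qed.

End latent.

(** * Concentration of the rank-based correlation estimate *)

Section concentration.
Context {R : realType} (n p : nat).
Context d0 (T0 : measurableType d0) (P0 : probability T0 R).
Context d (T : measurableType d) (P : probability T R).
Variables (X : 'I_p -> {RV P0 >-> R}) (x : 'I_n -> 'I_p -> {RV P >-> R}).
Variable S : 'M[R]_p.

Definition sample (w : T) : 'M[R]_(n, p) := \matrix_(l, i) x l i w.

(** The good event asks that every U-statistic deviates from its mean by at
    most t = delta / (6 pi), that all observations lie in the intervals on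
    which the transformations are monotone, and that the latent variables have
    no ties; the last two requirements have probability one.  On this event
    the observations are ordered like the latent variables, so that the
    estimate errs by at most (pi / 3) (6 t + 12 / (n + 1)), the sum of
    delta / 3 and of the bias 4 pi / (n + 1). *)
Lemma rank_correlation_concentration (delta : R) :
  correlation_mx S -> nonparanormal X S -> iid_copies X x ->
  (3 <= n)%N -> (0 < p)%N ->
  4 * pi / (n%:R + 1) <= 2 / 3 * delta -> 0 <= delta <= 3 * pi ->
  exists F : set T, [/\ measurable F,
    forall w, F w -> (forall i, Rs (sample w) i i = 1) /\
      (forall i j, `|Rs (sample w) i j - S i j| <= delta)
    & 1 - p%:R ^+ 2 * (2 * expR (- (n%:R * (delta / (6 * pi)) ^+ 2 / 24))) <= fine (P F)].
Proof.
move=> Scorr npX iidx n3 p0 bias /andP[delta0 delta1].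
have pi0 := @pi_gt0 R.
have [A [f [D [z [AS nz fD xD fx]]]]] :=
  latent_sample iidx (posdef_unitmx Scorr.1) npX.
have S_le1 := corr_le1 Scorr.
pose y := latent A z; pose t := delta / (6 * pi).
have t01 : 0 <= t <= 1 / 2.
  apply/andP; split; first by rewrite /t divr_ge0//; lra.
  by rewrite /t ler_pdivrMr; lra.
pose r := latent_discordance S.
pose dev i j w := t < `|ustat ((latent_discordant A z i j)^~ w) - r i j|.
have mdev i j : measurable [set w | dev i j w].
  exact: (measurable_ustat_event (measurable_latent_discordant A nz i j)
    (fun v => t < `|ustat v - r i j|)).
pose domain (li : 'I_n * 'I_p) := x li.1 li.2 @^-1` [set` D li.2].
pose untied (ilm : 'I_p * ('I_n * 'I_n)) := [set w | ilm.2.1 != ilm.2.2 ->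
  y ilm.1 ilm.2.1 w != y ilm.1 ilm.2.2 w].
have mdomain li : measurable (domain li).
  have mx : measurable_fun setT (x li.1 li.2) by exact: measurable_funPT.
  by rewrite /domain -[X in measurable X]setTI; apply: mx => //; exact: measurable_itv.
have untied_or ilm : untied ilm = setT \/ ilm.2.1 != ilm.2.2.
  case: eqVneq => [e|]; [left|by right].
  by apply/seteqP; split => // w _; rewrite /untied /= e eqxx.
have muntied ilm : measurable (untied ilm).
  have [->//|lm] := untied_or ilm.
  rewrite (_ : untied ilm = [set w | y ilm.1 ilm.2.1 w != y ilm.1 ilm.2.2 w]); last first.
    by apply/seteqP; split => w /=; [apply|move=> ? _].
  apply: measurable_set_bool; apply: measurable_neg.
  by apply: measurable_fun_eqr; exact: (measurable_latent A nz).
have Puntied ilm : P (untied ilm) = 1%E.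
  have [->|lm] := untied_or ilm; first exact: probability_setT.
  rewrite -(latent_ties AS Scorr.2 nz p0 ilm.1 lm); congr (P _).
  by apply/seteqP; split => w /=; [apply|move=> ? _].
(* [dev] speaks of the latent sample; on [sure] the observations have the
   same order. *)
pose sure := [set w | forall li, domain li w] `&` [set w | forall ilm, untied ilm w].
have msure : measurable sure.
  by apply: measurableI; exact: measurable_forall.
have Psure : P sure = 1%E.
  rewrite prob_setI_sure//; [|exact: measurable_forall..|exact: prob_forall_sure].
  by apply: prob_forall_sure => // li; exact: xD.
pose close := [set w | forall ij : 'I_p * 'I_p, (~` [set w | dev ij.1 ij.2 w]) w].
have mclose : measurable close.
  by apply: measurable_forall => ij; exact: measurableC.
exists (close `&` sure); split.
- exact: measurableI.
- move=> w [wclose [wdomain wuntied]].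
  have yx i l : y i l w = f i (x l i w).
    by rewrite fx//; exact: (wdomain (l, i)).
  have yinj i l m : y i l w = y i m w -> l = m.
    move=> e; apply/eqP/negPn/negP => lm.
    by have := wuntied (i, (l, m)) lm; rewrite /= e eqxx.
  pose u i l := x l i w.
  have uinj i : injective (u i) by move=> l m e; apply: (yinj i); rewrite !yx -!/(u i _) e.
  have ult i l m : l != m -> (u i l < u i m) = (y i l w < y i m w).
    move=> lm; have yne : y i l w != y i m w by apply: contra lm => /eqP/yinj ->.
    apply/idP/idP => h.
      rewrite lt_neqAle yne !yx fD//; [exact: (wdomain (l, i))|exact: (wdomain (m, i))|exact: ltW].
    rewrite ltNge; apply/negP => ml; move: h; apply/negP; rewrite -leNgt !yx.
    by rewrite fD//; [exact: (wdomain (m, i))|exact: (wdomain (l, i))].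
  have rkE' i : (fun l => (Defs.rank (fun m => sample w m i) l)%:R) = rk (u i).
    apply/funext => l; rewrite /rk; congr (Defs.rank _ l)%:R.
    by apply/funext => m; rewrite mxE.
  have spE i j : Defs.spearman (sample w) i j = pearson (rk (u i)) (rk (u j)).
    by rewrite /Defs.spearman !rkE'.
  split=> [i|i j].
    rewrite mxE spE pearson_rank_diag//; last exact: leq_trans n3.
    by rewrite mulr1 sin_pi6; field.
  have ustatE : ustat (discordant (u i) (u j))
      = ustat ((latent_discordant A z i j)^~ w) :> R.
    congr (_ / _); apply: eq_bigr => -[[l m] m'] /and3P[/= lm lm' mm'].
    by rewrite /latent_discordant /discordant /= !ult 1?eq_sym.
  have dev_le : `|ustat (discordant (u i) (u j)) - r i j| <= t.
    by rewrite ustatE leNgt; apply/negP; exact: (wclose (i, j)).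
  have := spearman_ustat n3 (uinj i) (uinj j) (latent_discordance01 S_le1 i j).
  rewrite -/(r i j) => sp.
  rewrite mxE spE (latent_correlation S_le1 i j) -/(r i j) -mulrBr normrM ger0_norm//.
  apply: (@le_trans _ _ (2 * `|pi / 6 * pearson (rk (u i)) (rk (u j))
      - pi / 6 * (3 * (1 - 2 * r i j))|)).
    by rewrite ler_pM2l// sin_lipschitz.
  rewrite -mulrBr normrM (gtr0_norm (x := pi / 6)) ?divr_gt0//.
  have h1 : `|pearson (rk (u i)) (rk (u j)) - 3 * (1 - 2 * r i j)| <= 6 * t + 12 / (n%:R + 1).
    by apply: (le_trans sp); rewrite lerD2r ler_pM2l.
  have h2 : 2 * (pi / 6) * (6 * t) = delta / 3.
    by rewrite /t; move: (lt0r_neq0 pi0); move: (pi : R) => q q0; field.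
  have h3 : 2 * (pi / 6) * (12 / (n%:R + 1)) = 4 * pi / (n%:R + 1) :> R.
    have n1 : n%:R + 1 != 0 :> R by rewrite natr1 pnatr_eq0.
    by move: (pi : R) => q; field.
  apply: (@le_trans _ _ (2 * (pi / 6) * (6 * t + 12 / (n%:R + 1)))).
    by rewrite -mulrA ler_pM2l// ler_pM2l// divr_gt0.
  by rewrite mulrDr h2 h3; lra.
- rewrite prob_setI_sure//.
  have := @union_bound _ _ _ P ('I_p * 'I_p)%type (fun ij => ~` [set w | dev ij.1 ij.2 w])
    (2 * expR (- (n%:R * t ^+ 2 / 24))).
  rewrite card_prod card_ord natrM -expr2; apply => [ij|ij]; first exact: measurableC.
  rewrite setCK.
  apply: (ustat_concentration (measurable_latent_discordant A nz ij.1 ij.2)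
    (latent_discordantP AS Scorr.2 nz p0 ij.1 ij.2) _ n3 t01) => m tau b.
  exact: (latent_discordant_indep A nz).
Qed.

End concentration.

Lemma psi_min_le_M (R : realType) (p : nat) (S : 'M[R]_p) :
  edges S != finset.set0 -> psi_min S <= M_ S.
Proof.
move=> Se; have [_ psi_le] := psi_minP Se.
have /finset.set0Pn[[i j] ijE] := Se.
apply: (le_trans (psi_le i j ijE)); apply: le_trans (norm_l1_ge (Theta S) j).
by rewrite (bigD1 i)//= lerDl sumr_ge0.
Qed.

(** * Sign consistency of the adaptive estimator *)

Theorem theorem5 (R : realType) :
  exists2 c0 : R, 0 < c0 &
  forall (p : nat -> nat) (Sigma : forall n, 'M[R]_(p n)) (lc lac : nat -> R)
    (d0 : nat -> measure_display)
    (Omega0 : forall n, measurableType (d0 n))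
    (P0 : forall n, probability (Omega0 n) R)
    (X : forall n, 'I_(p n) -> {RV (P0 n) >-> R})
    (dd : nat -> measure_display)
    (Omega : forall n, measurableType (dd n))
    (P : forall n, probability (Omega n) R)
    (x : forall n, 'I_n -> 'I_(p n) -> {RV (P n) >-> R}),
  (forall n, (0 < n)%N ->
     [/\ correlation_mx (Sigma n), edges (Sigma n) != finset.set0,
         nonparanormal (@X n) (Sigma n)
       & iid_copies (@X n) (@x n)]) ->
  (max_degree (Sigma n))%:R * lc n @[n --> \oo] --> (0 : R) ->
  (max_degree (Sigma n))%:R * lac n @[n --> \oo] --> (0 : R) ->
  forall n, (0 < n)%N ->
  let S := Sigma n in
  let psi := psi_min S in
  let M := M_ S in
  let d : R := (max_degree S)%:R in
  (forall k : 'I_(p n),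
     let G := G_ S k in
     let H := H_ S k in
     [/\ lc n <= Num.min (psi / (4 * M))
                   (1 / (4 * M * (psi + 2 * G) * d) - 2 / (M * n%:R)),
         12 * pi * M / n%:R <= lc n,
         lac n <= psi ^+ 2 / (8 * G),
         Num.max (12 * pi / n%:R)
           ((2 * M * lc n + 1 / n%:R) * (H * psi / G)) <= lac n
       & ((d * lac n)%:E <=
          Order.min (lambda_min (set_submx (adj S k) (adj S k) S))
            (Num.min (1 / (2 * G)) (psi / (4 * G * (psi + G))))%:E)%E]) ->
  holds_with_prob (P n)
    [set w | aclime_sign_consistent S (lc n) (lac n)
               (\matrix_(l, i) x n l i w)]
    (1 - (p n)%:R ^+ 2 *
         expR (- (c0 * n%:R * Num.min (lac n ^+ 2) (lc n ^+ 2 / M ^+ 2)))).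
Proof.
have pi0 := @pi_gt0 R.
(* With delta = m / 2 the concentration exponent is
   n (m / (12 pi))^2 / 24.  Half of it is kept as c0 n m^2, the other half
   absorbs the factor 2 in front of the exponential. *)
exists (48 * (12 * pi) ^+ 2)^-1; first by rewrite invr_gt0 mulr_gt0// exprn_gt0// mulr_gt0.
move=> p Sigma lc lac d0 Omega0 P0 X dd Omega P x model _ _ n n0 S psi M d hyp.
have [Scorr Sedges npX iidx] := model n n0; rewrite -/S in Scorr Sedges npX.
have [psi0 psi_le] := psi_minP Sedges; rewrite -/psi in psi0 psi_le.
have /finset.set0Pn[[i0 j0] ij0] := Sedges.
have p2 : (2 <= p n)%N.
  have i0j0 : i0 != j0 by move: ij0; rewrite finset.inE => /andP[].
  rewrite -[p n]card_ord; apply: leq_trans (max_card (pred2 i0 j0)).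
  by rewrite card2 i0j0.
have M1 : 1 <= M := M_ge1 Scorr i0.
have M0 : 0 < M by exact: lt_le_trans M1.
have psiM : psi <= M := psi_min_le_M Sedges.
have nR : 0 < n%:R :> R by rewrite ltr0n.
have lc_lb : 12 * pi * M / n%:R <= lc n by have [] := hyp i0.
have lc0 : 0 < lc n.
  by apply: lt_le_trans lc_lb; rewrite !mulr_gt0// invr_gt0.
have lc_ub : lc n <= psi / (4 * M) by have [] := hyp i0; rewrite le_min => /andP[].
have lac_lb : 12 * pi / n%:R <= lac n by have [_ _ _] := hyp i0; rewrite ge_max => /andP[].
have lac0 : 0 < lac n by apply: lt_le_trans lac_lb; rewrite !mulr_gt0// invr_gt0.
(* [m / 2] is the accuracy demanded from the correlation estimate; both stages
   allow it. *)
pose m := Num.min (lac n) (lc n / M).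
have m0 : 0 < m by rewrite lt_min lac0 divr_gt0.
have m_sq : Num.min (lac n ^+ 2) (lc n ^+ 2 / M ^+ 2) = m ^+ 2.
  rewrite /m -expr_div_n.
  have [le|lt] := leP (lac n) (lc n / M).
    by apply/min_idPl; rewrite ler_sqr ?nnegrE ?divr_ge0// ltW.
  by apply/min_idPr; rewrite ler_sqr ?nnegrE ?divr_ge0// ltW.
have m_lb : 12 * pi / n%:R <= m.
  rewrite le_min lac_lb /= ler_pdivlMr//.
  by apply: le_trans lc_lb; rewrite mulrAC.
have m_ub : m <= 1 / 4.
  apply: (@le_trans _ _ (lc n / M)); first by rewrite ge_min lexx orbT.
  rewrite ler_pdivrMr//; apply: (le_trans lc_ub).
  rewrite ler_pdivrMr ?mulr_gt0//; apply: (le_trans psiM).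
  have -> : 1 / 4 * M * (4 * M) = M * M by field.
  by rewrite ler_peMl// ltW.
have n3 : (3 <= n)%N.
  rewrite -(ler_nat R); have := le_trans m_lb m_ub.
  rewrite ler_pdivrMr//; have := @pi_ge2 R; lra.
rewrite /holds_with_prob m_sq.
set y := expR _.
have y0 : 0 < y by exact: expR_gt0.
(* If p^2 y >= 1 the claimed bound is not positive.  Otherwise 4 y < 1, as
   p >= 2, and the concentration bound satisfies 2 y^2 <= y. *)
have [trivial|nontrivial] := leP 1 ((p n)%:R ^+ 2 * y).
  exists set0; split=> //; rewrite measure0 lee_fin; lra.
have y4 : 4 * y < 1.
  apply: le_lt_trans nontrivial; rewrite ler_pM2r//.
  have : 2 <= (p n)%:R :> R by rewrite (ler_nat _ 2).
  by move=> h; nra.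
have bias : 4 * pi / (n%:R + 1) <= 2 / 3 * (m / 2).
  apply: (@le_trans _ _ (4 * pi / n%:R)).
    by rewrite ler_pM2l ?mulr_gt0// lef_pV2 ?posrE// ?addr_gt0// lerDl.
  have e : 4 * pi / n%:R = 12 * pi / n%:R / 3 :> R.
    by move: (lt0r_neq0 nR); move: (pi : R) => q n1; field.
  by rewrite e; lra.
have delta_ok : 0 <= m / 2 <= 3 * pi.
  by apply/andP; split; [rewrite divr_ge0// ltW|have := @pi_ge2 R; lra].
have [F [mF Fgood PF]] := rank_correlation_concentration Scorr npX iidx n3
  (ltnW p2) bias delta_ok.
exists F; split => //; last first.
  rewrite -(fineK (fin_num_measure (P n) F mF)) lee_fin; apply: le_trans PF.
  rewrite lerD2l lerN2 ler_wpM2l ?sqr_ge0//.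
  have -> : - (n%:R * (m / 2 / (6 * pi)) ^+ 2 / 24)
    = - ((48 * (12 * pi) ^+ 2)^-1 * n%:R * m ^+ 2) + - ((48 * (12 * pi) ^+ 2)^-1 * n%:R * m ^+ 2).
    by move: (lt0r_neq0 pi0); move: (pi : R) => q q0; field.
  by rewrite expRD -/y; nra.
move=> w /Fgood[Q1 QS].
have Qs : (Rs (sample (x n) w))^T = Rs (sample (x n) w).
  apply/matrixP => i j; rewrite !mxE; congr (2 * sin (_ * _)).
  by rewrite /Defs.spearman /pearson [X in X / _ = _](eq_bigr _ (fun l _ => mulrC _ _)) [X in _ / X = _]mulrC.
have m_lac : m / 2 <= lac n / 2 by rewrite ler_pM2r// ge_min lexx.
have m_lc : M * (m / 2) <= lc n / 2.
  rewrite mulrA ler_pM2r// mulrC -ler_pdivlMr//.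
  by rewrite ge_min lexx orbT.
have hyp' k : d * lac n <= Num.min (1 / (2 * G_ S k)) (psi / (4 * G_ S k * (psi + G_ S k))).
  by have [_ _ _ _] := hyp k; rewrite le_min => /andP[_]; rewrite lee_fin.
apply: (@clime_sign_recovery R (p n) S (Rs (sample (x n) w)) n (lc n) (lac n) (m / 2)) => //.
- by move=> k; have [] := hyp k; rewrite le_min => /andP[].
- by move=> k; have [] := hyp k.
- by move=> k; have [_ _ _] := hyp k; rewrite ge_max => /andP[].
- by move=> k; have := hyp' k; rewrite le_min => /andP[].
- by move=> k; have := hyp' k; rewrite le_min => /andP[].
- by move=> i j; rewrite !mxE; have := QS i j; rewrite !mxE.
Qed.
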